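(* Let $\alpha\geq \tfrac12$ and let $f\in L^1(\mathbb{R}_+,\omega_\alpha)$ be such that its Fourier transform satisfies $\hat f(\lambda)\geq 0$ for all $\lambda\in\mathbb{R}_+$. Then the following statements are equivalent: (i) $f$ is square integrable on a neighborhood of $0$, i.e. there is $\delta>0$ with $\int_0^\delta |f|^2\,d\omega_\alpha<\infty$; (ii) $\hat f\in (L^1,\ell^2)(\mathbb{R}_+,*_\alpha)$; (iii) $f\in (L^2,\ell^\infty)(\mathbb{R}_+,*_\alpha)$.
   Context: Fix $\alpha\geq\tfrac12$. The Bessel–Kingman hypergroup is $(\mathbb{R}_+,*_\alpha)$, $\mathbb{R}_+=[0,\infty)$, with identity involution, Haar measure $\omega_\alpha(dz)=z^{2\alpha+1}dz$, and convolution of point masses given for $x,y>0$ by $\varepsilon_x*_\alpha\varepsilon_y(f)=\int_{|x-y|}^{x+y}K_\alpha(x,y,z)f(z)z^{2\alpha+1}dz$, where $K_\alpha(x,y,z)=C_\Gamma\,\frac{[(z^2-(x-y)^2)((x+y)^2-z^2)]^{\alpha-1/2}}{(xyz)^{2\alpha}}$, $C_\Gamma=\frac{\Gamma(\alpha+1)}{\Gamma(1/2)\Gamma(\alpha+1/2)2^{2\alpha-1}}$, and $\varepsilon_0$ is the identity. The characters are $\chi_\lambda(x)=j_\alpha(\lambda x)$, $\lambda\in\mathbb{R}_+$, where $j_\alpha(x)=\sum_{k\ge0}\frac{(-1)^k\Gamma(\alpha+1)}{2^{2k}k!\Gamma(\alpha+k+1)}x^{2k}$; the dual is identified with $\mathbb{R}_+$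 via $\lambda\mapsto\chi_\lambda$, and the Fourier transform of $f\in L^1(\omega_\alpha)$ is $\hat f(\lambda)=\int_{\mathbb{R}_+} f(x)\chi_\lambda(x)\,d\omega_\alpha(x)$. Let $I_n=[n-1,n)$ and $\omega_n=\omega_\alpha(I_n)$ for $n\ge1$. For $1\le p,q<\infty$ the discrete amalgam norm is $\|f\|_{p,q}=\big(\sum_{n\ge1}\omega_n\big(\frac1{\omega_n}\int_{I_n}|f|^p d\omega_\alpha\big)^{q/p}\big)^{1/q}$, with the usual modifications $\|f\|_{\infty,q}=(\sum_n\omega_n\sup_{I_n}|f|^q)^{1/q}$, $\|f\|_{p,\infty}=\sup_n(\frac1{\omega_n}\int_{I_n}|f|^pd\omega_\alpha)^{1/p}$, $\|f\|_{\infty,\infty}=\|f\|_\infty$; $(L^p,\ell^q)(\mathbb{R}_+,*_\alpha)$ is the space of measurable $f$ with $\|f\|_{p,q}<\infty$. *)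

(* Defs.v *)
From HB Require Import structures.
From mathcomp Require Import all_boot all_order all_algebra.
From mathcomp Require Import all_classical all_reals all_analysis.
Set Implicit Arguments. Unset Strict Implicit. Unset Printing Implicit Defensive.
Import Order.TTheory GRing.Theory Num.Theory.
Import numFieldNormedType.Exports.
Local Open Scope classical_set_scope.
Local Open Scope ring_scope.

Section BesselKingman.
Variable R : realType.
Local Notation mu := (@lebesgue_measure R).

(* coefficient of x^(2k) in j_alpha:
   (-1)^k Gamma(a+1) / (2^(2k) k! Gamma(a+k+1))
   = (-1)^k / (2^(2k) k! prod_{i=1..k} (a+i))  (functional equation of Gamma) *)
Definition j_coef (a : R) (k : nat) : R :=
  (-1) ^+ k / (2 ^+ (2 * k) * (k`!)%:R * \prod_(1 <= i < k.+1) (a + i%:R)).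

Definition j_alpha (a x : R) : R :=
  limn (fun n : nat => \sum_(0 <= k < n) (j_coef a k * x ^+ (2 * k))).

(* density of the Haar measure omega_alpha(dz) = z^(2a+1) dz on [0,oo) *)
Definition wgt (a x : R) : R := x `^ (2 * a + 1).

(* A complex-valued function f = u + i v on R_+ is given by its real and
   imaginary parts u, v. |f| = sqrt(u^2+v^2). *)
Definition cmod (u v : R -> R) (x : R) : R := Num.sqrt (u x ^+ 2 + v x ^+ 2).

Definition in_L1 (a : R) (u v : R -> R) : Prop :=
  measurable_fun `[(0%R : R), +oo[ u /\ measurable_fun `[(0%R : R), +oo[ v /\
  (\int[mu]_(x in `[(0%R : R), +oo[) (cmod u v x * wgt a x)%:E < +oo)%E.

Definition fhat_re (a : R) (u : R -> R) (l : R) : \bar R :=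
  \int[mu]_(x in `[(0%R : R), +oo[) (u x * j_alpha a (l * x) * wgt a x)%:E.
Definition fhat_im (a : R) (v : R -> R) (l : R) : \bar R :=
  \int[mu]_(x in `[(0%R : R), +oo[) (v x * j_alpha a (l * x) * wgt a x)%:E.

Definition fhat_abs (a : R) (u v : R -> R) (l : R) : R :=
  Num.sqrt (fine (fhat_re a u l) ^+ 2 + fine (fhat_im a v l) ^+ 2).

Definition In (n : nat) : set R := `[(n%:R - 1), n%:R[.
Definition omega_n (a : R) (n : nat) : R :=
  fine (\int[mu]_(x in In n) (wgt a x)%:E).

(* (1/omega_n) int_{I_n} |g|^p d omega_alpha, for a nonnegative g = |f| *)
Definition local_mean (a p : R) (g : R -> R) (n : nat) : \bar R :=
  ((omega_n a n)^-1)%:E * \int[mu]_(x in In n) ((g x `^ p) * wgt a x)%:E.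

Definition amalgam_norm (a p q : R) (g : R -> R) : \bar R :=
  poweR (\sum_(1 <= n <oo) ((omega_n a n)%:E * poweR (local_mean a p g n) (q / p)))%E
        (1 / q).

Definition amalgam_norm_inf (a p : R) (g : R -> R) : \bar R :=
  ereal_sup [set poweR (local_mean a p g n) (1 / p) | n in [set n : nat | (1 <= n)%N]].

End BesselKingman.

(* Main.v *)
Require Import Defs.
From HB Require Import structures.
From mathcomp Require Import all_boot all_order all_algebra.
From mathcomp Require Import all_classical all_reals all_analysis.
From mathcomp Require Import measurable_realfun ring lra.
Import Order.TTheory GRing.Theory Num.Theory.
Import numFieldNormedType.Exports.
Local Open Scope classical_set_scope.
Local Open Scope ring_scope.

(** Write j for the characters, W for the Haar density extended by 0, and H for
    the transform.

    (i) => (ii): choose a nonnegative bump g supported near 0 whose transform is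
    C j_{a+2}(sg l)^2; it comes from averaging Sonine's integrals of
    (1 - r^2/T)_+ with the product formula.  By the product formula again, the
    kernel K(l, m) = int g j(l x) j(m x) W is nonnegative and at least
    c / n^(2a+1) on I_n x I_n.  Positivity of F = H f and the inversion formula
    then bound sum_n (int_{I_n} F W)^2 / n^(2a+1) by the double integral of
    F(l) F(m) K(l, m) (truncated to [0, N]), which Cauchy-Schwarz bounds by
    int f^2 g W.

    (ii) => (iii): test f against phi supported in [n-1, n].  The inversion
    formula gives the pairing int F (H phi) W, bounded through
    sum_m m^(2a+1) sup_{I_m} |H phi|^2.  That sum is at most
    C n^(2a+1) int phi^2 W by the Plancherel inequality for the parameters a and
    a + 1, since the derivative of H_a phi is a multiple of t H_{a+1} phi, and
    n^2 <= n^(2a+1).  Taking for phi an approximation of f itself bounds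
    int_{I_n} f^2 W.  The imaginary part of f has zero transform, and the same
    bound applies to it.

    The inversion formula is obtained by Gaussian regularisation from the
    explicit heat kernel.  Cauchy-Schwarz is used as AM-GM throughout. *)

(** * Lebesgue integrals of real functions on the line *)

(** In (i) => (ii), [F] is only known to be bounded, so the double integral is cut at [N]: it is
    then finite, and the half of it that AM-GM puts on the right can be absorbed on the left. The
    sign of [F] is what allows the inversion integral of [F] to be bounded below by that of its cut
    version.

    The kernel must be nonnegative at every pair [l], [m]. A single Sonine bump transforms into
    [j_alpha (a + 2)], which changes sign; averaging the bumps over their width with the weight
    [kap] produces its square.

    The facts on Bessel functions come from power series and integration by parts: the moments of
    the Gegenbauer weight [rho] and of Gaussians obey recurrences that reproduce the coefficients
    [cc]. Double integrals are arranged to have majorants of product form, so that each exchange is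
    one use of Fubini.

    The condition [2^-1 <= a] keeps [rho] bounded and gives [2 <= 2 * a + 1], so that the weight
    [n ^ (2a+1)] pays for the factor [n ^+ 2] lost by differentiating the transform of a function
    supported in [[0, n]]. *)

Section Toolbox.
Context {R : realType}.
Local Notation mu := (@lebesgue_measure R).
Implicit Types f g h : R -> R.

(** Both [ig] and [it] integrate over the whole line: an interval enters as an indicator factor, and
    [[0, +oo[] through the weight [W], which vanishes for negative arguments. *)
Definition ig f : Prop := mu.-integrable setT (EFin \o f).
Definition it f : R := Rintegral mu setT f.

Lemma ig_meas {f} : ig f -> measurable_fun setT f.
Proof. by move=> /measurable_int /measurable_EFinP. Qed.

Lemma ig_dom {f} g : measurable_fun setT f -> ig g -> (forall x, `|f x| <= g x) -> ig f.
Proof.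
move=> mf gi fg; apply: le_integrable gi => //; first exact/measurable_EFinP.
by move=> x _ /=; rewrite lee_fin (le_trans (fg x))// ler_norm.
Qed.

Lemma it_fin f : ig f -> (\int[mu]_x (f x)%:E = (it f)%:E)%E.
Proof. by move=> fi; rewrite /it /Rintegral fineK//; exact: integrable_fin_num. Qed.

Lemma igD f g : ig f -> ig g -> ig (fun x => f x + g x).
Proof. move=> fi gi; exact: (integrableD measurableT fi gi). Qed.

Lemma igZ f (r : R) : ig f -> ig (fun x => r * f x).
Proof. move=> fi; exact: (integrableZl measurableT r fi). Qed.

Lemma igZr f (r : R) : ig f -> ig (fun x => f x * r).
Proof. by move=> fi; under eq_fun do rewrite mulrC; exact: igZ. Qed.

Lemma igB f g : ig f -> ig g -> ig (fun x => f x - g x).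
Proof. move=> fi gi; exact: (integrableB measurableT fi gi). Qed.

Lemma ig0 : ig (fun=> 0).
Proof. exact: integrable0. Qed.

Lemma ig_abs f : ig f -> ig (fun x => `|f x|).
Proof. by move=> fi; exact: integrable_norm. Qed.

Lemma ig_sum I (s : seq I) (h : I -> R -> R) :
  (forall i, ig (h i)) -> ig (fun x => \sum_(i <- s) h i x).
Proof.
move=> hi; elim: s => [|i s IH]; first by under eq_fun do rewrite big_nil; exact: ig0.
by under eq_fun do rewrite big_cons; exact: igD.
Qed.

Lemma itD f g : ig f -> ig g -> it (fun x => f x + g x) = it f + it g.
Proof. by move=> fi gi; rewrite /it RintegralD. Qed.

Lemma itB f g : ig f -> ig g -> it (fun x => f x - g x) = it f - it g.
Proof. by move=> fi gi; rewrite /it RintegralB. Qed.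

Lemma itZ f (r : R) : ig f -> it (fun x => r * f x) = r * it f.
Proof. by move=> fi; rewrite /it RintegralZl. Qed.

Lemma itZr f (r : R) : ig f -> it (fun x => f x * r) = it f * r.
Proof. by move=> fi; rewrite /it RintegralZr. Qed.

Lemma it0 : it (fun=> 0) = 0.
Proof. by rewrite /it /Rintegral integral0. Qed.

Lemma it_sum I (s : seq I) (h : I -> R -> R) :
  (forall i, ig (h i)) -> it (fun x => \sum_(i <- s) h i x) = \sum_(i <- s) it (h i).
Proof.
move=> hi; elim: s => [|i s IH].
  by under eq_fun do rewrite big_nil; rewrite big_nil it0.
under eq_fun do rewrite big_cons; rewrite big_cons itD// ?IH//.
exact: ig_sum.
Qed.

Lemma eq_it f g : f =1 g -> it f = it g.
Proof. by move=> /funext ->. Qed.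

Lemma eq_ig f g : f =1 g -> ig f -> ig g.
Proof. by move=> /funext ->. Qed.

Lemma it_le f g : ig f -> ig g -> (forall x, f x <= g x) -> it f <= it g.
Proof. by move=> fi gi fg; apply: le_Rintegral. Qed.

Lemma it_ge0 f : (forall x, 0 <= f x) -> 0 <= it f.
Proof. by move=> f0; apply: Rintegral_ge0. Qed.

Lemma it_norm f : ig f -> `|it f| <= it (fun x => `|f x|).
Proof. by move=> fi; apply: le_normr_Rintegral. Qed.

(** The almost everywhere form serves the inversion formula, whose test functions may jump at the
    ends of an interval. *)
Lemma it_dct_ae (fn : nat -> R -> R) f g :
  (forall n, measurable_fun setT (fn n)) -> measurable_fun setT f ->
  ig g -> (forall n x, `|fn n x| <= g x) ->
  {ae mu, forall x, fn n x @[n --> \oo] --> f x} ->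
  ig f /\ it (fn n) @[n --> \oo] --> it f.
Proof.
move=> mfn mf gi fg fnf.
have gf (h : R -> R) (hm : measurable_fun setT h) (hg : forall x, `|h x| <= g x) : ig h.
  exact: ig_dom gi hg.
have fnfE : {ae mu, forall x, setT x -> (EFin \o fn n) x @[n --> \oo] --> (EFin \o f) x}.
  apply: negligibleS fnf => x /= Hx Hf; apply: Hx => _.
  by apply: cvg_EFin => //; exact: nearW.
have fgE : {ae mu, forall x n, setT x -> (`|(EFin \o fn n) x| <= (EFin \o g) x)%E}.
  by apply: aeW => x n _; rewrite lee_fin.
have [H1 _ H2] := @dominated_convergence _ _ R mu setT measurableT _ _ _
  (fun n => (measurable_EFinP _ _).2 (mfn n)) ((measurable_EFinP _ _).2 mf) fnfE gi fgE.
split=> //.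
have fini n : ig (fn n) by apply: gf.
apply: fine_cvg; rewrite /= -it_fin//.
Qed.

Lemma it_dct (fn : nat -> R -> R) f g :
  (forall n, measurable_fun setT (fn n)) ->
  ig g -> (forall n x, `|fn n x| <= g x) ->
  (forall x, fn n x @[n --> \oo] --> f x) ->
  ig f /\ it (fn n) @[n --> \oo] --> it f.
Proof.
move=> mfn gi fg fnf; apply: it_dct_ae gi fg _ => //; last exact: aeW.
by apply: (measurable_fun_cvg mfn) => // x _; exact: fnf.
Qed.

Lemma meas_slice1 (f : R -> R -> R) x : measurable_fun setT (fun z : R * R => f z.1 z.2) ->
  measurable_fun setT (f x).
Proof. by move=> mf; apply: (measurableT_comp mf (measurable_pair1 x)). Qed.

Lemma meas_slice2 (f : R -> R -> R) y : measurable_fun setT (fun z : R * R => f z.1 z.2) ->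
  measurable_fun setT (fun x => f x y).
Proof. by move=> mf; apply: (measurableT_comp mf (measurable_pair2 y)). Qed.

Section Fubini.
Variables (f : R -> R -> R) (g h : R -> R).
Hypotheses (mf : measurable_fun setT (fun z : R * R => f z.1 z.2)).
Hypotheses (gi : ig g) (hi : ig h) (fgh : forall x y, `|f x y| <= g x * h y).

Lemma slice1_ig x : ig (f x).
Proof. by apply: (ig_dom (fun y => g x * h y)) => //; [exact: meas_slice1|exact: igZ]. Qed.

Lemma slice2_ig y : ig (fun x => f x y).
Proof. by apply: (ig_dom (fun x => g x * h y)) => //; [exact: meas_slice2|exact: igZr]. Qed.

Let F := fun z : R * R => (f z.1 z.2)%:E.

(** By Tonelli, the majorant [g x * h y] has the finite integral [it g * it h], so joint
    integrability follows from integrability of the two factors. *)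
Let Fi : (mu \x mu)%E.-integrable setT F.
Proof.
apply/integrable12ltyP; first exact/measurable_EFinP.
apply: (@le_lt_trans _ _ (\int[mu]_x (g x * it h)%:E)%E); last first.
  by rewrite it_fin ?ltry//; exact: igZr.
have nn x : (0 <= \int[mu]_y `|F (x, y)|)%E by apply: integral_ge0.
have Ex x : (\int[mu]_y `|F (x, y)| = (it (fun y => `|f x y|))%:E)%E.
  by rewrite -it_fin//; apply: ig_abs; exact: slice1_ig.
apply: ge0_le_integral => //.
- apply: (@measurable_fun_fubini_tonelli_F _ _ _ _ R mu (fun z => `|F z|%E)) => //.
  by apply: measurableT_comp => //; exact/measurable_EFinP.
- by apply/measurable_EFinP; apply: ig_meas; exact: igZr.
- move=> x _; rewrite Ex lee_fin -itZ//; apply: it_le; [|exact: igZ|exact: fgh].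
  by apply: ig_abs; exact: slice1_ig.
Qed.

Lemma fubini_ig1 : ig (fun x => it (f x)).
Proof.
have := integrable_fubini_F Fi; rewrite /fubini_F.
apply: eq_integrable => // x _ /=.
by rewrite (it_fin (f x))//; exact: slice1_ig.
Qed.

Lemma fubini_it : it (fun x => it (f x)) = it (fun y => it (fun x => f x y)).
Proof.
have := Fubini Fi; rewrite /F /=.
under eq_integral do rewrite (it_fin (f _) (slice1_ig _)).
under [X in _ = X -> _]eq_integral do rewrite (it_fin _ (slice2_ig _)).
by move=> H; rewrite {1 3}/it /Rintegral H.
Qed.

End Fubini.

Lemma fubini_ig2 (f : R -> R -> R) g h :
  measurable_fun setT (fun z : R * R => f z.1 z.2) -> ig g -> ig h ->
  (forall x y, `|f x y| <= g x * h y) -> ig (fun y => it (fun x => f x y)).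
Proof.
move=> mf gi hi fgh; apply: (@fubini_ig1 (fun y x => f x y) h g) => //.
  apply: (measurableT_comp (f := fun z : R * R => f z.1 z.2) (g := fun z : R * R => (z.2, z.1)) mf).
  by apply/measurable_fun_pair; [exact: measurable_snd|exact: measurable_fst].
by move=> x y; rewrite mulrC.
Qed.

Lemma it_indic (D : set R) f : measurable D ->
  (\int[mu]_(x in D) (f x)%:E = \int[mu]_x (\1_D x * f x)%:E)%E.
Proof.
move=> mD; rewrite integral_mkcond; apply: eq_integral => x _.
by rewrite patchE indicE; case: ifPn => _; rewrite ?mul1r// mul0r.
Qed.

Lemma ig_indic_bnd (A B : R) : ig (\1_`[A, B]).
Proof. by apply: (integrable_indic_itv). Qed.

Lemma cvg_le_cst (s : nat -> R) (l c : R) :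
  s n @[n --> \oo] --> l -> (forall n, s n <= c) -> l <= c.
Proof.
move=> sl sc; rewrite -(cvg_lim _ sl)//; apply: limr_le; last exact: nearW.
by apply/cvg_ex; exists l.
Qed.

Lemma cvg_ge_cst (s : nat -> R) (l c : R) :
  s n @[n --> \oo] --> l -> (forall n, c <= s n) -> c <= l.
Proof.
move=> sl sc; rewrite -(cvg_lim _ sl)//; apply: limr_ge; last exact: nearW.
by apply/cvg_ex; exists l.
Qed.

Lemma cvg_uniqueN (s : nat -> R) (l m : R) :
  s n @[n --> \oo] --> l -> s n @[n --> \oo] --> m -> l = m.
Proof. by move=> sl sm; rewrite -(cvg_lim _ sl)// (cvg_lim _ sm). Qed.

Lemma ig_fin (g : R -> R) : measurable_fun setT g -> (forall x, 0 <= g x) ->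
  (\int[mu]_x (g x)%:E < +oo)%E -> ig g.
Proof.
move=> mg g0 gf; apply/integrableP; split; first exact/measurable_EFinP.
by under eq_integral do rewrite /= ger0_norm//.
Qed.

(** For the case where integrability of the limit is itself the claim: the square of [f] is reached
    from those of its truncations. *)
Lemma ig_monotone (gk : nat -> R -> R) (g : R -> R) (C : R) :
  (forall k, ig (gk k)) -> (forall k x, 0 <= gk k x) ->
  (forall x, {homo gk^~ x : k m / (k <= m)%N >-> k <= m}) ->
  (forall x, gk k x @[k --> \oo] --> g x) -> (forall k, it (gk k) <= C) ->
  ig g /\ it g <= C.
Proof.
move=> ik k0 kh kg kC.
have mg : measurable_fun setT g by apply: (measurable_fun_cvg (fun k => ig_meas (ik k))) => x _; exact: kg.
have g0 x : 0 <= g x by apply: (cvg_ge_cst _ _ _ (kg x)).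
have gC : (\int[mu]_x (g x)%:E <= C%:E)%E.
  have := @cvg_monotone_convergence _ _ R mu setT measurableT (fun k x => (gk k x)%:E) _ _ _.
  have -> : (fun x => limn (fun k => (gk k x)%:E)) = (fun x => (g x)%:E).
    by apply/funext => x; apply/cvg_lim => //; apply: cvg_EFin (kg x); near=> k.
  move=> H; have {}H : (\int[mu]_x (gk k x)%:E)%E @[k --> \oo] --> (\int[mu]_x (g x)%:E)%E.
    apply: H => [k|k x _|x _ k m km]; [by apply/measurable_EFinP; exact: ig_meas (ik k)|by rewrite lee_fin|by rewrite lee_fin; exact: kh].
  rewrite -(cvg_lim _ H)//; apply: lime_le; first by apply/cvg_ex; eexists; exact: H.
  by near=> k; rewrite it_fin// lee_fin.
have ig_g : ig g by apply: ig_fin => //; exact: le_lt_trans gC (ltry _).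
by split=> //; rewrite -lee_fin -it_fin.
Unshelve. all: by end_near. Qed.

End Toolbox.

(** * Real powers extended by zero *)

Section Powers.
Context {R : realType}.
Local Notation mu := (@lebesgue_measure R).

Implicit Types p q x y : R.

(* Unlike [powR], zero for every exponent as soon as [x <= 0]. *)
Definition pw (p x : R) : R := if 0 < x then x `^ p else 0.

Lemma pw_pos p x : 0 < x -> pw p x = x `^ p.
Proof. by rewrite /pw => ->. Qed.

Lemma pw_neg p x : x <= 0 -> pw p x = 0.
Proof. by rewrite /pw ltNge => ->. Qed.

Lemma pw_powR p x : 0 < p -> 0 <= x -> pw p x = x `^ p.
Proof.
move=> p0; rewrite le_eqVlt => /predU1P[<-|/pw_pos//].
by rewrite pw_neg// powR0// gt_eqF.
Qed.

Lemma pw_ge0 p x : 0 <= pw p x.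
Proof. by rewrite /pw; case: ifP => // _; exact: powR_ge0. Qed.

Lemma pw_gt0 p x : 0 < x -> 0 < pw p x.
Proof. by move=> x0; rewrite pw_pos// powR_gt0. Qed.

Lemma pwE p x : pw p x = \1_`]0, +oo[ x * x `^ p.
Proof.
by rewrite /pw indicE mem_setE in_itv/= andbT; case: ifP => _; rewrite ?mul1r ?mul0r.
Qed.

Lemma pw_meas p : measurable_fun setT (pw p).
Proof.
rewrite (_ : pw p = fun x => \1_`]0, +oo[ x * x `^ p); last by apply/funext => x; exact: pwE.
by apply: measurable_funM; [exact: measurable_indic|exact: measurable_powR].
Qed.

Lemma pw_le p x y : 0 <= p -> x <= y -> pw p x <= pw p y.
Proof.
move=> p0 xy; have [x0|x0] := leP x 0; first by rewrite pw_neg// pw_ge0.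
rewrite !pw_pos ?(lt_le_trans x0)//; apply: ge0_ler_powR => //.
by rewrite nnegrE ltW. by rewrite nnegrE ltW// (lt_le_trans x0).
Qed.

Lemma pwM p x y : 0 <= x -> 0 <= y -> pw p (x * y) = pw p x * pw p y.
Proof.
rewrite le_eqVlt => /predU1P[<-|x0]; first by rewrite mul0r pw_neg// mul0r.
rewrite le_eqVlt => /predU1P[<-|y0]; first by rewrite mulr0 !(pw_neg p 0)// mulr0.
by rewrite !pw_pos// ?mulr_gt0// powRM// ltW.
Qed.

Lemma pwD p q x : pw (p + q) x = pw p x * pw q x.
Proof.
have [x0|x0] := leP x 0; first by rewrite !pw_neg// mul0r.
by rewrite !pw_pos// powRD//; apply/implyP => _; rewrite gt_eqF.
Qed.

Lemma pwXn p n x : pw (p + n%:R) x = pw p x * x ^+ n.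
Proof.
have [x0|x0] := leP x 0; first by rewrite !pw_neg// mul0r.
by rewrite !pw_pos// powRD ?powR_mulrn ?ltW//; apply/implyP => _; rewrite gt_eqF.
Qed.

Lemma pw_continuous p : 0 < p -> continuous (pw p).
Proof.
move=> p0 x; have [x0|x0|x0] := ltgtP x 0.
- have : {for x, continuous (fun=> 0 : R)} by exact: cvg_cst.
  rewrite /continuous_at (pw_neg p x (ltW x0)); apply: cvg_trans; apply: near_eq_cvg.
  by near=> y; rewrite pw_neg// ltW//; near: y; exact: lt_nbhsl.
- have : {for x, continuous (@powR R ^~ p)}.
    apply: differentiable_continuous; apply/derivable1_diffP.
    by apply: derivable_powR; rewrite in_itv/= x0.
  rewrite /continuous_at (pw_pos p x x0); apply: cvg_trans; apply: near_eq_cvg.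
  by near=> y; rewrite pw_pos//; near: y; exact: lt_nbhsr.
- rewrite x0 /continuous_at (pw_neg p 0)//; apply/cvgrPdist_lt => e e0; near=> y.
  rewrite sub0r normrN ger0_norm ?pw_ge0//.
  have [y0|y0] := leP y 0; first by rewrite pw_neg.
  rewrite pw_pos//.
  (* At 0, the claim that [y ^ p] is less than [e] becomes [y < e ^ (1/p)]. *)
  have -> : e = (e `^ p^-1) `^ p by rewrite -powRrM mulVf ?gt_eqF// powRr1 // ltW.
  apply: gt0_ltr_powR => //; rewrite ?nnegrE ?powR_ge0 ?(ltW y0)//.
  rewrite -(gtr0_norm y0); near: y.
  apply: (@cvgr0_norm_lt _ _ _ _ _ id); last exact: powR_gt0.
  exact: cvg_id.
Unshelve. all: by end_near. Qed.

Lemma pw_derive p x : 0 < x -> is_derive x 1 (pw p) (p * pw (p - 1) x).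
Proof.
move=> x0; rewrite pw_pos//; apply: (@near_eq_is_derive _ _ _ (@powR R ^~ p)).
by near=> y; rewrite pw_pos//; near: y; exact: lt_nbhsr.
exact: is_derive1_powR.
Unshelve. all: by end_near. Qed.

Lemma pw_le_exp p x : 0 <= p -> pw p x <= expR (p * x).
Proof.
move=> p0; have [x0|x0] := leP x 0; first by rewrite pw_neg// expR_ge0.
rewrite pw_pos// /powR gt_eqF// ler_expR ler_wpM2l//.
by rewrite ltW//; exact: ln_sublinear.
Qed.

Lemma ig_cont (f : R -> R) A B : {within `[A, B], continuous f} ->
  ig (fun x => \1_`[A, B] x * f x).
Proof.
move=> cf.
have H := continuous_compact_integrable (@segment_compact R A B) cf.
have {}H := (@integrable_mkcond _ _ R mu `[A, B] (EFin \o f) (measurable_itv _)).1 H.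
apply: eq_integrable H => // x _ /=.
by rewrite patchE indicE; case: ifP => _; rewrite ?mul1r// mul0r.
Qed.

Lemma it_FTC (F f : R -> R) A B : A < B ->
  {within `[A, B], continuous f} -> {within `[A, B], continuous F} ->
  (forall x, A < x < B -> is_derive x 1 F (f x)) ->
  it (fun x => \1_`[A, B] x * f x) = F B - F A.
Proof.
move=> AB cf cF dF; have [c1 c2 c3] := (continuous_within_itvP F AB).1 cF.
have := continuous_FTC2 AB cf; rewrite it_indic// it_fin; last exact: ig_cont.
move=> /(_ F) H; apply: EFin_inj; rewrite EFinB; apply: H.
- split=> // x; rewrite in_itv/= => xAB.
  exact: (@ex_derive _ _ _ _ _ _ _ (dF _ xAB)).
- move=> x; rewrite in_itv/= => xAB; rewrite derive1E.
  exact: (@derive_val _ _ _ _ _ _ _ (dF _ xAB)).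
Qed.

Lemma cont_within (f : R -> R) (D : set R) : continuous f -> {within D, continuous f}.
Proof. exact: continuous_subspaceT. Qed.

End Powers.

(** * Approximation by continuous functions *)

Section ContinuousApproximation.
Context {R : realType}.
Local Notation mu := (@lebesgue_measure R).

Definition clamp (K y : R) : R := Num.max (- K) (Num.min K y).

Lemma clamp_bnd K y : 0 <= K -> `|clamp K y| <= K.
Proof.
move=> K0; rewrite /clamp ler_norml le_max lexx /= ge_max ge_min lexx /= andbT.
lra.
Qed.

Lemma clamp_dist K x y : `|x| <= K -> `|x - clamp K y| <= `|x - y|.
Proof.
rewrite ler_norml => /andP[h1 h2]; rewrite /clamp.
have [h3|h3] := leP K y.
  by rewrite (max_idPr _); [rewrite !ler0_norm|]; lra.
by have [h4|h4] := leP (- K) y; [|rewrite !ger0_norm; lra].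
Qed.

Lemma clamp_continuous K : continuous (clamp K).
Proof.
move=> y; apply: (@continuous_max _ R^o (cst (- K)) (fun y => Num.min K y)); first exact: cst_continuous.
by apply: (@continuous_min _ R^o (cst K) id); first exact: cst_continuous.
Qed.

(** Continuous approximants in mean need not obey the bound [K]. Clamping them to [[-K, K]] restores
    it and, since [f] already lies there, never increases the distance to [f]. *)
Lemma cont_approx (p q K : R) (f : R -> R) : measurable_fun setT f -> (forall x, `|f x| <= K) ->
  exists g : nat -> R -> R, [/\ forall j, continuous (g j), forall j x, `|g j x| <= K &
    it (fun x => \1_`[p, q] x * `|f x - g j x|) @[j --> \oo] --> 0].
Proof.
move=> mf fK; have K0 : 0 <= K by apply: le_trans (fK 0).
have mD : measurable (`[p, q]%classic : set R) by exact: measurable_itv.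
have muD : (mu `[p, q]%classic < +oo)%E.
  by rewrite lebesgue_measure_itv/=; case: ifP => // _; rewrite -EFinD ltry.
have fi : mu.-integrable `[p, q] (EFin \o f).
  apply: measurable_bounded_integrable; [by []|exact: muD|exact: measurable_funTS|].
  exists K; split; first exact: num_real.
  by move=> M KM x _ /=; exact: le_trans (fK x) (ltW KM).
have [g [gc gi gl]] := approximation_continuous_integrable mD muD fi.
exists (fun j x => clamp K (g j x)); split.
- move=> j x; apply: continuous_comp; [exact: gc|exact: clamp_continuous].
- by move=> j x; exact: clamp_bnd.
have toig h : mu.-integrable `[p, q] (EFin \o h) -> ig (fun x => \1_`[p, q] x * h x).
  move=> H; have {}H := (@integrable_mkcond _ _ R mu `[p, q] (EFin \o h) (measurable_itv _)).1 H.
  apply: eq_integrable H => // x _ /=.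
  by rewrite patchE indicE; case: ifPn => _; rewrite ?mul1r// mul0r.
have di j : ig (fun x => \1_`[p, q] x * `|f x - g j x|).
  apply: eq_ig (ig_abs _ (igB _ _ (toig _ fi) (toig _ (gi j)))) => x.
  by rewrite -mulrBr normrM ger0_norm.
have di' j : ig (fun x => \1_`[p, q] x * `|f x - clamp K (g j x)|).
  apply: (ig_dom _ _ (di j)).
    apply: measurable_funM; first exact: measurable_indic.
    apply: measurableT_comp => //; apply: measurable_funB => //; apply: continuous_measurable_fun.
    move=> x; apply: continuous_comp; [exact: gc|exact: clamp_continuous].
  move=> x; rewrite normrM normr_id ger0_norm//; apply: ler_wpM2l => //; exact: clamp_dist.
have e j : (\int[mu]_(z in `[p, q]) `|(f z - g j z)%:E|)%E = (it (fun x => \1_`[p, q] x * `|f x - g j x|))%:E.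
  by rewrite -(it_fin _ (di j)) -it_indic.
have {}gl : it (fun x => \1_`[p, q] x * `|f x - g j x|) @[j --> \oo] --> (0 : R).
  by move: gl; under eq_cvg do rewrite e; move/fine_cvgP => [].
apply: (squeeze_cvgr _ (cvg_cst 0) gl); near=> j; apply/andP; split.
  by apply: it_ge0 => x; apply: mulr_ge0.
apply: it_le => // x; apply: ler_wpM2l => //; exact: clamp_dist.
Unshelve. all: by end_near. Qed.

End ContinuousApproximation.

(** * The Bessel series *)

Section PhiSeries.
Context {R : realType}.
Implicit Types (a x y z : R) (n k : nat).

(** [poch a k] is the rising factorial (a+1)_k, so that [Phi a z] below is the hypergeometric series
    0F1 with parameter a+1 at z/4. *)
Definition poch a k : R := \prod_(1 <= i < k.+1) (a + i%:R).
Definition cc a k : R := (4 ^+ k * (k`!)%:R * poch a k)^-1.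
Definition phis a n z : R := \sum_(0 <= k < n) cc a k * z ^+ k.
(* [j_alpha a x] is [Phi a (- x ^+ 2)]; positive arguments give the modified Bessel function of
   the heat kernel. *)
Definition Phi a z : R := limn (fun n => phis a n z).

Lemma j_alphaE a x : j_alpha a x = Phi a (- x ^+ 2).
Proof.
rewrite /j_alpha /Phi /phis; congr (limn _); apply/funext => n; apply: eq_bigr => k _.
rewrite /j_coef /cc -/(poch a k).
have -> : (- x ^+ 2) ^+ k = (-1) ^+ k * x ^+ (2 * k).
  rewrite (exprM x). rewrite (exprNn (x ^+ 2)). done.
have -> : 2 ^+ (2 * k) = 4 ^+ k :> R by rewrite exprM expr2 -natrM.
by rewrite mulrAC mulrC.
Qed.

Variable a : R.
Hypothesis a0 : 2^-1 <= a.

Let a_gt0 : 0 < a.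
Proof. by apply: lt_le_trans a0; rewrite invr_gt0. Qed.

Lemma pochS k : poch a k.+1 = poch a k * (a + k.+1%:R).
Proof. by rewrite /poch big_nat_recr. Qed.

Lemma poch0 : poch a 0 = 1.
Proof. by rewrite /poch big_geq. Qed.

Lemma poch_gt0 k : 0 < poch a k.
Proof.
elim: k => [|k IH]; first by rewrite poch0.
by rewrite pochS mulr_gt0// addr_gt0.
Qed.

Lemma cc0 : cc a 0 = 1.
Proof. by rewrite /cc poch0 expr0 fact0 !mulr1 invr1. Qed.

Lemma ccS k : cc a k.+1 = cc a k / (4 * k.+1%:R * (a + k.+1%:R)).
Proof.
rewrite /cc pochS factS natrM exprS -invfM; congr (_^-1).
by ring.
Qed.

Lemma cc_gt0 k : 0 < cc a k.
Proof. by rewrite invr_gt0 !mulr_gt0 ?exprn_gt0 ?ltr0n ?fact_gt0 ?poch_gt0. Qed.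

(** The ratio of successive coefficients is compared with that of the hyperbolic cosine:
    [4(k+1)(a+k+1)] exceeds [(2k+2)(2k+1)] by [2(k+1)(2a+1)]. The resulting bound of all partial
    sums by [expR (Num.sqrt |z|)] is a majorant for later termwise integrations. *)
Lemma cc_le k : cc a k <= ((2 * k)`!%:R)^-1.
Proof.
elim: k => [|k IH]; first by rewrite cc0 muln0 fact0 invr1.
have -> : (2 * k.+1 = (2 * k).+2)%N by rewrite mulnS.
have p0 : 0 < 4 * k.+1%:R * (a + k.+1%:R).
  by rewrite !mulr_gt0// addr_gt0.
rewrite ccS ler_pdivrMr// (le_trans IH)// !factS !natrM.
have f0 : 0 < (2 * k)`!%:R :> R by rewrite ltr0n fact_gt0.
have -> : (2 * k).+2%:R = 2 * k%:R + 2 :> R by rewrite -addn2 natrD natrM.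
have -> : (2 * k).+1%:R = 2 * k%:R + 1 :> R by rewrite -natr1 natrM.
rewrite -(natr1 k); set K := k%:R.
have k0 : 0 <= K by [].
have q0 : 0 < (2 * K + 2) * (2 * K + 1) by nra.
rewrite mulrA invfM mulrAC ler_peMl ?invr_ge0 ?(ltW f0)//.
have Ka : 0 <= K * a by rewrite mulr_ge0 ?(ltW a_gt0).
rewrite -[leLHS](mulVf (lt0r_neq0 q0)) ler_pM2l ?invr_gt0//.
rewrite -subr_ge0 (_ : _ - _ = 2 * (K + 1) * (2 * a + 1)); last by ring.
by rewrite !mulr_ge0 ?addr_ge0 ?mulr_ge0 ?(ltW a_gt0).
Qed.

Lemma expR_even_le n x : \sum_(0 <= k < n) (x ^+ (2 * k) / (2 * k)`!%:R) <= expR `|x|.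
Proof.
have H : \sum_(0 <= k < n) (x ^+ (2 * k) / (2 * k)`!%:R) <= series (exp_coeff `|x|) (2 * n)%N.
  elim: n => [|n IH]; first by rewrite muln0 /series/= !big_geq.
  rewrite /series/= mulnS !big_nat_recr//= -/(series _ _) -addrA lerD//.
  rewrite -[leLHS]addr0 lerD//; last by rewrite divr_ge0// exprn_ge0.
  rewrite /exp_coeff/=.
  by rewrite !exprM real_normK ?num_real.
apply: (le_trans H); apply: nondecreasing_cvgn_le; last exact: is_cvg_series_exp_coeff.
by apply: nondecreasing_series => k _ _; rewrite exp_coeff_ge0.
Qed.

Lemma expR_sum_le n x : `|\sum_(0 <= k < n) (x ^+ k / k`!%:R)| <= expR `|x|.
Proof.
apply: (@le_trans _ _ (series (exp_coeff `|x|) n)).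
  rewrite (le_trans (ler_norm_sum _ _ _))// ler_sum// => k _.
  by rewrite normrM normfV normrX normr_nat.
apply: nondecreasing_cvgn_le; last exact: is_cvg_series_exp_coeff.
by apply: nondecreasing_series => k _ _; rewrite exp_coeff_ge0.
Qed.

Lemma phis_sqr_le n x : phis a n (x ^+ 2) <= expR `|x|.
Proof.
apply: le_trans (expR_even_le n x); apply: ler_sum => k _.
rewrite -exprM mulrC ler_wpM2l ?cc_le//.
by rewrite exprM exprn_ge0// sqr_ge0.
Qed.

Lemma phis_norm n z : `|phis a n z| <= phis a n `|z|.
Proof.
rewrite (le_trans (ler_norm_sum _ _ _))// ler_sum// => k _.
by rewrite normrM normrX (gtr0_norm (cc_gt0 _)).
Qed.

Lemma phis_bound n z : `|phis a n z| <= expR (Num.sqrt `|z|).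
Proof.
apply: (le_trans (phis_norm n z)).
have := phis_sqr_le n (Num.sqrt `|z|).
by rewrite sqr_sqrtr// (ger0_norm (sqrtr_ge0 _)).
Qed.

Lemma phis_nd z : 0 <= z -> {homo (fun n => phis a n z) : m n / (m <= n)%N >-> m <= n}.
Proof.
move=> z0; apply: (@nondecreasing_series _ (fun k => cc a k * z ^+ k)) => k _ _.
by rewrite mulr_ge0 ?exprn_ge0// ltW// cc_gt0.
Qed.

Lemma Phi_cvg z : phis a n z @[n --> \oo] --> Phi a z.
Proof.
suff : cvgn (series (fun k => cc a k * z ^+ k)) by [].
apply: normed_cvg; apply: nondecreasing_is_cvgn.
  by apply: nondecreasing_series => k _ _ /=; exact: normr_ge0.
exists (expR (Num.sqrt `|z|)) => _ [n _ <-].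
have := phis_bound n `|z|; rewrite normr_id; apply: le_trans.
rewrite [leLHS]/series/= ger0_norm; last first.
  by apply: sumr_ge0 => k _; rewrite mulr_ge0 ?exprn_ge0// ltW// cc_gt0.
by apply: ler_sum => k _; rewrite normrM normrX (gtr0_norm (cc_gt0 _)).
Qed.

Lemma Phi_bound z : `|Phi a z| <= expR (Num.sqrt `|z|).
Proof. by apply: cvg_le_cst (cvg_norm (Phi_cvg z)) _ => n; exact: phis_bound. Qed.

Lemma Phi_ge0 z : 0 <= z -> 0 <= Phi a z.
Proof.
move=> z0; apply: cvg_ge_cst (Phi_cvg z) _ => n; apply: sumr_ge0 => k _.
by rewrite mulr_ge0 ?exprn_ge0// ltW// cc_gt0.
Qed.

Lemma phis_meas n : measurable_fun setT (phis a n).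
Proof.
apply: measurable_sum => k; apply: measurable_funM; first exact: measurable_cst.
exact: exprn_measurable.
Qed.

Lemma Phi_meas : measurable_fun setT (Phi a).
Proof. by apply: (measurable_fun_cvg phis_meas) => z _; exact: Phi_cvg. Qed.

End PhiSeries.

(** * The Poisson integral *)

Section Gegenbauer.
Context {R : realType}.
Local Notation mu := (@lebesgue_measure R).
Implicit Types (x y z s : R) (n k : nat).
Variable a : R.
Hypothesis a0 : 2^-1 <= a.

Let a_gt0 : 0 < a.
Proof. by apply: lt_le_trans a0; rewrite invr_gt0. Qed.

(** Gegenbauer weight: up to a factor, the law of the cosine of an angle in dimension [2a + 2]. The
    exponent is nonnegative, so [rho <= 1]. *)
Definition rho s : R := \1_`[(-1), 1] s * (1 - s ^+ 2) `^ (a - 2^-1).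

Lemma rho_ge0 s : 0 <= rho s.
Proof. by rewrite mulr_ge0// powR_ge0. Qed.

Lemma rho_out s : 1 < `|s| -> rho s = 0.
Proof.
rewrite /rho indicE mem_setE in_itv/= -ler_norml => s1.
by rewrite leNgt s1 mul0r.
Qed.

Lemma sqr_le1 s : `|s| <= 1 -> 0 <= 1 - s ^+ 2 <= 1.
Proof. by rewrite ler_norml => /andP[s1 s2]; apply/andP; split; nra. Qed.

Lemma rho_in s : `|s| <= 1 -> rho s = (1 - s ^+ 2) `^ (a - 2^-1).
Proof. by rewrite /rho indicE mem_setE in_itv/= -ler_norml => ->; rewrite mul1r. Qed.

Lemma rho_meas : measurable_fun setT rho.
Proof.
apply: measurable_funM; first exact: measurable_indic.
apply: (measurableT_comp (f := @powR R ^~ (a - 2^-1)) (g := fun s => 1 - s ^+ 2)).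
  exact: measurable_powR.
by apply: measurable_funB; [exact: measurable_cst|exact: exprn_measurable].
Qed.

Lemma rho_le s : rho s <= \1_`[(-1), 1] s.
Proof.
rewrite /rho ler_piMr//; have [s1|s1] := leP `|s| 1; last first.
  have : 1 - s ^+ 2 < 0.
    rewrite subr_lt0 -real_normK ?num_real// exprn_egt1//.
  by move=> /lt0_powR1 ->.
have /andP[h1 h2] := sqr_le1 s s1.
rewrite -[leRHS](_ : 1 `^ (a - 2^-1) = 1); last by rewrite powR1.
by rewrite ge0_ler_powR ?nnegrE// subr_ge0.
Qed.

Lemma rho_ig : ig rho.
Proof.
apply: (ig_dom (\1_`[(-1), 1])); [exact: rho_meas|exact: ig_indic_bnd|move=> s].
by rewrite ger0_norm ?rho_ge0// rho_le.
Qed.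

Lemma ig_rho (h : R -> R) (C : R) : measurable_fun setT h ->
  (forall s, `|s| <= 1 -> `|h s| <= C) -> ig (fun s => h s * rho s).
Proof.
move=> mh hC; apply: (ig_dom (fun s => C * rho s)); last 1 first.
- move=> s; rewrite normrM (ger0_norm (rho_ge0 s)).
  have [s1|s1] := leP `|s| 1; first by rewrite ler_wpM2r ?rho_ge0// hC.
  by rewrite rho_out// !mulr0.
- by apply: measurable_funM => //; exact: rho_meas.
- by apply: igZ; exact: rho_ig.
Qed.

Lemma rho_cont : {within `[(-1), 1], continuous (fun s => (1 - s ^+ 2) `^ (a - 2^-1))}.
Proof.
have c1 : continuous (fun s : R => 1 - s ^+ 2).
  by move=> s; apply: cvgB; [exact: cvg_cst|exact: exprn_continuous].
have [->|a12] := eqVneq a 2^-1.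
  rewrite subrr (_ : (fun _ => _) = fun=> 1); last by apply/funext => s; rewrite powRr0.
  by apply: cont_within => s; exact: cvg_cst.
have p0 : 0 < a - 2^-1 by rewrite subr_gt0 lt_neqAle eq_sym a12.
apply: (@subspace_eq_continuous _ _ _ (fun s => pw (a - 2^-1) (1 - s ^+ 2))).
  move=> s; rewrite inE/= in_itv/= -ler_norml => s1.
  by rewrite pw_powR//; have /andP[] := sqr_le1 s s1.
apply: cont_within => s; apply: (@continuous_comp _ _ _ (fun s : R => 1 - s ^+ 2) (pw (a - 2^-1))).
  exact: c1.
exact: pw_continuous.
Qed.

Lemma ig_rho_cont (h : R -> R) : continuous h -> ig (fun s => h s * rho s).
Proof.
move=> ch; rewrite (_ : (fun s => _) = fun s => \1_`[(-1), 1] s * (h s * (1 - s ^+ 2) `^ (a - 2^-1))).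
  apply: ig_cont; have c2 : {within `[(-1), 1], continuous h} by exact: cont_within.
  by move=> s; exact: cvgM (c2 s) (rho_cont s).
by apply/funext => s; rewrite /rho; ring.
Qed.

(** The integrand is the derivative of [q s * (1 - s^2)^(a+1/2)], which vanishes at both ends. Every
    recurrence between moments of [rho] comes from a choice of [q] here. *)
Lemma rho_ibp (q dq : R -> R) : (forall s, is_derive s 1 q (dq s)) -> continuous dq ->
  it (fun s => (dq s * (1 - s ^+ 2) - (2 * a + 1) * s * q s) * rho s) = 0.
Proof.
move=> dqq cdq.
have cq : continuous q.
  move=> s; apply: differentiable_continuous; apply/derivable1_diffP.
  exact: (@ex_derive _ _ _ _ _ _ _ (dqq s)).
have c1 : continuous (fun s : R => 1 - s ^+ 2).
  by move=> s; apply: cvgB; [exact: cvg_cst|exact: exprn_continuous].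
pose F s := q s * pw (a + 2^-1) (1 - s ^+ 2).
pose f s := (dq s * (1 - s ^+ 2) - (2 * a + 1) * s * q s) * (1 - s ^+ 2) `^ (a - 2^-1).
have cF : continuous F.
  move=> s; apply: cvgM; first exact: cq.
  apply: (@continuous_comp _ _ _ (fun s : R => 1 - s ^+ 2) (pw (a + 2^-1))); first exact: c1.
  by apply: pw_continuous; rewrite addr_gt0// invr_gt0.
have cf : {within `[(-1), 1], continuous f}.
  have c2 : {within `[(-1), 1], continuous (fun s => dq s * (1 - s ^+ 2) - (2 * a + 1) * s * q s)}.
    apply: cont_within => s; apply: cvgB; apply: cvgM; [exact: cdq|exact: c1| |exact: cq].
    by apply: cvgM; [exact: cvg_cst|exact: cvg_id].
  by move=> s; exact: cvgM (c2 s) (rho_cont s).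
have := @it_FTC R F f (-1) 1 _ cf (cont_within _ _ cF).
rewrite {2 3}/F sqrrN expr1n subrr pw_neg// !mulr0 subrr.
move=> H; rewrite -[RHS]H.
- by apply: eq_it => s; rewrite /f /rho; ring.
- by lra.
move=> s s1.
have s2 : 0 < 1 - s ^+ 2 by nra.
have d1 : is_derive s 1 (fun s : R => 1 - s ^+ 2) (- (2 * s)).
  apply: is_derive_eq.
  by rewrite /GRing.scale/=; ring.
have := @is_derive1_comp _ (pw (a + 2^-1)) _ s _ _ (pw_derive _ _ s2) d1.
move=> d2; have d3 := @is_deriveM _ _ _ _ _ _ _ _ (dqq s) d2.
apply: (@is_derive_eq _ _ _ F s 1 _ _ d3).
rewrite /f /= /GRing.scale/=.
have -> : a + 2^-1 - 1 = a - 2^-1 by lra.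
rewrite !pw_pos//.
have -> : (1 - s ^+ 2) `^ (a + 2^-1) = (1 - s ^+ 2) `^ (a - 2^-1) * (1 - s ^+ 2).
  rewrite -[X in _ * X]powRr1 ?ltW// -powRD; first by congr (_ `^ _); lra.
  by apply/implyP => _; rewrite gt_eqF.
by field.
Qed.

Definition NN n : R := it (fun s => s ^+ n * rho s).

Lemma rhoX_ig n : ig (fun s => s ^+ n * rho s).
Proof.
apply: (ig_rho (fun s => s ^+ n) 1); first exact: exprn_measurable.
by move=> s s1; rewrite normrX exprn_ile1.
Qed.

Lemma NN_1 : NN 1 = 0.
Proof.
have H : it (fun s : R => (0 * (1 - s ^+ 2) - (2 * a + 1) * s * 1) * rho s) = 0.
  by apply: (rho_ibp (cst 1) (cst 0)) => s; exact: cvg_cst.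
have e : (fun s : R => (0 * (1 - s ^+ 2) - (2 * a + 1) * s * 1) * rho s) =
         (fun s => (- (2 * a + 1)) * (s ^+ 1 * rho s)).
  by apply/funext => s; rewrite expr1; ring.
move: H; rewrite e itZ; last exact: rhoX_ig.
have p0 : 2 * a + 1 != 0 by rewrite gt_eqF// addr_gt0 ?mulr_gt0.
by move/eqP; rewrite mulf_eq0 oppr_eq0 (negbTE p0) => /eqP.
Qed.

Lemma NN_rec n : n.+1%:R * NN n = (n%:R + 2 * a + 2) * NN n.+2.
Proof.
have d s : is_derive s 1 (fun s : R => s ^+ n.+1) (n.+1%:R * s ^+ n).
  apply: DeriveDef; first exact: exprn_derivable.
  by rewrite exp_derive /GRing.scale/= mulr1.
have c : continuous (fun s : R => n.+1%:R * s ^+ n).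
  by move=> s; apply: cvgM; [exact: cvg_cst|exact: exprn_continuous].
have := rho_ibp _ _ d c.
rewrite (_ : (fun s => _) = fun s => n.+1%:R * (s ^+ n * rho s) -
    (n%:R + 2 * a + 2) * (s ^+ n.+2 * rho s)); last first.
  by apply/funext => s; rewrite !exprS -natr1; ring.
rewrite itB ?itZ; try by [exact: rhoX_ig|apply: igZ; exact: rhoX_ig].
by move/eqP; rewrite subr_eq0 => /eqP.
Qed.

Lemma NN_odd k : NN (2 * k).+1 = 0.
Proof.
elim: k => [|k IH]; first by rewrite muln0 NN_1.
have := NN_rec (2 * k).+1; rewrite IH mulr0 mulnS => /esym/eqP.
have p0 : (2 * k).+1%:R + 2 * a + 2 != 0 by rewrite gt_eqF// !addr_gt0 ?mulr_gt0.
by rewrite mulf_eq0 (negbTE p0) => /eqP.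
Qed.

(** The factorial cancels the Taylor coefficient of the exponential or of the cosine, which is how
    the Poisson integrals give back the coefficients [cc]. *)
Lemma NN_even k : NN (2 * k) = NN 0 * (2 * k)`!%:R * cc a k.
Proof.
elim: k => [|k IH]; first by rewrite muln0 cc0 fact0 !mulr1.
have p0 : 0 < (2 * k)%:R + 2 * a + 2 by rewrite ltr_wpDl// addr_ge0// mulr_ge0// ltW.
have := NN_rec (2 * k); rewrite IH mulnS => /esym/(canRL (mulKf (lt0r_neq0 p0))) ->.
rewrite ccS// !factS !natrM.
have -> : (2 * k).+2%:R = 2 * k%:R + 2 :> R by rewrite -addn2 natrD natrM.
have -> : (2 * k).+1%:R = 2 * k%:R + 1 :> R by rewrite -natr1 natrM.
move: p0; rewrite natrM -(natr1 k) => p0.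
have k1 : 0 < k%:R + 1 :> R by rewrite ltr_wpDl.
have k2 : 0 < a + (k%:R + 1) :> R by rewrite addr_gt0.
by field; rewrite !gt_eqF.
Qed.

Lemma it_indic_itv (A B : R) : A < B -> it (\1_`[A, B]) = B - A.
Proof.
move=> AB; rewrite (_ : \1_`[A, B] = fun x => \1_`[A, B] x * 1); last by apply/funext => x; rewrite mulr1.
apply: (@it_FTC R id (fun=> 1)) => //.
- by apply: cont_within => s; exact: cvg_cst.
- by apply: cont_within => s; exact: cvg_id.
Qed.

Lemma NN0_gt0 : 0 < NN 0.
Proof.
pose c : R := (3 / 4) `^ (a - 2^-1).
have c0 : 0 < c by apply: powR_gt0; lra.
apply: (@lt_le_trans _ _ (it (fun s => c * \1_`[(- 2^-1), 2^-1] s))).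
  rewrite itZ; last exact: ig_indic_bnd.
  by rewrite mulr_gt0// it_indic_itv; lra.
apply: it_le; [by apply: igZ; exact: ig_indic_bnd|exact: rhoX_ig|move=> s].
rewrite expr0 mul1r indicE mem_setE in_itv/=; case: andP => [[s1 s2]|_]; last first.
  by rewrite mulr0 rho_ge0.
rewrite mulr1 rho_in; last by rewrite ler_norml; lra.
by rewrite /c ge0_ler_powR ?nnegrE ?subr_ge0//; nra.
Qed.

Lemma exp_poisson x : it (fun s => expR (x * s) * rho s) = NN 0 * Phi a (x ^+ 2).
Proof.
(* The odd moments vanish, so [2 * n] terms of the exponential match [n] terms of [Phi]. *)
pose fn n s := (\sum_(0 <= m < (2 * n)%N) ((x * s) ^+ m / m`!%:R)) * rho s.
have E n : it (fn n) = NN 0 * phis a n (x ^+ 2).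
  transitivity (\sum_(0 <= m < (2 * n)%N) (x ^+ m / m`!%:R * NN m)).
    rewrite /fn; under eq_fun do rewrite mulr_suml.
    rewrite it_sum; last first.
      move=> m; rewrite (_ : (fun _ => _) = fun s => (x ^+ m / m`!%:R) * (s ^+ m * rho s)).
        by apply: igZ; exact: rhoX_ig.
      by apply/funext => s; rewrite exprMn; ring.
    apply: eq_bigr => m _; rewrite /NN -itZ; last exact: rhoX_ig.
    by apply: eq_it => s; rewrite exprMn; ring.
  rewrite /phis; elim: n => [|n IH]; first by rewrite muln0 !big_geq// mulr0.
  rewrite mulnS !big_nat_recr//= IH mulrDr NN_odd mulr0 addr0; congr (_ + _).
  rewrite NN_even -exprM; field.
  by rewrite pnatr_eq0 -lt0n fact_gt0.
have bd n s : `|fn n s| <= expR `|x| * rho s.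
  rewrite normrM (ger0_norm (rho_ge0 s)).
  have [s1|s1] := leP `|s| 1; last by rewrite rho_out// !mulr0.
  rewrite ler_wpM2r ?rho_ge0// (le_trans (expR_sum_le _ _))// ler_expR normrM.
  by rewrite ler_piMr.
have mfn n : measurable_fun setT (fn n).
  apply: measurable_funM; last exact: rho_meas.
  apply: measurable_sum => m; apply: measurable_funM; last exact: measurable_cst.
  by apply: measurable_funX; apply: measurable_funM => //; exact: measurable_cst.
have cfn s : fn n s @[n --> \oo] --> expR (x * s) * rho s.
  apply: cvgM; last exact: cvg_cst.
  have : series (exp_coeff (x * s)) n @[n --> \oo] --> expR (x * s).
    exact: is_cvg_series_exp_coeff.
  move=> /(cvg_comp (fun n => (2 * n)%N)); apply.
  by apply/cvgnyPge => A; exists A => // n /= An; rewrite (leq_trans An)// leq_pmull.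
have [_ H] := it_dct _ _ _ mfn (igZ _ _ rho_ig) bd cfn.
apply: cvg_uniqueN H _; under eq_fun do rewrite E.
by apply: cvgM; [exact: cvg_cst|exact: Phi_cvg].
Qed.

(** Poisson's integral exhibits [j_alpha] as an average of cosines, whence its bound by 1 in
    [j_le1]. *)
Lemma cos_poisson x : it (fun s => cos (x * s) * rho s) = NN 0 * Phi a (- x ^+ 2).
Proof.
pose fn n s := series (cos_coeff' (x * s)) n * rho s.
have E n : it (fn n) = NN 0 * phis a n (- x ^+ 2).
  rewrite /fn /series/=; under eq_fun do rewrite mulr_suml.
  have e m : (fun s => cos_coeff' (x * s) m * rho s) =
             fun s => ((- x ^+ 2) ^+ m / (2 * m)`!%:R) * (s ^+ (2 * m) * rho s).
    apply/funext => s; rewrite /cos_coeff' -mul2n.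
    have -> : (- x ^+ 2) ^+ m = (-1) ^+ m * x ^+ (2 * m).
      by rewrite (exprM x) (exprNn (x ^+ 2)).
    by rewrite exprMn -exprnP; ring.
  rewrite it_sum; last by move=> m; rewrite e; apply: igZ; exact: rhoX_ig.
  rewrite /phis mulr_sumr; apply: eq_bigr => m _; rewrite e itZ; last exact: rhoX_ig.
  rewrite -/(NN _) NN_even; field.
  by rewrite pnatr_eq0 -lt0n fact_gt0.
have bd n s : `|fn n s| <= expR `|x| * rho s.
  rewrite normrM (ger0_norm (rho_ge0 s)).
  have [s1|s1] := leP `|s| 1; last by rewrite rho_out// !mulr0.
  rewrite ler_wpM2r ?rho_ge0//; apply: le_trans (expR_even_le n x).
  rewrite (le_trans (ler_norm_sum _ _ _))// ler_sum// => k _.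
  rewrite /cos_coeff' -mul2n !normrM normfV normr_nat normrX normrN1 expr1n mul1r.
  rewrite ler_wpM2r ?invr_ge0// normrX normrM !exprM.
  rewrite lerXn2r ?nnegrE ?sqr_ge0// exprMn real_normK ?num_real//.
  by rewrite ler_piMr ?sqr_ge0// expr_le1.
have mfn n : measurable_fun setT (fn n).
  apply: measurable_funM; last exact: rho_meas.
  apply: measurable_sum => m; apply: measurable_funM; last exact: measurable_cst.
  apply: measurable_funM; first exact: measurable_cst.
  by apply: measurable_funX; apply: measurable_funM => //; exact: measurable_cst.
have cfn s : fn n s @[n --> \oo] --> cos (x * s) * rho s.
  by apply: cvgM; [exact: cvg_cos_coeff'|exact: cvg_cst].
have [_ H] := it_dct _ _ _ mfn (igZ _ _ rho_ig) bd cfn.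
apply: cvg_uniqueN H _; under eq_fun do rewrite E.
by apply: cvgM; [exact: cvg_cst|exact: Phi_cvg].
Qed.

Lemma j_le1 x : `|j_alpha a x| <= 1.
Proof.
have N0 := NN0_gt0; rewrite -(ler_pM2l N0) mulr1 j_alphaE.
rewrite -[X in X * _]gtr0_norm// -normrM -cos_poisson.
have mc : measurable_fun setT (fun s : R => cos (x * s)).
  apply: (measurableT_comp (f := @cos R)); last by apply: measurable_funM => //; exact: measurable_cst.
  by apply: continuous_measurable_fun; exact: continuous_cos.
have ci : ig (fun s => cos (x * s) * rho s) by apply: (ig_rho _ 1) => // s _; exact: cos_max.
apply: (le_trans (it_norm _ ci)); apply: it_le; [exact: ig_abs|exact: rhoX_ig|move=> s].
rewrite expr0 mul1r normrM (ger0_norm (rho_ge0 s)).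
by rewrite ler_piMl ?rho_ge0// cos_max.
Qed.

End Gegenbauer.

(** * The product formula *)

Section Cauchy.
Context {R : realType}.
Implicit Types (x y z s X Y : R) (n k m : nat).
Variable a : R.
Hypothesis a0 : 2^-1 <= a.

(* The product formula: the terms [TT] of the Cauchy product of two series [Phi] and the moments
   [PP] of the squared distance satisfy the same three-term recurrence. *)
Definition UU (h : nat -> nat -> R) X Y k : R :=
  \sum_(0 <= i < k.+1) h i (k - i)%N * (cc a i * X ^+ i) * (cc a (k - i) * Y ^+ (k - i)).

Let gg k : R := 4 * k%:R * (a + k%:R).

Let ggS k : gg k.+1 * cc a k.+1 = cc a k.
Proof.
rewrite ccS// mulrC divfK// mulf_neq0// ?mulf_neq0//.
by rewrite gt_eqF// addr_gt0// (lt_le_trans _ a0)// invr_gt0.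
Qed.

(** Multiplying by [X] shifts [i] by one, and the quotient of consecutive coefficients appears as
    the weight [gg i]. Since [gg 0 = 0], the missing term at [i = 0] is added for free. Polynomials
    in [X] and [Y] thus become weights on a single sum. *)
Let shiftX h X Y k : X * UU h X Y k = UU (fun i j => gg i * h i.-1 j) X Y k.+1.
Proof.
rewrite [RHS]/UU big_nat_recl//= /gg mulr0 !mul0r add0r mulr_sumr.
apply: eq_bigr => i _; rewrite subSS -[in LHS](ggS i) /gg exprS; ring.
Qed.

Let shiftY h X Y k : Y * UU h X Y k = UU (fun i j => gg j * h i j.-1) X Y k.+1.
Proof.
rewrite [RHS]/UU big_nat_recr//= subnn /gg mulr0 !mul0r addr0 mulr_sumr.
apply: eq_big_nat => i /andP[_ ik]; rewrite subSn// -[in LHS](ggS (k - i)) /gg exprS /=; ring.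
Qed.

Let UUD h h' X Y k : UU (fun i j => h i j + h' i j) X Y k = UU h X Y k + UU h' X Y k.
Proof. by rewrite /UU -big_split; apply: eq_bigr => i _ /=; rewrite !mulrDl. Qed.

Let UUZ (c : R) h X Y k : UU (fun i j => c * h i j) X Y k = c * UU h X Y k.
Proof. by rewrite /UU mulr_sumr; apply: eq_bigr => i _ /=; rewrite !mulrA. Qed.

Let UUN h X Y k : UU (fun i j => - h i j) X Y k = - UU h X Y k.
Proof. by rewrite /UU -sumrN; apply: eq_bigr => i _ /=; rewrite !mulNr. Qed.

Let eq_UU h h' X Y k : (forall i j, (i + j)%N = k -> h i j = h' i j) ->
  UU h X Y k = UU h' X Y k.
Proof.
by move=> H; apply: eq_big_nat => i /andP[_ ik]; rewrite H// subnKC.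
Qed.

Let TT := UU (fun _ _ => 1).

(** Once all shifts are absorbed into weights, the recurrence is a polynomial identity in [i] and
    [j] under [i + j = k + 2]. *)
Let TT_rec X Y k : 16 * (a + k.+1%:R) * (2 * a + 1 + k.+1%:R) * k.+2%:R * (a + k.+2%:R) * TT X Y k.+2 =
  4 * (a + k.+1%:R) * (2 * a + 1 + 2 * k.+1%:R) * (X * TT X Y k.+1 + Y * TT X Y k.+1)
  - (X * (X * TT X Y k) + Y * (Y * TT X Y k) - 2 * (X * (Y * TT X Y k))).
Proof.
set c := 16 * _ * _ * _ * _; set d := 4 * _ * _.
rewrite /TT !shiftX !shiftY !shiftX.
transitivity (UU (fun i j => d * (gg i * 1 + gg j * 1) - ((gg i * (gg i.-1 * 1) +
    gg j * (gg j.-1 * 1)) - 2 * (gg i * (gg j * 1)))) X Y k.+2); last first.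
  rewrite UUD UUZ UUD; congr (_ + _); rewrite UUN; congr (- _).
  by rewrite UUD UUD; congr (_ + _); rewrite UUN UUZ.
rewrite -UUZ; apply: eq_UU => i j ij; rewrite !mulr1 /c /d.
(* The truncated predecessor of 0 does no harm, because the factor [gg i] is then zero. *)
have -> : gg i * gg i.-1 = gg i * (4 * (i%:R - 1) * (a + (i%:R - 1))).
  by case: (i) => [|i'] /=; rewrite ?[gg 0]/gg ?mulr0 ?mul0r// /gg -(natr1 i') addrK.
have -> : gg j * gg j.-1 = gg j * (4 * (j%:R - 1) * (a + (j%:R - 1))).
  by case: (j) => [|i'] /=; rewrite ?[gg 0]/gg ?mulr0 ?mul0r// /gg -(natr1 i') addrK.
have e2 : k.+2%:R = i%:R + j%:R :> R by rewrite -natrD ij.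
have e1 : k.+1%:R = i%:R + j%:R - 1 :> R by rewrite -e2 -(natr1 k.+1) addrK.
by rewrite e1 e2 /gg; ring.
Qed.

Section moments.
Variables X Y w : R.
Hypothesis wXY : w ^+ 2 = 4 * X * Y.

Let r s := X + Y + w * s.
Let PP k := it (fun s => r s ^+ k * rho a s).

Let r_meas : measurable_fun setT r.
Proof.
apply: measurable_funD; first exact: measurable_cst.
by apply: measurable_funM => //; exact: measurable_cst.
Qed.

Lemma rX_ig k : ig (fun s => r s ^+ k * rho a s).
Proof.
apply: (ig_rho a a0 (fun s => r s ^+ k) ((`|X + Y| + `|w|) ^+ k)).
  exact: measurable_funX.
move=> s s1; rewrite normrX lerXn2r ?nnegrE ?addr_ge0//.
by rewrite (le_trans (ler_normD _ _))// lerD2l normrM ler_piMr.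
Qed.

(** This is [rho_ibp] with [q = r ^ (k+1)], multiplied by [w]. Then [s] occurs only through
    [w s = r - (X + Y)] and [w^2 (1 - s^2) = 4XY - (r - X - Y)^2], which are polynomials in [r]. *)
Let PP_rec k : (2 * a + 1 + k.+1%:R) * PP k.+2 = (2 * a + 1 + 2 * k.+1%:R) * (X + Y) * PP k.+1
   - k.+1%:R * ((X + Y) ^+ 2 - 4 * X * Y) * PP k.
Proof.
have cr : continuous r.
  by move=> s; apply: cvgD; [exact: cvg_cst|apply: cvgM; [exact: cvg_cst|exact: cvg_id]].
have d s : is_derive s 1 (fun s => r s ^+ k.+1) (k.+1%:R * r s ^+ k * w).
  have d1 : is_derive s 1 r w.
    by apply: is_derive_eq; rewrite /GRing.scale/=; ring.
  have d2 : is_derive (r s) 1 (fun s : R => s ^+ k.+1) (k.+1%:R * r s ^+ k).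
    apply: DeriveDef; first exact: exprn_derivable.
    by rewrite exp_derive /GRing.scale/= mulr1.
  exact: (@is_derive1_comp _ (fun s : R => s ^+ k.+1) r _ _ _ d2 d1).
have c : continuous (fun s => k.+1%:R * r s ^+ k * w).
  move=> s; apply: cvgM; last exact: cvg_cst.
  apply: cvgM; first exact: cvg_cst.
  by apply: (@continuous_comp _ _ _ r (fun s : R => s ^+ k)); [exact: cr|exact: exprn_continuous].
have /(congr1 (fun z => w * z)) := rho_ibp a a0 _ _ d c; rewrite mulr0.
have ri := rX_ig.
have c1 : continuous (fun s : R => 1 - s ^+ 2).
  by move=> s; apply: cvgB; [exact: cvg_cst|exact: exprn_continuous].
rewrite -itZ; last first.
  apply: (ig_rho_cont a a0 (fun s => k.+1%:R * r s ^+ k * w * (1 - s ^+ 2) - (2 * a + 1) * s * r s ^+ k.+1)).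
  move=> s; apply: cvgB; apply: cvgM; [exact: c|exact: c1| |].
    by apply: cvgM; [exact: cvg_cst|exact: cvg_id].
  by apply: (@continuous_comp _ _ _ r (fun s : R => s ^+ k.+1)); [exact: cr|exact: exprn_continuous].
pose A : R := 2 * a + 1 + k.+1%:R.
pose B := (2 * a + 1 + 2 * k.+1%:R) * (X + Y).
pose C := k.+1%:R * ((X + Y) ^+ 2 - 4 * X * Y).
rewrite (_ : (fun s => _) = fun s => B * (r s ^+ k.+1 * rho a s) - C * (r s ^+ k * rho a s)
   - A * (r s ^+ k.+2 * rho a s)); last first.
  apply/funext => s; rewrite /A /B /C -wXY !exprS.
  by move: (r s ^+ k) => rk; rewrite /r; ring.
rewrite itB ?itB ?itZ -/(PP _) -/(PP _); try by [exact: ri|exact: igZ|apply: igB; exact: igZ].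
by move/eqP; rewrite subr_eq0 => /eqP <-.
Qed.

Let PP0 : PP 0 = NN a 0.
Proof. by apply: eq_it => s; rewrite !expr0. Qed.

Let PP1 : PP 1 = (X + Y) * NN a 0.
Proof.
have i n := rhoX_ig a a0 n.
rewrite /PP (_ : (fun s => _) = fun s => (X + Y) * (s ^+ 0 * rho a s) + w * (s ^+ 1 * rho a s)).
  rewrite (itD _ _ (igZ _ _ (i 0%N)) (igZ _ _ (i 1%N))) (itZ _ _ (i 0%N)) (itZ _ _ (i 1%N)).
  by rewrite -[it (fun s => s ^+ 1 * _)]/(NN a 1) NN_1// mulr0 addr0.
by apply/funext => s; rewrite expr0 !expr1 /r; ring.
Qed.

Lemma cauchy_moments k : cc a k * it (fun s => (X + Y + w * s) ^+ k * rho a s) =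
  NN a 0 * UU (fun _ _ => 1) X Y k.
Proof.
rewrite -/(PP k) -/(TT X Y k).
(* The recurrence has order two, so the induction carries two consecutive terms. *)
suff : cc a k * PP k = NN a 0 * TT X Y k /\ cc a k.+1 * PP k.+1 = NN a 0 * TT X Y k.+1 by case.
elim: k => [|k [IH0 IH1]].
  rewrite PP0 PP1 /TT /UU !(big_nat_recr _ 0)//= !big_geq//= !subn0 subnn cc0 !expr0 !expr1.
  by split; ring.
split=> //.
have ap : 0 < a by rewrite (lt_le_trans _ a0)// invr_gt0.
have e1 : cc a k.+1 = gg k.+2 * cc a k.+2 by rewrite ggS.
have e0 : cc a k = gg k.+1 * (gg k.+2 * cc a k.+2) by rewrite !ggS.
have H1 := PP_rec k; have H2 := TT_rec X Y k.
have K : k.+2%:R = k.+1%:R + 1 :> R by rewrite -natr1.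
move: H1 H2 IH0 IH1; rewrite e0 e1 /gg K.
have : 0 < k.+1%:R :> R by [].
move: (PP k) (PP k.+1) (PP k.+2) (TT X Y k) (TT X Y k.+1) (TT X Y k.+2) (cc a k.+2) (NN a 0) => P0 P1 P2 T0 T1 T2 c N.
move: (k.+1%:R) => q q0 H1 H2 H3 H4.
have p0 : 16 * (a + q) * (2 * a + 1 + q) * (q + 1) * (a + (q + 1)) != 0.
  by rewrite gt_eqF// !mulr_gt0// !addr_gt0// ?mulr_gt0.
apply: (mulfI p0).
rewrite [RHS]mulrCA H2.
transitivity (16 * (a + q) * (q + 1) * (a + (q + 1)) * c * ((2 * a + 1 + q) * P2)); first by ring.
rewrite H1.
transitivity (4 * (a + q) * (2 * a + 1 + 2 * q) * (X + Y) * (4 * (q + 1) * (a + (q + 1)) * c * P1)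
  - ((X + Y) ^+ 2 - 4 * X * Y) * (4 * q * (a + q) * (4 * (q + 1) * (a + (q + 1)) * c) * P0)); first by ring.
by rewrite H3 H4; ring.
Qed.

End moments.

Lemma triangle_sum (f : nat -> nat -> R) n :
  \sum_(0 <= k < n) \sum_(0 <= i < k.+1) f i (k - i)%N =
  \sum_(0 <= i < n) \sum_(0 <= j < n - i) f i j.
Proof.
elim: n => [|n IH]; first by rewrite !big_geq.
rewrite [LHS]big_nat_recr//= IH [RHS]big_nat_recr//= subSn// subnn big_nat1.
rewrite [X in _ + X = _]big_nat_recr//= subnn addrA; congr (_ + _).
rewrite -big_split/=; apply: eq_big_nat => i /andP[_ ik].
by rewrite subSn 1?ltnW// big_nat_recr.
Qed.

(** The part of the square [i, j < n] that lies outside the triangle [i + j < n]: the error made in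
    replacing a product of partial sums by the Cauchy product. *)
Let DD x y n : R := \sum_(0 <= i < n) (cc a i * x ^+ i) * (phis a n y - phis a (n - i) y).

Let DDE x y n : DD x y n = phis a n x * phis a n y - \sum_(0 <= k < n) TT x y k.
Proof.
rewrite /TT /UU.
under [X in _ - X]eq_bigr do under eq_bigr do rewrite mul1r.
rewrite (triangle_sum (fun i j => cc a i * x ^+ i * (cc a j * y ^+ j))).
rewrite {1}[phis a n x]/phis mulr_suml -sumrB; apply: eq_bigr => i _.
by rewrite mulrBr; congr (_ - _); rewrite /phis mulr_sumr.
Qed.

Let phisB n m y : (m <= n)%N -> phis a n y - phis a m y = \sum_(m <= j < n) cc a j * y ^+ j.
Proof. by move=> mn; rewrite /phis (@big_cat_nat _ _ _ m 0 n)//= addrAC subrr add0r. Qed.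

Let DD_norm x y n : `|DD x y n| <= DD `|x| `|y| n.
Proof.
rewrite (le_trans (ler_norm_sum _ _ _))// ler_sum// => i _.
rewrite !normrM normrX (gtr0_norm (cc_gt0 a a0 i)) ler_wpM2l ?mulr_ge0 ?exprn_ge0 ?(ltW (cc_gt0 a a0 i))//.
rewrite !phisB ?leq_subr// (le_trans (ler_norm_sum _ _ _))// ler_sum// => j _.
by rewrite normrM normrX (gtr0_norm (cc_gt0 a a0 j)).
Qed.

(** The triangle [i + j < 2m] contains the square [i, j < m], so the error at [2m] is at most the
    difference of two squares, which tends to 0. Hence the even indices. *)
Let DD_le x y m : 0 <= x -> 0 <= y ->
  DD x y (2 * m) <= phis a (2 * m) x * phis a (2 * m) y - phis a m x * phis a m y.
Proof.
move=> x0 y0; have c0 i := ltW (cc_gt0 a a0 i).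
rewrite /DD; under eq_bigr do rewrite mulrBr; rewrite sumrB -mulr_suml lerB//.
rewrite {1}/phis mulr_suml [leRHS](@big_cat_nat _ _ _ m)//= ?leq_pmull//.
rewrite -[leLHS]addr0 lerD//; last first.
  by apply: sumr_ge0 => i _; rewrite !mulr_ge0 ?exprn_ge0//; apply: sumr_ge0 => j _; rewrite mulr_ge0 ?exprn_ge0.
rewrite ler_sum_nat// => i /andP[_ im]; rewrite ler_wpM2l ?mulr_ge0 ?exprn_ge0//.
apply: phis_nd => //; rewrite mul2n -addnn; rewrite -addnBA ?leq_addr//; exact: ltnW.
Qed.

Lemma cauchy_product x y :
  \sum_(0 <= k < (2 * m)%N) TT x y k @[m --> \oo] --> Phi a x * Phi a y.
Proof.
have c2 z : phis a (2 * m)%N z @[m --> \oo] --> Phi a z.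
  apply: (cvg_comp (fun m => (2 * m)%N) (fun n => phis a n z)); last exact: Phi_cvg.
  by apply/cvgnyPge => A; exists A => // n /= An; rewrite (leq_trans An)// leq_pmull.
have D0 : DD x y (2 * m)%N @[m --> \oo] --> (0 : R).
  apply/cvgr0Pnorm_le => /= e e0.
  have : phis a (2 * m) `|x| * phis a (2 * m) `|y| - phis a m `|x| * phis a m `|y|
      @[m --> \oo] --> (0 : R).
    rewrite -(subrr (Phi a `|x| * Phi a `|y|)).
    by apply: cvgB; apply: cvgM; [exact: c2|exact: c2|exact: Phi_cvg|exact: Phi_cvg].
  move=> /cvgr0_norm_le /(_ _ e0); apply: filterS => m; apply: le_trans.
  rewrite (le_trans (DD_norm _ _ _))// (le_trans _ (ler_norm _))//.
  by apply: DD_le.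
have -> : Phi a x * Phi a y = Phi a x * Phi a y - 0 by rewrite subr0.
rewrite (_ : (fun m => _) = fun m => phis a (2 * m) x * phis a (2 * m) y - DD x y (2 * m)).
  by apply: cvgB D0; apply: cvgM; exact: c2.
by apply/funext => m; rewrite DDE opprB addrC subrK.
Qed.

Lemma Phi_product X Y (w : R) : w ^+ 2 = 4 * X * Y ->
  it (fun s => Phi a (X + Y + w * s) * rho a s) = NN a 0 * (Phi a X * Phi a Y).
Proof.
move=> wXY; pose r s := X + Y + w * s.
have mr : measurable_fun setT r.
  apply: measurable_funD; first exact: measurable_cst.
  by apply: measurable_funM => //; exact: measurable_cst.
pose fn m s := phis a (2 * m)%N (r s) * rho a s.
have mfn m : measurable_fun setT (fn m).
  apply: measurable_funM; last exact: rho_meas.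
  exact: (measurableT_comp (phis_meas a _) mr).
have E m : it (fn m) = NN a 0 * \sum_(0 <= k < (2 * m)%N) TT X Y k.
  rewrite /fn /phis; under eq_fun do rewrite mulr_suml.
  have e k : (fun s => cc a k * r s ^+ k * rho a s) = fun s => cc a k * (r s ^+ k * rho a s).
    by apply/funext => s; rewrite mulrA.
  rewrite it_sum; last by move=> k; rewrite e; apply: igZ; exact: rX_ig.
  rewrite mulr_sumr; apply: eq_bigr => k _; rewrite e itZ; last exact: rX_ig.
  exact: cauchy_moments.
pose C := expR (Num.sqrt (`|X + Y| + `|w|)).
have bd m s : `|fn m s| <= C * rho a s.
  rewrite normrM (ger0_norm (rho_ge0 a s)).
  have [s1|s1] := leP `|s| 1; last by rewrite rho_out// !mulr0.
  rewrite ler_wpM2r ?rho_ge0// (le_trans (phis_bound _ a0 _ _))// ler_expR ler_wsqrtr//.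
  by rewrite (le_trans (ler_normD _ _))// lerD2l normrM ler_piMr.
have cfn s : fn m s @[m --> \oo] --> Phi a (r s) * rho a s.
  apply: cvgM; last exact: cvg_cst.
  apply: (cvg_comp (fun m => (2 * m)%N) (fun n => phis a n (r s))); last exact: Phi_cvg.
  by apply/cvgnyPge => A; exists A => // n /= An; rewrite (leq_trans An)// leq_pmull.
have [_ H] := it_dct _ _ _ mfn (igZ _ _ (rho_ig a a0)) bd cfn.
apply: cvg_uniqueN H _; under eq_fun do rewrite E.
by apply: cvgM; [exact: cvg_cst|exact: cauchy_product].
Qed.

(* Third side of a triangle with sides [l], [m] enclosing an angle of cosine [s]. *)
Definition dist_s (l m s : R) : R := Num.sqrt (l ^+ 2 + m ^+ 2 - 2 * l * m * s).

Lemma dist_meas (l m : R) : measurable_fun setT (dist_s l m).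
Proof.
apply: (measurableT_comp (f := @Num.sqrt R)).
  by apply: continuous_measurable_fun; exact: sqrt_continuous.
by apply: measurable_funB; [exact: measurable_cst|exact: mulrl_measurable].
Qed.

Lemma dist_sqr (l m s : R) : `|s| <= 1 ->
  dist_s l m s ^+ 2 = l ^+ 2 + m ^+ 2 - 2 * l * m * s.
Proof.
move=> s1; rewrite sqr_sqrtr//.
have : `|2 * l * m * s| <= l ^+ 2 + m ^+ 2.
  rewrite normrM; apply: (@le_trans _ _ (`|2 * l * m| * 1)); first by rewrite ler_wpM2l.
  have h1 := sqr_ge0 (l - m); have h2 := sqr_ge0 (l + m).
  by rewrite mulr1 ler_norml; apply/andP; split; nra.
by rewrite ler_norml => /andP[_]; rewrite subr_ge0.
Qed.

(** With [X = -(l x)^2], [Y = -(m x)^2] and [w = 2 l m x^2], the argument [X + Y + w s] is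
    [-(dist_s l m s * x)^2]. It is the usual convolution kernel after the substitution of the cosine
    [s] for the third side, a form without case distinction when [l] or [m] is 0. *)
Lemma j_product (l m x : R) :
  it (fun s => j_alpha a (dist_s l m s * x) * rho a s) =
  NN a 0 * (j_alpha a (l * x) * j_alpha a (m * x)).
Proof.
rewrite !j_alphaE -(Phi_product _ _ (2 * l * m * x ^+ 2)); last by rewrite !exprMn; ring.
apply: eq_it => s; have [s1|s1] := leP `|s| 1; last by rewrite rho_out// !mulr0.
by rewrite j_alphaE exprMn dist_sqr//; congr (Phi a _ * _); ring.
Qed.

End Cauchy.

(** * Sonine's integral *)

Section Sonine.
Context {R : realType}.
Implicit Types (x y z s r t l X Y : R) (n k m : nat).
Variable a : R.
Hypothesis a0 : 2^-1 <= a.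

Let a_gt0 : 0 < a.
Proof. by apply: lt_le_trans a0; rewrite invr_gt0. Qed.

Definition W x : R := pw (2 * a + 1) x.

Lemma W_ge0 x : 0 <= W x. Proof. exact: pw_ge0. Qed.

Lemma W_meas : measurable_fun setT W. Proof. exact: pw_meas. Qed.

Lemma W_neg x : x <= 0 -> W x = 0. Proof. exact: pw_neg. Qed.

Lemma W_cont : continuous W.
Proof. by apply: pw_continuous; rewrite addr_gt0// mulr_gt0. Qed.

Lemma W_ig_bnd (A B : R) : ig (fun x => \1_`[A, B] x * W x).
Proof. by apply: ig_cont; apply: cont_within; exact: W_cont. Qed.

Lemma j_meas : measurable_fun setT (j_alpha a).
Proof.
rewrite (_ : j_alpha a = Phi a \o (fun x => - x ^+ 2)).
  apply: measurableT_comp; first exact: Phi_meas.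
  by apply: measurable_funN; exact: exprn_measurable.
by apply/funext => x; rewrite j_alphaE.
Qed.

Lemma jl_meas l : measurable_fun setT (fun x => j_alpha a (l * x)).
Proof. by apply: (measurableT_comp j_meas); exact: mulrl_measurable. Qed.

(** The terms of the series after the first add up to at most [expR |x| - 1] in absolute value, and
    [expR (1/3) <= 3/2]. *)
Lemma j_ge x : `|x| <= 3^-1 -> 2^-1 <= j_alpha a x.
Proof.
move=> x3; rewrite j_alphaE.
have H : 2 - expR `|x| <= Phi a (- x ^+ 2).
  have H : phis a n.+1 (- x ^+ 2) @[n --> \oo] --> Phi a (- x ^+ 2).
    by rewrite (cvg_shiftS (fun n => phis a n (- x ^+ 2))); exact: Phi_cvg.
  apply: (cvg_ge_cst _ _ _ H) => n.
  have := phis_sqr_le a a0 n.+1 x.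
  rewrite lerBlDr => h; apply: (@le_trans _ _ (phis a n.+1 (- x ^+ 2) + phis a n.+1 (x ^+ 2))).
    rewrite -big_split/= big_nat_recl//= cc0// !expr0 mulr1 -[leLHS]addr0 lerD//.
    apply: sumr_ge0 => k _; rewrite -mulrDr mulr_ge0// ?(ltW (cc_gt0 _ _ _))//.
    rewrite exprNn -{2}[(x ^+ 2) ^+ _]mul1r -mulrDl mulr_ge0//; last by apply: exprn_ge0; exact: sqr_ge0.
    by rewrite -signr_odd; case: (odd _); rewrite ?expr0 ?expr1 ?addNr ?addr_ge0.
  by rewrite lerD2l.
apply: le_trans H.
have := expR_ge1Dx (- `|x|).
have := expRxMexpNx_1 `|x|; have := expR_gt0 `|x|; have := expR_gt0 (- `|x|).
move: (expR `|x|) (expR (- `|x|)) => E E' E'0 E0 EE h.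
nra.
Qed.

Lemma sonine_moment k t : 0 < t ->
  it (fun r => \1_`[0, t] r * ((1 - r ^+ 2 / t ^+ 2) * (r ^+ (2 * k) * W r))) =
  pw (2 * a + 2) t * t ^+ (2 * k) / (2 * (a + k%:R + 1) * (a + k%:R + 2)).
Proof.
move=> t0; pose p : R := 2 * a + 1 + (2 * k)%:R.
have k0 : 0 <= (2 * k)%:R :> R by [].
have k1 : 0 <= k%:R :> R by [].
have p0 : 0 < p by have := a_gt0; rewrite /p natrM; lra.
pose F r := pw (p + 1) r / (p + 1) - (t ^+ 2)^-1 * (pw (p + 3) r / (p + 3)).
have cpw q : 0 < q -> continuous (@pw R q) by exact: pw_continuous.
have cF : continuous F.
  move=> r; apply: cvgB; first by apply: cvgM; [apply: cpw; lra|exact: cvg_cst].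
  by apply: cvgM; [exact: cvg_cst|apply: cvgM; [apply: cpw; lra|exact: cvg_cst]].
pose f r := pw p r - (t ^+ 2)^-1 * pw (p + 2) r.
have cf : continuous f.
  move=> r; apply: cvgB; first exact: cpw.
  by apply: cvgM; [exact: cvg_cst|apply: cpw; lra].
have dF r : 0 < r < t -> is_derive r 1 F (f r).
  move=> /andP[r0 _].
  have d1 := pw_derive (p + 1) r r0; have d2 := pw_derive (p + 3) r r0.
  have -> : F = fun r => (p + 1)^-1 * pw (p + 1) r - ((t ^+ 2)^-1 / (p + 3)) * pw (p + 3) r.
    by apply/funext => z; rewrite /F; ring.
  have d3 := is_deriveB (is_deriveZ _ d1) (is_deriveZ _ d2).
  apply: (@is_derive_eq _ _ _ _ r 1 _ _ (d3 _ _)).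
  rewrite /f /GRing.scale/= (_ : p + 1 - 1 = p) 1?(_ : p + 3 - 1 = p + 2); try lra.
  by field; rewrite !gt_eqF//; lra.
have := @it_FTC R F f 0 t t0 (cont_within _ _ cf) (cont_within _ _ cF) dF.
have F00 : F 0 = 0 by rewrite /F !(pw_neg _ 0)// !mul0r mulr0 subr0.
rewrite F00 subr0 => H.
rewrite -[LHS](_ : it (fun x => \1_`[0, t] x * f x) = _); last first.
  apply: eq_it => r; congr (_ * _).
  by rewrite /f /p /W (pwXn (2 * a + 1 + (2 * k)%:R) 2) !(pwXn (2 * a + 1) (2 * k)); ring.
rewrite H /F.
have -> : p + 3 = p + 1 + 2%:R by lra.
rewrite (pwXn (p + 1)).
have -> : pw (p + 1) t = pw (2 * a + 2) t * t ^+ (2 * k).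
  by rewrite -pwXn; congr (pw _ _); rewrite /p; lra.
have a1 := a_gt0.
have q1 : 0 < a + k%:R + 1 by lra.
have q2 : 0 < a + k%:R + 2 by lra.
have q3 : 0 < 2 * a + 1 + 2 * k%:R + 1 by lra.
have q4 : 0 < 2 * a + 1 + 2 * k%:R + 1 + 2 by lra.
by rewrite /p natrM; field; rewrite !gt_eqF.
Qed.

Lemma cc_add2 k : cc a k / (2 * (a + k%:R + 1) * (a + k%:R + 2)) = cc (a + 2) k / (2 * (a + 1) * (a + 2)).
Proof.
have a1 := a_gt0; have a2 : 2^-1 <= a + 2 by lra.
have q1 : 0 < a + 1 by lra. have q2 : 0 < a + 2 by lra.
elim: k => [|k IH]; first by rewrite !cc0// !addr0.
rewrite !ccS// -(natr1 k).
have k1 : 0 <= k%:R :> R by [].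
have q3 : 0 < a + k%:R + 1 by lra. have q4 : 0 < a + k%:R + 2 by lra.
have q5 : 0 < k%:R + 1 :> R by lra.
have q6 : 0 < a + k%:R + 3 by lra.
have e : cc a k = cc (a + 2) k / (2 * (a + 1) * (a + 2)) * (2 * (a + k%:R + 1) * (a + k%:R + 2)).
  by rewrite -IH divfK// !mulf_neq0// gt_eqF.
rewrite e; field.
by rewrite !gt_eqF//; lra.
Qed.

(** Termwise, the moment of [r ^ (2k)] under [1 - r^2/t^2] supplies the denominator which, by
    [cc_add2], turns [cc a k] into a multiple of [cc (a + 2) k]. *)
Lemma sonine t x : 0 < t ->
  it (fun r => \1_`[0, t] r * ((1 - r ^+ 2 / t ^+ 2) * (j_alpha a (x * r) * W r))) =
  pw (2 * a + 2) t / (2 * (a + 1) * (a + 2)) * j_alpha (a + 2) (x * t).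
Proof.
move=> t0; have a1 := a_gt0; have a2 : 2^-1 <= a + 2 by lra.
pose wt r := \1_`[0, t] r * ((1 - r ^+ 2 / t ^+ 2) * W r).
have wtE r : 0 <= wt r <= \1_`[0, t] r * W r.
  rewrite /wt indicE mem_setE in_itv/=; case: (boolP (0 <= r <= t)) => [/andP[r0 rt]|_]; last first.
    by rewrite !mul0r lexx.
  have h : 0 <= r ^+ 2 / t ^+ 2 <= 1.
    by rewrite divr_ge0 ?sqr_ge0//= ler_pdivrMr ?exprn_gt0// mul1r lerXn2r ?nnegrE// (ltW t0).
  rewrite !mul1r mulr_ge0 ?W_ge0//=; last by lra.
  by rewrite ler_piMl ?W_ge0//; lra.
have wtm : measurable_fun setT wt.
  apply: measurable_funM; first exact: measurable_indic.
  apply: measurable_funM; last exact: W_meas.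
  apply: measurable_funB; first exact: measurable_cst.
  by apply: measurable_funM; [exact: exprn_measurable|exact: measurable_cst].
have mom k : ig (fun r => wt r * r ^+ (2 * k)).
  apply: (ig_dom (fun r => t ^+ (2 * k) * (\1_`[0, t] r * W r))).
  - by apply: measurable_funM => //; exact: exprn_measurable.
  - by apply: igZ; exact: W_ig_bnd.
  move=> r; rewrite normrM; have /andP[w1 w2] := wtE r; rewrite (ger0_norm w1) mulrC.
  move: w1 w2; rewrite /wt indicE mem_setE in_itv/=; case: andP => [[r0 rt]|_]; last first.
    by rewrite !mul0r ?mulr0.
  move=> w1 w2; rewrite ler_pM// normrX lerXn2r ?nnegrE// ?(ltW t0)//.
  by rewrite ger0_norm.
pose fn n r := phis a n (- (x * r) ^+ 2) * wt r.
have mfn n : measurable_fun setT (fn n).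
  apply: measurable_funM => //; apply: (measurableT_comp (phis_meas a n)).
  by apply: measurable_funN; apply: measurable_funX; exact: mulrl_measurable.
have bd n r : `|fn n r| <= expR (`|x| * t) * (\1_`[0, t] r * W r).
  rewrite normrM; have /andP[w1 w2] := wtE r; rewrite (ger0_norm w1).
  move: w1 w2; rewrite /wt indicE mem_setE in_itv/=; case: andP => [[r0 rt]|_]; last first.
    by rewrite !mul0r ?mulr0.
  move=> w1 w2; rewrite ler_pM// (le_trans (phis_bound _ a0 _ _))// ler_expR normrN.
  rewrite ger0_norm ?sqr_ge0// sqrtr_sqr normrM ler_wpM2l//.
  by rewrite ger0_norm.
have cfn r : fn n r @[n --> \oo] --> j_alpha a (x * r) * wt r.
  by rewrite j_alphaE; apply: cvgM; [exact: Phi_cvg|exact: cvg_cst].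
have [_ H] := it_dct _ _ _ mfn (igZ _ _ (W_ig_bnd _ _)) bd cfn.
transitivity (it (fun r => j_alpha a (x * r) * wt r)).
  by apply: eq_it => r; rewrite /wt; ring.
apply: cvg_uniqueN H _.
rewrite (_ : (fun n => _) = fun n => pw (2 * a + 2) t / (2 * (a + 1) * (a + 2)) * phis (a + 2) n (- (x * t) ^+ 2)).
  by rewrite j_alphaE; apply: cvgM; [exact: cvg_cst|exact: Phi_cvg].
apply/funext => n; rewrite /fn /phis; under eq_fun do rewrite mulr_suml.
have nn (c d : R) k : (- (c * d) ^+ 2) ^+ k = (- c ^+ 2) ^+ k * d ^+ (2 * k).
  by rewrite (exprM d) -exprMn; congr (_ ^+ _); ring.
have e k : (fun r => cc a k * (- (x * r) ^+ 2) ^+ k * wt r) =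
   fun r => (cc a k * (- x ^+ 2) ^+ k) * (wt r * r ^+ (2 * k)).
  by apply/funext => r; rewrite nn; ring.
rewrite it_sum; last by move=> k; rewrite e; exact: igZ.
rewrite mulr_sumr; apply: eq_bigr => k _; rewrite e itZ//.
rewrite [it _](_ : _ = pw (2 * a + 2) t * t ^+ (2 * k) / (2 * (a + k%:R + 1) * (a + k%:R + 2))).
  rewrite nn.
  transitivity (pw (2 * a + 2) t * t ^+ (2 * k) * (- x ^+ 2) ^+ k * (cc a k / (2 * (a + k%:R + 1) * (a + k%:R + 2)))).
    by ring.
  by rewrite cc_add2; ring.
by rewrite -sonine_moment//; apply: eq_it => r; rewrite /wt; ring.
Qed.

End Sonine.

Lemma W_pw (R : realType) (a x : R) : W a x = pw (2 * a + 1) x.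
Proof. by []. Qed.

(** * A bump function with nonnegative transform *)

Section Bump.
Context {R : realType}.
Implicit Types (x y z s r t l m : R) (n k : nat).
Variable a : R.
Hypothesis a0 : 2^-1 <= a.
Variable sg : R.
Hypothesis sg0 : 0 < sg.

Let a_gt0 : 0 < a.
Proof. by apply: lt_le_trans a0; rewrite invr_gt0. Qed.

Let a2 : 2^-1 <= a + 2.
Proof. by have := a_gt0; lra. Qed.

Lemma pw_sqrt (p y : R) : 0 <= y -> pw (2 * p) (Num.sqrt y) = pw p y.
Proof.
rewrite le_eqVlt => /predU1P[<-|y0]; first by rewrite sqrtr0 !pw_neg.
have s0 : 0 < Num.sqrt y by rewrite sqrtr_gt0.
rewrite -{2}(sqr_sqrtr (ltW y0)) expr2 pwM ?(ltW s0)//.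
by rewrite -pwD; congr (pw _ _); ring.
Qed.

(* With this weight, the powers of [T = sg ^+ 2 * (2 - 2 * s)] produced by Sonine's integral turn
   into the density of the product formula for [j_alpha (a + 2) (sg * l) ^+ 2]. *)
Definition kap s : R := \1_`[(-1), 1] s * (pw (a + 3 / 2) (1 + s) * pw (2^-1) (1 - s)).

Lemma kap_ge0 s : 0 <= kap s.
Proof. by rewrite !mulr_ge0// pw_ge0. Qed.

Lemma kap_meas : measurable_fun setT kap.
Proof.
apply: measurable_funM; first exact: measurable_indic.
apply: measurable_funM; apply: (measurableT_comp (pw_meas _)).
  by apply: measurable_funD => //; exact: measurable_cst.
by apply: measurable_funB => //; exact: measurable_cst.
Qed.

Lemma kap_ig : ig kap.
Proof.
have a1 := a_gt0.
apply: (ig_dom (fun s => (pw (a + 3 / 2) 2 * pw 2^-1 2) * \1_`[(-1), 1] s)).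
- exact: kap_meas.
- by apply: igZ; exact: ig_indic_bnd.
move=> s; rewrite ger0_norm ?kap_ge0// /kap mulrC indicE mem_setE in_itv/=.
case: andP => [[s1 s2]|_]; last by rewrite !mulr0.
by rewrite !mulr1 ler_pM ?pw_ge0//; apply: pw_le; lra.
Qed.

Lemma kap_neq0 s : kap s != 0 -> -1 <= s /\ s < 1.
Proof.
rewrite /kap indicE mem_setE in_itv/=; case: andP => [[h1 h2] h3|]; last by rewrite !mul0r eqxx.
split=> //; rewrite lt_neqAle h2 andbT; apply/eqP => e.
by move: h3; rewrite e subrr (pw_neg _ 0)// !mulr0 eqxx.
Qed.

Let tt s : R := sg * Num.sqrt (2 - 2 * s).

Lemma kapE s : kap s * pw (2 * a + 2) (tt s) =
  pw (2 * a + 2) sg * pw (a + 1) 2 * rho (a + 2) s.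
Proof.
have a1 := a_gt0.
rewrite /kap /rho indicE mem_setE in_itv/=; case: (boolP (-1 <= s <= 1)); last by rewrite !mul0r mulr0.
move=> /andP[s1 s2]; rewrite !mul1r.
have h1 : 0 <= 1 - s by lra. have h2 : 0 <= 1 + s by lra.
have e1 : 2 * a + 2 = 2 * (a + 1) by ring.
rewrite pwM ?sqrtr_ge0 ?(ltW sg0)// {2}e1 pw_sqrt; last by lra.
have -> : 2 - 2 * s = 2 * (1 - s) by ring.
rewrite pwM//.
have -> : (1 - s ^+ 2) `^ (a + 2 - 2^-1) = pw (a + 3 / 2) (1 + s) * (pw (2^-1) (1 - s) * pw (a + 1) (1 - s)).
  rewrite -pwD (_ : 2^-1 + (a + 1) = a + 3 / 2); last by lra.
  rewrite -pwM// pw_powR; last 2 first.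
  - by lra.
  - by rewrite mulr_ge0.
  by congr (_ `^ _); [ring|lra].
ring.
Qed.

(** The truncated parabola [(1 - r^2/T)_+]. At [T <= 0] the value is 1, which is harmless: with
    [T = sg^2 (2 - 2s)] this means [1 <= s], where [kap] vanishes. *)
Definition bb (T r : R) : R := Num.max 0 (1 - r ^+ 2 * pw (-1) T).

Lemma bb_bnd T r : 0 <= bb T r <= 1.
Proof.
rewrite /bb le_max lexx/= ge_max ler01/= gerBl mulr_ge0 ?sqr_ge0// pw_ge0 //.
Qed.

Lemma bb_sqr t r : 0 < t -> bb (t ^+ 2) r * W a r = \1_`[0, t] r * ((1 - r ^+ 2 / t ^+ 2) * W a r).
Proof.
move=> t0; have [r0|r0] := leP r 0; first by rewrite W_neg// !mulr0.
rewrite /bb pw_pos ?exprn_gt0// powR_inv1 ?exprn_ge0 ?(ltW t0)// mulrA; congr (_ * _).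
rewrite indicE mem_setE in_itv/= (ltW r0)/=.
have [rt|rt] := leP r t.
  rewrite mul1r max_r// subr_ge0 ler_pdivrMr ?exprn_gt0// mul1r.
  by rewrite lerXn2r ?nnegrE ?(ltW t0) ?(ltW r0).
rewrite mul0r max_l// subr_le0 ler_pdivlMr ?exprn_gt0// mul1r.
by rewrite lerXn2r ?nnegrE ?(ltW t0) ?(ltW r0)// ltW.
Qed.

(** The cut to [[0, 2 * sg]] provides an integrable majorant in [r]. On the half-line it changes
    nothing, since [T <= 4 sg^2] for [s] in [[-1, 1]] (see [th_supp]). *)
Definition th r s : R := \1_`[0, 2 * sg] r * (kap s * bb (sg ^+ 2 * (2 - 2 * s)) r).
Definition gb r : R := it (th r).

Lemma th_meas : measurable_fun setT (fun z : R * R => th z.1 z.2).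
Proof.
apply: measurable_funM.
  have mi : measurable_fun setT (\1_`[0, 2 * sg] : R -> R) by exact: measurable_indic.
  exact: (measurableT_comp mi measurable_fst).
apply: measurable_funM.
  exact: (measurableT_comp kap_meas measurable_snd).
apply: measurable_maxr; first exact: measurable_cst.
apply: measurable_funB; first exact: measurable_cst.
apply: measurable_funM; first by apply: measurable_funX; exact: measurable_fst.
apply: (measurableT_comp (pw_meas _)).
apply: measurable_funM; first exact: measurable_cst.
apply: measurable_funB; first exact: measurable_cst.
by apply: measurable_funM; [exact: measurable_cst|exact: measurable_snd].
Qed.

Lemma th_ge0 r s : 0 <= th r s.
Proof. by rewrite mulr_ge0// mulr_ge0 ?kap_ge0//; have /andP[] := bb_bnd (sg ^+ 2 * (2 - 2 * s)) r. Qed.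

Lemma th_bnd r s : `|th r s| <= \1_`[0, 2 * sg] r * kap s.
Proof.
rewrite ger0_norm ?th_ge0// /th ler_wpM2l// ler_piMr ?kap_ge0//.
by have /andP[] := bb_bnd (sg ^+ 2 * (2 - 2 * s)) r.
Qed.

Lemma gb_ig : ig gb.
Proof. by apply: (fubini_ig1 th _ _ th_meas _ kap_ig th_bnd); exact: ig_indic_bnd. Qed.

Lemma gb_ge0 r : 0 <= gb r.
Proof. by apply: it_ge0 => s; exact: th_ge0. Qed.

Lemma gb_le r : gb r <= it kap * \1_`[0, 2 * sg] r.
Proof.
rewrite mulrC -itZ; last exact: kap_ig.
apply: it_le; last by move=> s; rewrite (le_trans (ler_norm _))// th_bnd.
  by apply: (slice1_ig th _ _ th_meas kap_ig th_bnd).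
by apply: igZ; exact: kap_ig.
Qed.

Lemma th_supp r s : 2 * sg < r -> kap s * bb (sg ^+ 2 * (2 - 2 * s)) r = 0.
Proof.
move=> r2; have [->|k0] := eqVneq (kap s) 0; first by rewrite mul0r.
have [s1 s2] := kap_neq0 s k0.
have T0 : 0 < sg ^+ 2 * (2 - 2 * s) by rewrite mulr_gt0 ?exprn_gt0//; lra.
rewrite /bb pw_pos// powR_inv1 ?(ltW T0)// max_l ?mulr0// subr_le0 ler_pdivlMr// mul1r.
have : (2 * sg) ^+ 2 <= r ^+ 2.
  by rewrite lerXn2r ?nnegrE ?mulr_ge0 ?(ltW sg0) ?(ltW r2)// (le_trans _ (ltW r2))// mulr_ge0 ?(ltW sg0).
have := sqr_ge0 sg; nra.
Qed.

Lemma gbE r : 0 <= r -> gb r = it (fun s => kap s * bb (sg ^+ 2 * (2 - 2 * s)) r).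
Proof.
move=> r0; apply: eq_it => s; rewrite /th indicE mem_setE in_itv/= r0/=.
by have [_|r2] := leP r (2 * sg); rewrite ?mul1r// mul0r th_supp.
Qed.

(** Dominated convergence under [kap]. Taking [0 < x] avoids the jump of the indicator at 0, and
    [gbE] removes the one at [2 * sg]. Inversion will be applied to a test function with factor
    [gb], hence the need for continuity. *)
Lemma gb_continuous x : 0 < x -> gb y @[y --> x] --> gb x.
Proof.
move=> x0; pose G r := it (fun s => kap s * bb (sg ^+ 2 * (2 - 2 * s)) r).
have mT : measurable_fun setT (fun s => sg ^+ 2 * (2 - 2 * s)).
  apply: measurable_funM; first exact: measurable_cst.
  by apply: measurable_funB; [exact: measurable_cst|exact: mulrl_measurable].
have GG : G y @[y --> x] --> G x.
  apply/(@cvg_nbhsP _ R^o) => w wx.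
  apply: (it_dct (fun n s => kap s * bb (sg ^+ 2 * (2 - 2 * s)) (w n)) _ kap _ kap_ig _ _).2.
  - move=> n; apply: measurable_funM; first exact: kap_meas.
    apply: measurable_maxr; first exact: measurable_cst.
    apply: measurable_funB; first exact: measurable_cst.
    apply: measurable_funM; first exact: measurable_cst.
    exact: (measurableT_comp (pw_meas _) mT).
  - move=> n s; have /andP[b0 b1] := bb_bnd (sg ^+ 2 * (2 - 2 * s)) (w n).
    by rewrite (ger0_norm (mulr_ge0 (kap_ge0 s) b0)) ler_piMr ?kap_ge0.
  - move=> s; apply: cvgM; first exact: cvg_cst.
    have /(@cvg_nbhsP _ R^o) : bb (sg ^+ 2 * (2 - 2 * s)) y @[y --> x] --> bb (sg ^+ 2 * (2 - 2 * s)) x; last by apply.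
    apply: (@continuous_max _ _ (fun=> 0) (fun y => 1 - y ^+ 2 * pw (-1) (sg ^+ 2 * (2 - 2 * s)))).
      exact: cvg_cst.
    apply: cvgB; first exact: cvg_cst.
    by apply: cvgM; [exact: exprn_continuous|exact: cvg_cst].
rewrite (gbE x (ltW x0)); apply: cvg_trans GG; apply: near_eq_cvg.
by near=> y; rewrite gbE// ltW//; near: y; exact: lt_nbhsr.
Unshelve. all: by end_near. Qed.

Lemma gbW_ig (h : R -> R) (C : R) : measurable_fun setT h -> (forall x, `|h x| <= C) ->
  ig (fun x => gb x * (h x * W a x)).
Proof.
move=> mh hC; have C0 : 0 <= C by apply: le_trans (hC 0).
apply: (ig_dom (fun x => (it kap * C) * (\1_`[0, 2 * sg] x * W a x))).
- apply: measurable_funM; first exact: (ig_meas gb_ig).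
  by apply: measurable_funM => //; exact: W_meas.
- by apply: igZ; exact: W_ig_bnd.
move=> x; rewrite !normrM (ger0_norm (gb_ge0 x)) (ger0_norm (W_ge0 a x)).
apply: (@le_trans _ _ (it kap * \1_`[0, 2 * sg] x * (C * W a x))); last by rewrite mulrACA.
rewrite ler_pM ?gb_ge0 ?gb_le ?mulr_ge0 ?W_ge0//.
by rewrite ler_wpM2r ?W_ge0.
Qed.

Definition Cg : R := pw (2 * a + 2) sg * pw (a + 1) 2 / (2 * (a + 1) * (a + 2)) * NN (a + 2) 0.

Lemma Cg_gt0 : 0 < Cg.
Proof.
have a1 := a_gt0; rewrite mulr_gt0 ?NN0_gt0// divr_gt0// ?mulr_gt0 ?pw_gt0//; lra.
Qed.

(** For fixed [s] this is Sonine's integral at [t = tt s]. As [tt s = sg * dist_s 1 1 s], the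
    remaining average over [s] is the product formula with two equal arguments, so that a square
    results. *)
Lemma gb_hat l : it (fun x => gb x * (j_alpha a (l * x) * W a x)) =
  Cg * j_alpha (a + 2) (sg * l) ^+ 2.
Proof.
have a1 := a_gt0.
pose f x s := th x s * (j_alpha a (l * x) * W a x).
have mf : measurable_fun setT (fun z : R * R => f z.1 z.2).
  apply: measurable_funM; first exact: th_meas.
  apply: measurable_funM; last exact: (measurableT_comp (W_meas a) measurable_fst).
  exact: (measurableT_comp (jl_meas a a0 l) measurable_fst).
have bf x s : `|f x s| <= (\1_`[0, 2 * sg] x * W a x) * kap s.
  rewrite mulrAC /f normrM ler_pM ?th_bnd// normrM (ger0_norm (W_ge0 a x)).
  by rewrite ler_piMl ?W_ge0// j_le1.
have E x : it (f x) = gb x * (j_alpha a (l * x) * W a x).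
  by rewrite /f itZr//; apply: (slice1_ig th _ _ th_meas kap_ig th_bnd).
under eq_fun do rewrite -E.
rewrite (fubini_it f _ _ mf (W_ig_bnd a a0 _ _) kap_ig bf).
have -> : Cg * j_alpha (a + 2) (sg * l) ^+ 2 =
    (pw (2 * a + 2) sg * pw (a + 1) 2 / (2 * (a + 1) * (a + 2))) *
    (NN (a + 2) 0 * (j_alpha (a + 2) (1 * (sg * l)) * j_alpha (a + 2) (1 * (sg * l)))).
  by rewrite /Cg mul1r; ring.
rewrite -j_product//.
have ji : ig (fun s => j_alpha (a + 2) (dist_s 1 1 s * (sg * l)) * rho (a + 2) s).
  apply: (ig_rho _ a2 (fun s => j_alpha (a + 2) (dist_s 1 1 s * (sg * l))) 1); last by move=> s _; exact: j_le1.
  apply: (measurableT_comp (j_meas _ a2)).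
  apply: measurable_funM; last exact: measurable_cst.
  exact: dist_meas.
rewrite -itZ//; apply: eq_it => s.
have -> : dist_s 1 1 s * (sg * l) = l * tt s.
  rewrite /dist_s /tt (_ : 1 ^+ 2 + 1 ^+ 2 - 2 * 1 * 1 * s = 2 - 2 * s); last by ring.
  by ring.
transitivity (kap s * (pw (2 * a + 2) (tt s) / (2 * (a + 1) * (a + 2)) * j_alpha (a + 2) (l * tt s))); last first.
  transitivity (kap s * pw (2 * a + 2) (tt s) * j_alpha (a + 2) (l * tt s) / (2 * (a + 1) * (a + 2))).
    by ring.
  by rewrite kapE; ring.
have [k0|k0] := eqVneq (kap s) 0.
  by rewrite k0 mul0r (_ : (fun _ => _) = fun=> 0) ?it0//; apply/funext => x; rewrite /f /th k0 !mul0r mulr0 mul0r.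
have [s1 s2] := kap_neq0 s k0.
have t0 : 0 < tt s by rewrite mulr_gt0// sqrtr_gt0; lra.
have t2 : tt s ^+ 2 = sg ^+ 2 * (2 - 2 * s) by rewrite exprMn sqr_sqrtr//; lra.
have ind x : \1_`[0, 2 * sg] x * \1_`[0, tt s] x = \1_`[0, tt s] x :> R.
  rewrite !indicE !mem_setE !in_itv/=; case: (boolP (0 <= x <= tt s)) => [/andP[x0 xt]|_]; last by rewrite mulr0.
  rewrite x0/= (_ : x <= 2 * sg) ?mulr1// (le_trans xt)// /tt mulrC ler_wpM2r ?(ltW sg0)//.
  rewrite -(ler_pXn2r (n := 2))// ?nnegrE ?sqrtr_ge0// sqr_sqrtr; lra.
have E2 x : f x s = kap s * (\1_`[0, tt s] x * ((1 - x ^+ 2 / tt s ^+ 2) * (j_alpha a (l * x) * W a x))).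
  rewrite /f /th -t2.
  transitivity (kap s * (\1_`[0, 2 * sg] x * (bb (tt s ^+ 2) x * W a x) * j_alpha a (l * x))); first by ring.
  by rewrite bb_sqr// -[in RHS]ind; ring.
rewrite -(sonine a a0)// -itZ.
  by apply: eq_it => x; exact: E2.
have := igZ _ (kap s)^-1 (slice2_ig f _ _ mf (W_ig_bnd a a0 _ _) bf s).
by apply: eq_integrable => // x _ /=; rewrite E2 mulKf.
Qed.

Definition KK l m : R := it (fun x => gb x * (j_alpha a (l * x) * j_alpha a (m * x) * W a x)).

Lemma KKE l m : NN a 0 * KK l m = Cg * it (fun s => j_alpha (a + 2) (sg * dist_s l m s) ^+ 2 * rho a s).
Proof.
pose f x s := gb x * (j_alpha a (dist_s l m s * x) * rho a s * W a x).
have mf : measurable_fun setT (fun z : R * R => f z.1 z.2).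
  apply: measurable_funM; first exact: (measurableT_comp (ig_meas gb_ig) measurable_fst).
  apply: measurable_funM; last exact: (measurableT_comp (W_meas a) measurable_fst).
  apply: measurable_funM; last exact: (measurableT_comp (rho_meas a) measurable_snd).
  apply: (measurableT_comp (j_meas _ a0)); apply: measurable_funM; last exact: measurable_fst.
  exact: (measurableT_comp (dist_meas l m) measurable_snd).
have bf x s : `|f x s| <= (gb x * (1 * W a x)) * rho a s.
  rewrite /f 2!normrM [`|j_alpha _ _ * _|]normrM (ger0_norm (gb_ge0 x)) (ger0_norm (W_ge0 a x)) (ger0_norm (rho_ge0 a s)).
  rewrite -[leRHS]mulrA ler_wpM2l ?gb_ge0// mul1r mulrC ler_wpM2l ?W_ge0//.
  by rewrite ler_piMl ?rho_ge0// j_le1.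
have gi : ig (fun x => gb x * (1 * W a x)).
  by apply: (gbW_ig (fun=> 1) 1) => // x; rewrite normr1.
have ji x : ig (fun s => j_alpha a (dist_s l m s * x) * rho a s).
  apply: (ig_rho _ a0 (fun s => j_alpha a (dist_s l m s * x)) 1); last by move=> s _; exact: j_le1.
  apply: (measurableT_comp (j_meas _ a0)); apply: measurable_funM; last exact: measurable_cst.
  exact: dist_meas.
have E x : it (f x) = NN a 0 * (gb x * (j_alpha a (l * x) * j_alpha a (m * x) * W a x)).
  rewrite [RHS](_ : _ = gb x * W a x * (NN a 0 * (j_alpha a (l * x) * j_alpha a (m * x)))); last by ring.
  by rewrite -j_product// -itZ//; apply: eq_it => s; rewrite /f; ring.
have -> : NN a 0 * KK l m = it (fun x => it (f x)).
  rewrite /KK -itZ; first by apply: eq_it => x; rewrite E.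
  apply: (gbW_ig (fun x => j_alpha a (l * x) * j_alpha a (m * x)) 1).
    by apply: measurable_funM; exact: jl_meas.
  by move=> x; rewrite normrM mulr_ile1// j_le1.
rewrite (fubini_it f _ _ mf gi (rho_ig a a0) bf) -itZ; last first.
  apply: (ig_rho _ a0 (fun s => j_alpha (a + 2) (sg * dist_s l m s) ^+ 2) 1); last first.
    by move=> s _; rewrite normrX exprn_ile1// j_le1.
  apply: measurable_funX; apply: (measurableT_comp (j_meas _ a2)).
  by apply: measurable_funM; [exact: measurable_cst|exact: dist_meas].
apply: eq_it => s; rewrite mulrA -gb_hat -itZr; last first.
  by apply: gbW_ig (jl_meas a a0 _) _ => x; exact: j_le1.
by apply: eq_it => x; rewrite /f; ring.
Qed.

Lemma KK_ge0 l m : 0 <= KK l m.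
Proof.
rewrite -(pmulr_rge0 _ (NN0_gt0 a a0)) KKE mulr_ge0 ?(ltW Cg_gt0)//.
by apply: it_ge0 => s; rewrite mulr_ge0 ?sqr_ge0 ?rho_ge0.
Qed.

(** The 4 comes from squaring the bound of [j_ge]; the last factor is what remains of
    [d ^ (a+1/2) * n ^ (2a+1)] when [d * n^2 = 1/2] in [KK_lower]. *)
Definition c0 : R := Cg / NN a 0 / 4 * pw (a + 2^-1) 2^-1.

Lemma c0_gt0 : 0 < c0.
Proof. by rewrite mulr_gt0 ?pw_gt0// !divr_gt0// ?Cg_gt0 ?NN0_gt0. Qed.

(* The cosines [s] within [n^-2] of 1 keep [dist_s l m s <= 2] and have [rho]-mass of order
   [n^-(2a+1)]. *)
Lemma KK_lower l m n : sg <= 6^-1 -> (0 < n)%N ->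
  n%:R - 1 <= l <= n%:R -> n%:R - 1 <= m <= n%:R ->
  c0 <= KK l m * pw (2 * a + 1) n%:R.
Proof.
move=> sg6 n0 ln mn; have a1 := a_gt0.
have N0 := NN0_gt0 a a0; have C0 := Cg_gt0.
have n1 : 1 <= n%:R :> R by rewrite ler1n.
have np : 0 < n%:R :> R by lra.
(* On [[1 - 2d, 1 - d]] one has [l m (1 - s) <= 1], so [dist_s l m s ^ 2 = (l - m)^2 + 2 l m (1 - s)
   <= 3], and [sg <= 1/6] brings the argument of [j_alpha] below the threshold 1/3 of [j_ge]. There
   [1 - s^2 >= d] as well, because [s >= 0]. *)
pose d : R := (2 * n%:R ^+ 2)^-1.
have d0 : 0 < d by rewrite invr_gt0 mulr_gt0// exprn_gt0.
have dn : d * n%:R ^+ 2 = 2^-1 by rewrite /d; field; lra.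
have d1 : d <= 2^-1 by rewrite -dn ler_peMr ?(ltW d0)// exprn_ege1.
have key : 4^-1 * pw (a + 2^-1) d <= it (fun s => j_alpha (a + 2) (sg * dist_s l m s) ^+ 2 * rho a s).
  have -> : 4^-1 * pw (a + 2^-1) d = it (fun s => (4^-1 * pw (a - 2^-1) d) * \1_`[1 - 2 * d, 1 - d] s).
    rewrite itZ; last exact: ig_indic_bnd.
    rewrite it_indic_itv; last by lra.
    rewrite (_ : a + 2^-1 = a - 2^-1 + 1%:R); last by lra.
    by rewrite pwXn expr1; ring.
  apply: it_le.
  - by apply: igZ; exact: ig_indic_bnd.
  - apply: (ig_rho _ a0 (fun s => j_alpha (a + 2) (sg * dist_s l m s) ^+ 2) 1); last first.
      by move=> s _; rewrite normrX exprn_ile1// j_le1.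
    apply: measurable_funX; apply: (measurableT_comp (j_meas _ a2)).
    by apply: measurable_funM; [exact: measurable_cst|exact: dist_meas].
  move=> s; rewrite indicE mem_setE in_itv/=.
  case: andP => [[s1 s2]|_]; last by rewrite mulr0 mulr_ge0 ?sqr_ge0 ?rho_ge0.
  have sn : `|s| <= 1 by rewrite ler_norml; lra.
  rewrite mulr1 ler_pM ?pw_ge0//.
    have : dist_s l m s ^+ 2 <= 2 ^+ 2.
      rewrite dist_sqr//.
      have : l * m * (1 - s) <= n%:R ^+ 2 * (2 * d).
        by rewrite ler_pM ?mulr_ge0//; [lra|lra|lra|rewrite expr2 ler_pM//; lra|lra].
      by nra.
    rewrite ler_pXn2r ?nnegrE ?sqrtr_ge0// => h.
    have : 2^-1 <= j_alpha (a + 2) (sg * dist_s l m s).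
      apply: j_ge => //; rewrite ger0_norm ?mulr_ge0 ?(ltW sg0) ?sqrtr_ge0//.
      apply: (@le_trans _ _ (6^-1 * 2)); last by lra.
      by rewrite ler_pM ?(ltW sg0) ?sqrtr_ge0.
    by nra.
  rewrite rho_in// pw_pos//; apply: ge0_ler_powR; rewrite ?nnegrE ?subr_ge0//; [lra| |]; nra.
rewrite -(ler_pM2l N0) [leRHS]mulrA KKE.
have pn : 0 < pw (2 * a + 1) n%:R :> R by rewrite pw_gt0.
have -> : NN a 0 * c0 = Cg * (4^-1 * pw (a + 2^-1) d) * pw (2 * a + 1) n%:R.
  have -> : pw (2 * a + 1) n%:R = pw (a + 2^-1) (n%:R ^+ 2) :> R.
    rewrite expr2 pwM ?(ltW np)// -pwD; congr (pw _ _); lra.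
  rewrite /c0 -dn pwM ?sqr_ge0 ?(ltW d0)//.
  by field; rewrite gt_eqF.
by rewrite ler_pM2r// ler_pM2l.
Qed.

End Bump.

(** * Gaussians *)

Section Gauss.
Context {R : realType}.
Local Notation mu := (@lebesgue_measure R).
Implicit Types (x y z s r t l m e q p : R) (n k : nat).

Definition Gs e x : R := expR (- (e * x ^+ 2)).

Lemma Gs_gt0 e x : 0 < Gs e x. Proof. exact: expR_gt0. Qed.

Lemma Gs_ge0 e x : 0 <= Gs e x. Proof. exact: expR_ge0. Qed.

Lemma Gs_cont e : continuous (Gs e).
Proof.
move=> x; apply: (@continuous_comp _ _ _ (fun x : R => - (e * x ^+ 2)) expR); last exact: continuous_expR.
by apply: cvgN; apply: cvgM; [exact: cvg_cst|exact: exprn_continuous].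
Qed.

Lemma Gs_meas e : measurable_fun setT (Gs e).
Proof. by apply: continuous_measurable_fun; exact: Gs_cont. Qed.

Lemma Gs_le1 e x : 0 <= e -> Gs e x <= 1.
Proof. by move=> e0; rewrite -expR0 ler_expR oppr_le0 mulr_ge0// sqr_ge0. Qed.

Lemma exp_pos_ig : ig (fun x => expR (- x) * \1_`[0, +oo[ x).
Proof.
have := @integrable_exponential_pdf R 1 ltr01.
apply: eq_integrable => // x _ /=; congr (_%:E).
rewrite /exponential_pdf patchE indicE; case: ifP => _; rewrite ?mulr0//.
by rewrite mul1r mulr1 mulN1r.
Qed.

(** Completing the square in [e x^2 - (p + q + 1) x]; the added 1 leaves a factor [expR (- x)] to
    integrate. *)
Lemma gauss_dom e p q x : 0 < e -> 0 <= p ->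
  expR (q * x) * Gs e x * pw p x <= expR ((p + q + 1) ^+ 2 / (4 * e)) * (expR (- x) * \1_`[0, +oo[ x).
Proof.
move=> e0 p0; have [x0|x0] := leP x 0.
  by rewrite pw_neg// mulr0 !mulr_ge0 ?expR_ge0.
rewrite indicE mem_setE in_itv/= (ltW x0) mulr1.
apply: (@le_trans _ _ (expR (q * x) * Gs e x * expR (p * x))).
  by rewrite ler_wpM2l ?mulr_ge0 ?expR_ge0// pw_le_exp.
rewrite /Gs -!expRD ler_expR.
have h : 0 <= (2 * e * x - (p + q + 1)) ^+ 2 / (4 * e) by rewrite divr_ge0 ?sqr_ge0// ltW// mulr_gt0.
have E : (2 * e * x - (p + q + 1)) ^+ 2 / (4 * e) = e * x ^+ 2 - (p + q + 1) * x + (p + q + 1) ^+ 2 / (4 * e).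
  by field; rewrite gt_eqF.
rewrite E in h; lra.
Qed.

Lemma gauss_ig e p q : 0 < e -> 0 <= p -> ig (fun x => expR (q * x) * Gs e x * pw p x).
Proof.
move=> e0 p0; apply: ig_dom (igZ _ _ exp_pos_ig) _; last first.
  move=> x; rewrite ger0_norm; first exact: (gauss_dom e p q).
  by rewrite !mulr_ge0 ?expR_ge0 ?pw_ge0.
apply: measurable_funM; last exact: pw_meas.
apply: measurable_funM; last exact: Gs_meas.
by apply: (measurableT_comp (@measurable_expR R)); exact: mulrl_measurable.
Qed.

Lemma pw_exp_cvg0 p q : 0 <= p -> 0 < q -> pw p n.+1%:R * expR (- (q * n.+1%:R)) @[n --> \oo] --> (0 : R).
Proof.
(* Rescaling by [c] with [p c <= q/2] gives [x^p <= c^(-p) exp(p c x)], which costs at most half of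
   the exponential decay. *)
move=> p0 q0; pose c := q / (2 * (p + 1)).
have c0 : 0 < c by rewrite divr_gt0// mulr_gt0//; lra.
have pc : p * c <= q / 2.
  rewrite /c mulrA ler_pdivrMr; last by lra.
  by nra.
have E n : expR (- (q / 2)) ^+ n.+1 = expR (- (q / 2 * n.+1%:R)).
  by rewrite -expRM_natr mulNr.
apply: (@squeeze_cvgr _ _ _ _ (fun=> 0) (fun n => (pw p c)^-1 * expR (- (q / 2)) ^+ n.+1)).
- apply: nearW => n; rewrite mulr_ge0 ?pw_ge0 ?expR_ge0//= E.
  rewrite -(ler_pM2l (pw_gt0 p c c0)) mulrA -pwM ?(ltW c0)// mulVKf ?gt_eqF ?pw_gt0//.
  apply: (@le_trans _ _ (expR (p * (c * n.+1%:R)) * expR (- (q * n.+1%:R)))).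
    by rewrite ler_wpM2r ?expR_ge0// pw_le_exp.
  rewrite -expRD ler_expR.
  have n0 : 0 <= n.+1%:R :> R by [].
  have := ler_wpM2r n0 pc; lra.
- exact: cvg_cst.
- rewrite -(mulr0 (pw p c)^-1); apply: cvgM; first exact: cvg_cst.
  rewrite (cvg_shiftS (fun n => expR (- (q / 2)) ^+ n)); apply: cvg_expr.
  by rewrite ger0_norm ?expR_ge0// expR_lt1; lra.
Qed.

Variable a : R.
Hypothesis a0 : 2^-1 <= a.

Let a_gt0 : 0 < a.
Proof. by apply: lt_le_trans a0; rewrite invr_gt0. Qed.

Definition MM e k : R := it (fun x => x ^+ (2 * k) * (Gs e x * W a x)).

Lemma MM_ig e k : 0 < e -> ig (fun x => x ^+ (2 * k) * (Gs e x * W a x)).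
Proof.
move=> e0; have := gauss_ig e (2 * a + 1 + (2 * k)%:R) 0 e0.
rewrite (_ : (fun x => _) = fun x => x ^+ (2 * k) * (Gs e x * W a x)).
  by apply; have := a_gt0; have : 0 <= (2 * k)%:R :> R by []; lra.
by apply/funext => x; rewrite mul0r expR0 mul1r pwXn /W; ring.
Qed.

(** The derivative of [x ^ (2a+2+2k) * Gs e x] has integral 0 over the half-line. *)
Lemma MM_rec e k : 0 < e -> e * MM e k.+1 = (a + k.+1%:R) * MM e k.
Proof.
move=> e0; have a1 := a_gt0; have k0 : 0 <= k%:R :> R by [].
have kk0 : 0 <= (2 * k)%:R :> R by [].
pose p : R := 2 * a + 1 + (2 * k)%:R.
have p0 : 0 < p by rewrite /p; lra.
pose F x := pw (p + 1) x * Gs e x.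
pose f x := (p + 1) * (x ^+ (2 * k) * (Gs e x * W a x)) - (2 * e) * (x ^+ (2 * k.+1) * (Gs e x * W a x)).
have cF : continuous F.
  by move=> x; apply: cvgM; [apply: pw_continuous; lra|exact: Gs_cont].
have cf : continuous f.
  have c k' : continuous (fun x => x ^+ (2 * k') * (Gs e x * W a x)).
    move=> x; apply: cvgM; first exact: exprn_continuous.
    by apply: cvgM; [exact: Gs_cont|exact: W_cont].
  by move=> x; apply: cvgB; apply: cvgM; [exact: cvg_cst|exact: c|exact: cvg_cst|exact: c].
have fi : ig f by apply: igB; apply: igZ; exact: MM_ig.
have dF x B : 0 < x < B -> is_derive x 1 F (f x).
  move=> /andP[x0 _].
  have d1 := pw_derive (p + 1) x x0.
  have d2 : is_derive x 1 (fun x : R => - (e * x ^+ 2)) (- (2 * e * x)).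
    by apply: is_derive_eq; rewrite /GRing.scale/=; ring.
  have d3 := @is_derive1_comp _ expR _ x _ _ (is_derive_expR _) d2.
  have d4 := @is_deriveM _ _ _ _ _ _ _ _ d1 d3.
  apply: (@is_derive_eq _ _ _ F x 1 _ _ d4).
  rewrite /f /GRing.scale/= -/(Gs e x) addrK.
  have -> : x ^+ (2 * k.+1) = x * x * x ^+ (2 * k) by rewrite mulnS exprD expr2.
  have E : pw p x = W a x * x ^+ (2 * k) by rewrite /p pwXn.
  have -> : pw (p + 1) x = pw p x * x by rewrite (pwXn p 1) expr1.
  by rewrite E; ring.
have F00 : F 0 = 0 by rewrite /F pw_neg// mul0r.
have H n : it (fun x => \1_`[0, n.+1%:R] x * f x) = F n.+1%:R.
  have := @it_FTC R F f 0 n.+1%:R (ltr0Sn _ _) (cont_within _ _ cf) (cont_within _ _ cF) (dF^~ _).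
  by rewrite F00 subr0.
have mi n : measurable_fun setT (fun x => \1_`[0, n.+1%:R] x * f x).
  by apply: measurable_funM; [exact: measurable_indic|exact: ig_meas fi].
have bi n x : `|\1_`[0, n.+1%:R] x * f x| <= `|f x|.
  by rewrite normrM ler_piMl// indicE; case: (_ \in _); rewrite ?normr1 ?normr0.
have ci x : \1_`[0, n.+1%:R] x * f x @[n --> \oo] --> f x.
  have [x0|x0] := ltP x 0.
    rewrite (_ : f x = 0); last by rewrite /f W_neg ?(ltW x0)// !mulr0 subrr.
    by apply: cvg_near_cst; apply: nearW => n; rewrite mulr0.
  apply: cvg_near_cst; near=> n; rewrite indicE mem_set ?mul1r//= in_itv/= x0/=.
  rewrite (@le_trans _ _ n%:R)// ?ler_nat//; near: n; exact: nbhs_infty_ger.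
have [_ L] := it_dct _ _ _ mi (ig_abs _ fi) bi ci.
have L0 : it f = 0.
  apply: cvg_uniqueN L _; under eq_fun do rewrite H.
  rewrite (_ : (fun n => _) = fun n => pw (p + 1) n.+1%:R * expR (- (e * n.+1%:R ^+ 2))) //.
  apply: (@squeeze_cvgr _ _ _ _ (fun=> 0) (fun n => pw (p + 1) n.+1%:R * expR (- (e * n.+1%:R)))).
  - apply: nearW => n; rewrite mulr_ge0 ?pw_ge0 ?expR_ge0//= ler_wpM2l ?pw_ge0// ler_expR lerN2.
    by rewrite ler_pM2l// expr2 ler_peMr// ler1n.
  - exact: cvg_cst.
  - by apply: pw_exp_cvg0 => //; lra.
move: L0; rewrite itB; try by [apply: igZ; exact: MM_ig].
rewrite !itZ; try by [exact: MM_ig].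
rewrite -/(MM e k) -/(MM e k.+1) => /eqP; rewrite subr_eq0 => /eqP L1.
have : 2 * (e * MM e k.+1) = 2 * ((a + k.+1%:R) * MM e k).
  by rewrite mulrA -L1 /p -(natr1 k) natrM; ring.
by apply: mulfI; rewrite pnatr_eq0.
Unshelve. all: by end_near. Qed.

Lemma MM_E e k : 0 < e -> MM e k = MM e 0 * poch a k / e ^+ k.
Proof.
move=> e0; elim: k => [|k IH]; first by rewrite poch0 expr0 !mulr1 invr1 mulr1.
have := MM_rec e k e0; rewrite IH => /(canRL (mulKf (lt0r_neq0 e0))) ->.
rewrite pochS exprS; field.
by rewrite ?expf_neq0 ?gt_eqF.
Qed.

Lemma MM0_gt0 e : 0 < e -> 0 < MM e 0.
Proof.
move=> e0; have a1 := a_gt0.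
apply: (@lt_le_trans _ _ (it (fun x => Gs e 2 * \1_`[1, 2] x))).
  rewrite itZ; last exact: ig_indic_bnd.
  by rewrite mulr_gt0 ?Gs_gt0// it_indic_itv; lra.
apply: it_le; [by apply: igZ; exact: ig_indic_bnd|exact: MM_ig|move=> x].
rewrite muln0 expr0 mul1r indicE mem_setE in_itv/=; case: andP => [[x1 x2]|_]; last first.
  by rewrite mulr0 mulr_ge0 ?Gs_ge0 ?W_ge0.
rewrite mulr1 -[leLHS]mulr1 ler_pM ?Gs_ge0//.
  by rewrite ler_expR lerN2 ler_pM2l// lerXn2r ?nnegrE//; lra.
rewrite (@le_trans _ _ (W a 1))//; last by apply: pw_le; lra.
by rewrite /W pw_pos// powR1.
Qed.

(** The rising factorial in the moment [MM e k] cancels the one in [cc a k], and an exponential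
    series is left. *)
Lemma gauss_hat e l : 0 < e ->
  it (fun x => j_alpha a (l * x) * (Gs e x * W a x)) = MM e 0 * expR (- (l ^+ 2 / (4 * e))).
Proof.
move=> e0; have a1 := a_gt0.
pose wt x := Gs e x * W a x.
have wt0 x : 0 <= wt x by rewrite mulr_ge0 ?Gs_ge0 ?W_ge0.
have mwt : measurable_fun setT wt.
  by apply: measurable_funM; [exact: Gs_meas|exact: W_meas].
pose fn n x := phis a n (- (l * x) ^+ 2) * wt x.
have mfn n : measurable_fun setT (fn n).
  apply: measurable_funM => //; apply: (measurableT_comp (phis_meas a n)).
  by apply: measurable_funN; apply: measurable_funX; exact: mulrl_measurable.
have gi : ig (fun x => expR (`|l| * x) * Gs e x * W a x) by apply: gauss_ig => //; lra.
have bd n x : `|fn n x| <= expR (`|l| * x) * Gs e x * W a x.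
  rewrite normrM (ger0_norm (wt0 x)) -mulrA.
  have [x0|x0] := leP x 0; first by rewrite /wt W_neg// !mulr0.
  rewrite ler_wpM2r// (le_trans (phis_bound _ a0 _ _))// ler_expR normrN.
  by rewrite ger0_norm ?sqr_ge0// sqrtr_sqr normrM (gtr0_norm x0).
have cfn x : fn n x @[n --> \oo] --> j_alpha a (l * x) * wt x.
  by rewrite j_alphaE; apply: cvgM; [exact: Phi_cvg|exact: cvg_cst].
have [_ H] := it_dct _ _ _ mfn gi bd cfn.
apply: cvg_uniqueN H _.
rewrite (_ : (fun n => _) = fun n => MM e 0 * series (exp_coeff (- (l ^+ 2 / (4 * e)))) n).
  by apply: cvgM; [exact: cvg_cst|exact: is_cvg_series_exp_coeff].
apply/funext => n; rewrite /fn /phis; under eq_fun do rewrite mulr_suml.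
have nn (c d : R) k : (- (c * d) ^+ 2) ^+ k = (- c ^+ 2) ^+ k * d ^+ (2 * k).
  by rewrite (exprM d) -exprMn; congr (_ ^+ _); ring.
have E k : (fun x => cc a k * (- (l * x) ^+ 2) ^+ k * wt x) =
   fun x => (cc a k * (- l ^+ 2) ^+ k) * (x ^+ (2 * k) * (Gs e x * W a x)).
  by apply/funext => x; rewrite nn /wt; ring.
rewrite it_sum; last by move=> k; rewrite E; apply: igZ; exact: MM_ig.
rewrite /series/= mulr_sumr; apply: eq_bigr => k _; rewrite E itZ; last exact: MM_ig.
rewrite -/(MM e k) MM_E// /exp_coeff/= /cc.
have -> : (- (l ^+ 2 / (4 * e))) ^+ k = (- l ^+ 2) ^+ k / (4 ^+ k * e ^+ k).
  by rewrite -mulNr exprMn exprVn exprMn.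
field.
by rewrite !expf_neq0 ?gt_eqF ?poch_gt0 ?ltr0n ?fact_gt0.
Qed.

End Gauss.

(** * The heat kernel *)

Section Heat.
Context {R : realType}.
Local Notation mu := (@lebesgue_measure R).
Implicit Types (x y z s r t l m e q p : R) (n k : nat).
Variable a : R.
Hypothesis a0 : 2^-1 <= a.

Let a_gt0 : 0 < a.
Proof. by apply: lt_le_trans a0; rewrite invr_gt0. Qed.

Lemma it_scale (G : R -> R) (c : R) : 0 < c -> continuous G -> (forall x, 0 <= G x) ->
  (forall x, x <= 0 -> G x = 0) -> ig G -> ig (fun x => c * G (c * x)) ->
  it (fun x => c * G (c * x)) = it G.
Proof.
move=> c0 cG G0 Gn Gi Gci.
pose F x := c * x.
have dE : derive1 F = cst c.
  by apply/funext => x; rewrite derive1Ml// derive1_id mulr1.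
have H := @increasing_ge0_integration_by_substitutiony R F G 0.
have D (f : R -> R) : (forall x, x <= 0 -> f x = 0) -> ig f ->
    (\int[mu]_(x in `[0%R, +oo[) (f x)%:E)%E = (it f)%:E.
  move=> fn fi; rewrite it_indic// -it_fin//; apply: eq_integral => x _; congr (_%:E).
  rewrite indicE mem_setE in_itv/= andbT; have [x0|x0] := leP 0 x; first by rewrite mul1r.
  by rewrite mul0r fn// ltW.
apply: EFin_inj; rewrite -!D//; last first.
  by move=> x x0; rewrite Gn ?mulr0// mulr_ge0_le0// ltW.
have F00 : F 0 = 0 by rewrite /F mulr0.
rewrite F00 in H; rewrite H.
- by apply: eq_integral => x _; rewrite dE /= /F; congr (_%:E); rewrite mulrC.
- by move=> x y _ _ xy; rewrite /F ltr_pM2l.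
- by move=> x _; rewrite dE; exact: cvg_cst.
- by rewrite dE; exact: is_cvg_cst.
- by rewrite dE; exact: is_cvg_cst.
- split.
  + by move=> x _; apply: derivableM.
  + by apply: cvg_at_right_filter; apply: cvgM; [exact: cvg_cst|exact: cvg_id].
- exact: gt0_cvgMry.
- exact: cont_within.
- by move=> x _; exact: G0.
Qed.

Lemma MM_scale e : 0 < e -> MM a 1 0 = pw (a + 1) e * MM a e 0.
Proof.
move=> e0; have a1 := a_gt0; have s0 : 0 < Num.sqrt e by rewrite sqrtr_gt0.
pose G x := x ^+ (2 * 0) * (Gs 1 x * W a x).
have E : (fun x => Num.sqrt e * G (Num.sqrt e * x)) =
    fun x => pw (a + 1) e * (x ^+ (2 * 0) * (Gs e x * W a x)).
  apply/funext => x; rewrite /G muln0 !expr0 !mul1r /Gs /W mul1r exprMn sqr_sqrtr ?(ltW e0)//.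
  have [x0|x0] := leP x 0.
    have sx : Num.sqrt e * x <= 0 by rewrite mulr_ge0_le0 ?sqrtr_ge0.
    by rewrite !(pw_neg _ _ sx) !(pw_neg _ _ x0) !mulr0.
  rewrite pwM ?sqrtr_ge0 ?(ltW x0)//.
  have -> : pw (a + 1) e = Num.sqrt e * pw (2 * a + 1) (Num.sqrt e).
    rewrite -[X in X * _]expr1 mulrC -pwXn.
    rewrite (_ : 2 * a + 1 + 1%:R = (a + 1) + (a + 1)); last by ring.
    by rewrite (pwD (a + 1) (a + 1)) -pwM ?sqrtr_ge0// -expr2 sqr_sqrtr// ltW.
  by ring.
rewrite [LHS]/MM -/G -(it_scale G _ s0).
- by rewrite E itZ//; exact: MM_ig.
- move=> x; apply: cvgM; first exact: exprn_continuous.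
  by apply: cvgM; [exact: Gs_cont|exact: W_cont].
- by move=> x; rewrite /G muln0 expr0 mul1r mulr_ge0 ?Gs_ge0 ?W_ge0.
- by move=> x x0; rewrite /G W_neg// !mulr0.
- exact: MM_ig.
- by rewrite E; apply: igZ; exact: MM_ig.
Qed.

(* Constant of the inversion formula, read off on Gaussians. *)
Definition kpa : R := MM a 1 0 ^+ 2 * pw (a + 1) 4.

Lemma kpa_gt0 : 0 < kpa.
Proof. by rewrite mulr_gt0 ?pw_gt0// exprn_gt0// MM0_gt0. Qed.

(** Transforming [Gs e] twice multiplies it by the left-hand side, so this product is the constant
    of the inversion formula. Scaling shows that it does not depend on [e]. *)
Lemma MM_kpa e : 0 < e -> MM a e 0 * MM a (4 * e)^-1 0 = kpa.
Proof.
move=> e0; have e4 : 0 < (4 * e)^-1 by rewrite invr_gt0 mulr_gt0.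
have p1 := pw_gt0 (a + 1) _ e0; have p2 := pw_gt0 (a + 1) _ e4.
rewrite /kpa expr2 {1}(MM_scale e)// (MM_scale (4 * e)^-1)//.
have : pw (a + 1) e * pw (a + 1) (4 * e)^-1 * pw (a + 1) 4 = 1.
  rewrite -pwM ?(ltW e0) ?(ltW e4)// -pwM// ?mulr_ge0 ?(ltW e0) ?(ltW e4)//.
  rewrite (_ : _ * _ * _ = 1); last by field; rewrite gt_eqF.
  by rewrite pw_pos// powR1.
move=> h; transitivity (pw (a + 1) e * pw (a + 1) (4 * e)^-1 * pw (a + 1) 4 * (MM a e 0 * MM a (4 * e)^-1 0)).
  by rewrite h mul1r.
by ring.
Qed.

(** * The heat kernel at a fixed time *)

Section fixed_e.
Variable e : R.
Hypothesis e0 : 0 < e.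

(** The heat kernel at time [e], with total mass [kpa a] instead of 1. [Phi] at a nonnegative
    argument is its modified Bessel factor, which makes the kernel visibly nonnegative. *)
Definition pe x y : R := MM a e 0 * (Gs (4 * e)^-1 x * Gs (4 * e)^-1 y) * Phi a ((x * y / (2 * e)) ^+ 2).

Lemma pe_sym x y : pe x y = pe y x.
Proof. by rewrite /pe (mulrC x) (mulrC (Gs _ x)). Qed.

Lemma pe_ge0 x y : 0 <= pe x y.
Proof.
by rewrite /pe mulr_ge0 ?Phi_ge0 ?sqr_ge0// mulr_ge0 ?mulr_ge0 ?Gs_ge0// ltW// MM0_gt0.
Qed.

Lemma j_meas2 : measurable_fun setT (fun z : R * R => j_alpha a (z.1 * z.2)).
Proof.
apply: (measurableT_comp (j_meas a a0)).
by apply: measurable_funM; [exact: measurable_fst|exact: measurable_snd].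
Qed.

Lemma GW_ig : ig (fun x => Gs e x * W a x).
Proof.
have := MM_ig a a0 e 0 e0; rewrite (_ : (fun x => _) = fun x => Gs e x * W a x)//.
by apply/funext => x; rewrite muln0 expr0 mul1r.
Qed.

Lemma jjG_ig x y : ig (fun l => (j_alpha a (x * l) * j_alpha a (y * l)) * (Gs e l * W a l)).
Proof.
apply: ig_dom GW_ig _.
  by apply: measurable_funM; [apply: measurable_funM; exact: jl_meas|exact: (ig_meas GW_ig)].
move=> l; rewrite normrM (ger0_norm (mulr_ge0 (Gs_ge0 e l) (W_ge0 a l))).
by rewrite ler_piMl ?mulr_ge0 ?Gs_ge0 ?W_ge0// normrM mulr_ile1// j_le1.
Qed.

(** Weber's second exponential integral: the product formula merges the two characters, [gauss_hat]
    integrates over [l] for each [s], and [exp_poisson] integrates the exponential of a multiple of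
    [s] that remains. *)
Lemma peE x y : it (fun l => (j_alpha a (x * l) * j_alpha a (y * l)) * (Gs e l * W a l)) = pe x y.
Proof.
have N0 := NN0_gt0 a a0.
pose f l s := Gs e l * W a l * (j_alpha a (dist_s x y s * l) * rho a s).
have mf : measurable_fun setT (fun z : R * R => f z.1 z.2).
  apply: measurable_funM; first exact: (measurableT_comp (ig_meas GW_ig) measurable_fst).
  apply: measurable_funM; last exact: (measurableT_comp (rho_meas a) measurable_snd).
  apply: (measurableT_comp (j_meas _ a0)); apply: measurable_funM; last exact: measurable_fst.
  exact: (measurableT_comp (dist_meas x y) measurable_snd).
have GW0 l : 0 <= Gs e l * W a l by rewrite mulr_ge0 ?Gs_ge0 ?W_ge0.
have bf l s : `|f l s| <= (Gs e l * W a l) * rho a s.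
  rewrite /f normrM (ger0_norm (GW0 l)) ler_wpM2l// normrM (ger0_norm (rho_ge0 a s)).
  by rewrite ler_piMl ?rho_ge0// j_le1.
have ji l : ig (fun s => j_alpha a (dist_s x y s * l) * rho a s).
  apply: (ig_rho _ a0 (fun s => j_alpha a (dist_s x y s * l)) 1); last by move=> s _; exact: j_le1.
  apply: (measurableT_comp (j_meas _ a0)); apply: measurable_funM; last exact: measurable_cst.
  exact: dist_meas.
have E l : it (f l) = NN a 0 * ((j_alpha a (x * l) * j_alpha a (y * l)) * (Gs e l * W a l)).
  by rewrite /f itZ// j_product//; ring.
apply: (mulfI (lt0r_neq0 N0)); rewrite -itZ; last exact: jjG_ig.
under eq_fun do rewrite -E.
rewrite (fubini_it f _ _ mf GW_ig (rho_ig a a0) bf).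
transitivity (it (fun s => (MM a e 0 * (Gs (4 * e)^-1 x * Gs (4 * e)^-1 y)) * (expR ((x * y / (2 * e)) * s) * rho a s))).
  apply: eq_it => s; have [s1|s1] := leP `|s| 1; last first.
    by rewrite rho_out// !mulr0 (_ : (fun _ => _) = fun=> 0) ?it0//; apply/funext => l; rewrite /f rho_out// !mulr0.
  transitivity (rho a s * it (fun l => j_alpha a (dist_s x y s * l) * (Gs e l * W a l))).
    rewrite -itZ; first by apply: eq_it => l; rewrite /f; ring.
    apply: ig_dom GW_ig _; first by apply: measurable_funM; [exact: jl_meas|exact: (ig_meas GW_ig)].
    by move=> l; rewrite normrM (ger0_norm (GW0 l)) ler_piMl// j_le1.
  rewrite gauss_hat// dist_sqr//.
  have -> : expR (- ((x ^+ 2 + y ^+ 2 - 2 * x * y * s) / (4 * e))) =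
     Gs (4 * e)^-1 x * Gs (4 * e)^-1 y * expR (x * y / (2 * e) * s).
    by rewrite /Gs -!expRD; congr expR; field; rewrite gt_eqF.
  by ring.
rewrite itZ ?exp_poisson//; first by rewrite /pe; ring.
apply: (ig_rho_cont a a0 (fun s => expR (x * y / (2 * e) * s))) => s.
apply: (@continuous_comp _ _ _ (fun s : R => x * y / (2 * e) * s) expR); last exact: continuous_expR.
by apply: cvgM; [exact: cvg_cst|exact: cvg_id].
Qed.

Lemma pe_meas : measurable_fun setT (fun z : R * R => pe z.1 z.2).
Proof.
apply: measurable_funM.
  apply: measurable_funM; first exact: measurable_cst.
  by apply: measurable_funM; apply: (measurableT_comp (Gs_meas _)); [exact: measurable_fst|exact: measurable_snd].
apply: (measurableT_comp (Phi_meas a a0)); apply: measurable_funX.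
apply: measurable_funM; last exact: measurable_cst.
by apply: measurable_funM; [exact: measurable_fst|exact: measurable_snd].
Qed.

Lemma pe_le x y : 0 <= x -> 0 <= y -> pe x y <= MM a e 0 * Gs (4 * e)^-1 (y - x).
Proof.
move=> x0 y0; rewrite /pe -mulrA ler_wpM2l ?(ltW (MM0_gt0 a a0 e e0))//.
have xy : 0 <= x * y / (2 * e) by rewrite divr_ge0 ?mulr_ge0// ltW// mulr_gt0.
have -> : Gs (4 * e)^-1 (y - x) = Gs (4 * e)^-1 x * Gs (4 * e)^-1 y * expR (x * y / (2 * e)).
  by rewrite /Gs -!expRD; congr expR; field; rewrite gt_eqF.
rewrite ler_wpM2l ?mulr_ge0 ?Gs_ge0//; apply: (le_trans (ler_norm _)).
by apply: (le_trans (Phi_bound a a0 _)); rewrite ler_expR ger0_norm ?sqr_ge0// sqrtr_sqr ger0_norm.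
Qed.

Lemma MM0E : MM a e 0 = it (fun x => Gs e x * W a x).
Proof. by apply: eq_it => x; rewrite muln0 expr0 mul1r. Qed.

Lemma pe_bnd x y : pe x y <= MM a e 0.
Proof.
rewrite -peE MM0E; apply: it_le; [exact: jjG_ig|exact: GW_ig|move=> l].
rewrite (le_trans (ler_norm _))// normrM (ger0_norm (mulr_ge0 (Gs_ge0 e l) (W_ge0 a l))).
by rewrite ler_piMl ?mulr_ge0 ?Gs_ge0 ?W_ge0// normrM mulr_ile1// j_le1.
Qed.

(** Integrating the series of [Phi] termwise, the Gaussian moments sum to [expR (q * x^2)], which
    cancels the prefactor [Gs q x]. *)
Lemma pe_massE x : ig (fun y => pe x y * W a y) /\ it (fun y => pe x y * W a y) = kpa.
Proof.
set q := (4 * e)^-1; have q0 : 0 < q by rewrite invr_gt0 mulr_gt0.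
pose C := MM a e 0 * Gs q x.
pose fn n y := C * (phis a n ((x * y / (2 * e)) ^+ 2) * (Gs q y * W a y)).
have C0 : 0 <= C by rewrite mulr_ge0 ?Gs_ge0// ltW// MM0_gt0.
have GW0 l : 0 <= Gs q l * W a l by rewrite mulr_ge0 ?Gs_ge0 ?W_ge0.
have mfn n : measurable_fun setT (fn n).
  apply: measurable_funM; first exact: measurable_cst.
  apply: measurable_funM; last by apply: measurable_funM; [exact: Gs_meas|exact: W_meas].
  apply: (measurableT_comp (phis_meas a n)); apply: measurable_funX.
  by apply: measurable_funM; [exact: mulrl_measurable|exact: measurable_cst].
have a1 := a_gt0.
have gi : ig (fun y => expR (`|x / (2 * e)| * y) * Gs q y * W a y) by apply: gauss_ig => //; lra.
have bd n y : `|fn n y| <= C * (expR (`|x / (2 * e)| * y) * Gs q y * W a y).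
  rewrite /fn normrM (ger0_norm C0) ler_wpM2l// normrM (ger0_norm (GW0 y)) -[leRHS]mulrA.
  have [y0|y0] := leP y 0; first by rewrite W_neg// !mulr0.
  rewrite ler_wpM2r// (le_trans (phis_bound _ a0 _ _))// ler_expR.
  rewrite ger0_norm ?sqr_ge0// sqrtr_sqr mulrAC normrM (gtr0_norm y0) //.
have cfn y : fn n y @[n --> \oo] --> pe x y * W a y.
  rewrite (_ : pe x y * W a y = C * (Phi a ((x * y / (2 * e)) ^+ 2) * (Gs q y * W a y))); last first.
    by rewrite /pe /C; ring.
  apply: cvgM; first exact: cvg_cst.
  by apply: cvgM; [exact: Phi_cvg|exact: cvg_cst].
have [pi H] := it_dct _ _ _ mfn (igZ _ _ gi) bd cfn; split=> //.
apply: cvg_uniqueN H _.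
have -> : kpa = MM a e 0 * Gs q x * (MM a q 0 * expR (q * x ^+ 2)).
  rewrite -(MM_kpa e e0) -/q /Gs.
  transitivity (MM a e 0 * MM a q 0 * (expR (- (q * x ^+ 2)) * expR (q * x ^+ 2))).
    by rewrite [expR (- _) * _]mulrC expRxMexpNx_1 mulr1.
  by ring.
rewrite (_ : (fun n => _) = fun n => MM a e 0 * Gs q x * (MM a q 0 * series (exp_coeff (q * x ^+ 2)) n)).
  apply: cvgM; first exact: cvg_cst.
  by apply: cvgM; [exact: cvg_cst|exact: is_cvg_series_exp_coeff].
have nn y k : ((x * y / (2 * e)) ^+ 2) ^+ k = (x / (2 * e)) ^+ (2 * k) * y ^+ (2 * k).
  by rewrite -exprM -exprMn; congr (_ ^+ _); ring.
have pi' n : ig (fun y => phis a n ((x * y / (2 * e)) ^+ 2) * (Gs q y * W a y)).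
  rewrite /phis; under eq_fun do rewrite mulr_suml.
  apply: ig_sum => k.
  rewrite (_ : (fun y => _) = fun y => (cc a k * (x / (2 * e)) ^+ (2 * k)) * (y ^+ (2 * k) * (Gs q y * W a y))).
    by apply: igZ; exact: MM_ig.
  by apply/funext => y; rewrite nn; ring.
apply/funext => n; rewrite /fn itZ//; congr (_ * _).
rewrite /phis; under eq_fun do rewrite mulr_suml.
have E k : (fun y => cc a k * ((x * y / (2 * e)) ^+ 2) ^+ k * (Gs q y * W a y)) =
    fun y => (cc a k * (x / (2 * e)) ^+ (2 * k)) * (y ^+ (2 * k) * (Gs q y * W a y)).
  by apply/funext => y; rewrite nn; ring.
rewrite it_sum; last by move=> k; rewrite E; apply: igZ; exact: MM_ig.
rewrite /series/= mulr_sumr; apply: eq_bigr => k _; rewrite E itZ; last exact: MM_ig.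
rewrite -/(MM a q k) MM_E// /exp_coeff/= /cc.
have -> : (q * x ^+ 2) ^+ k = (x / (2 * e)) ^+ (2 * k) / (4 ^+ k * q ^+ k).
  rewrite exprM -exprMn -exprVn -exprMn; congr (_ ^+ _); rewrite /q; field.
  by rewrite gt_eqF.
field.
by rewrite !expf_neq0 ?gt_eqF ?poch_gt0 ?ltr0n ?fact_gt0.
Qed.

End fixed_e.
End Heat.

(** * The Bessel transform and its inversion *)

Section Transform.
Context {R : realType}.
Local Notation mu := (@lebesgue_measure R).
Implicit Types (x y z s r t l m e q p : R) (n k : nat) (u v f h phi : R -> R).
Variable a : R.
Hypothesis a0 : 2^-1 <= a.

Let a_gt0 : 0 < a.
Proof. by apply: lt_le_trans a0; rewrite invr_gt0. Qed.

Definition L1 u : Prop := measurable_fun setT u /\ ig (fun x => u x * W a x).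

Definition hat u l : R := it (fun x => u x * (j_alpha a (l * x) * W a x)).

Lemma L1_abs u : L1 u -> ig (fun x => `|u x| * W a x).
Proof.
move=> [mu_ iu]; have := ig_abs _ iu; rewrite (_ : (fun x => _) = fun x => `|u x| * W a x)//.
by apply/funext => x; rewrite normrM (ger0_norm (W_ge0 a x)).
Qed.

Lemma L1_bnd u h (C : R) : L1 u -> measurable_fun setT h -> (forall x, `|h x| <= C) ->
  ig (fun x => u x * (h x * W a x)).
Proof.
move=> Lu mh hC; have [mu_ iu] := Lu.
apply: ig_dom (igZ _ C (L1_abs u Lu)) _.
  by apply: measurable_funM => //; apply: measurable_funM => //; exact: W_meas.
move=> x; rewrite !normrM (ger0_norm (W_ge0 a x)) mulrCA ler_wpM2r ?mulr_ge0 ?W_ge0//.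
Qed.

Lemma hat_ig u l : L1 u -> ig (fun x => u x * (j_alpha a (l * x) * W a x)).
Proof. by move=> Lu; apply: (L1_bnd _ _ 1 Lu); [exact: jl_meas|move=> x; exact: j_le1]. Qed.

Definition nrm u : R := it (fun x => `|u x| * W a x).

Lemma nrm_ge0 u : 0 <= nrm u.
Proof. by apply: it_ge0 => x; rewrite mulr_ge0 ?W_ge0. Qed.

Lemma hat_bnd u l : L1 u -> `|hat u l| <= nrm u.
Proof.
move=> Lu; rewrite (le_trans (it_norm _ (hat_ig _ _ Lu)))//.
apply: it_le; [exact: ig_abs (hat_ig _ _ Lu)|exact: L1_abs|move=> x].
rewrite !normrM (ger0_norm (W_ge0 a x)) ler_wpM2l//.
by rewrite ler_piMl ?W_ge0// j_le1.
Qed.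

Lemma hat_fub u v : L1 u -> L1 v ->
  let f l x := (v l * W a l) * (u x * (j_alpha a (l * x) * W a x)) in
  measurable_fun setT (fun z : R * R => f z.1 z.2) /\
  forall l x, `|f l x| <= (`|v l| * W a l) * (`|u x| * W a x).
Proof.
move=> [mu_ iu] [mv iv] f; split.
  apply: measurable_funM.
    by apply: measurable_funM; apply: measurableT_comp => //; exact: W_meas.
  apply: measurable_funM; first exact: (measurableT_comp mu_ measurable_snd).
  apply: measurable_funM; last exact: (measurableT_comp (W_meas a) measurable_snd).
  exact: j_meas2.
move=> l x; rewrite /f !normrM !(ger0_norm (W_ge0 a _)) ler_wpM2l ?mulr_ge0 ?W_ge0//.
by rewrite ler_wpM2l// ler_piMl ?W_ge0// j_le1.
Qed.

Lemma parseval u v : L1 u -> L1 v ->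
  it (fun l => hat u l * (v l * W a l)) = it (fun x => u x * (hat v x * W a x)).
Proof.
move=> Lu Lv; have [mf bf] := hat_fub u v Lu Lv.
have H := fubini_it _ _ _ mf (L1_abs v Lv) (L1_abs u Lu) bf.
transitivity (it (fun l => it (fun x => v l * W a l * (u x * (j_alpha a (l * x) * W a x))))).
  by apply: eq_it => l; rewrite (itZ _ _ (hat_ig u l Lu)) [LHS]mulrC.
rewrite H; apply: eq_it => x.
transitivity (it (fun l => u x * W a x * (v l * (j_alpha a (x * l) * W a l)))).
  by apply: eq_it => l; rewrite (mulrC x l); ring.
by rewrite (itZ _ _ (hat_ig v x Lv)) -/(hat v x); ring.
Qed.

(** Without decay in [l] there is no majorant of product form, so [l] is first confined to
    [[-n, n]]. *)
Lemma hat_meas u : L1 u -> measurable_fun setT (hat u).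
Proof.
move=> Lu; have [mu_ iu] := Lu.
have H n : measurable_fun setT (fun l => \1_`[- n%:R, n%:R] l * hat u l).
  have mi : measurable_fun setT (\1_`[- n%:R, n%:R] : R -> R) by exact: measurable_indic.
  pose f l x := \1_`[- n%:R, n%:R] l * (u x * (j_alpha a (l * x) * W a x)).
  have mf : measurable_fun setT (fun z : R * R => f z.1 z.2).
    apply: measurable_funM; first exact: (measurableT_comp mi measurable_fst).
    apply: measurable_funM; first exact: (measurableT_comp mu_ measurable_snd).
    apply: measurable_funM; last exact: (measurableT_comp (W_meas a) measurable_snd).
    exact: j_meas2.
  have bf l x : `|f l x| <= \1_`[- n%:R, n%:R] l * (`|u x| * W a x).
    rewrite normrM ger0_norm// ler_wpM2l// !normrM (ger0_norm (W_ge0 a x)).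
    by rewrite ler_wpM2l// ler_piMl ?W_ge0// j_le1.
  have := ig_meas (fubini_ig1 f _ _ mf (ig_indic_bnd _ _) (L1_abs u Lu) bf).
  rewrite (_ : (fun l => _) = fun l => \1_`[- n%:R, n%:R] l * hat u l)//.
  by apply/funext => l; rewrite /f (itZ _ _ (hat_ig u l Lu)).
apply: (measurable_fun_cvg H) => l _; apply: cvg_near_cst; near=> n.
rewrite indicE mem_set ?mul1r//= in_itv/= -ler_norml; near: n; exact: nbhs_infty_ger.
Unshelve. all: by end_near. Qed.

Lemma GL1 u e : L1 u -> 0 < e -> L1 (fun l => Gs e l * hat u l).
Proof.
move=> Lu e0; split; first by apply: measurable_funM; [exact: Gs_meas|exact: hat_meas].
apply: ig_dom (igZ _ (nrm u) (GW_ig a a0 e e0)) _.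
  apply: measurable_funM; last exact: W_meas.
  by apply: measurable_funM; [exact: Gs_meas|exact: hat_meas].
move=> l; rewrite mulrAC normrM (ger0_norm (mulr_ge0 (Gs_ge0 e l) (W_ge0 a l))) mulrC.
by rewrite ler_wpM2r ?mulr_ge0 ?Gs_ge0 ?W_ge0// hat_bnd.
Qed.

Lemma hat_heat u e x : L1 u -> 0 < e ->
  hat (fun l => Gs e l * hat u l) x = it (fun y => u y * (pe a e x y * W a y)).
Proof.
move=> Lu e0; have [mu_ iu] := Lu.
have GW0 l : 0 <= Gs e l * W a l by rewrite mulr_ge0 ?Gs_ge0 ?W_ge0.
pose f l y := j_alpha a (x * l) * (Gs e l * W a l) * (u y * (j_alpha a (l * y) * W a y)).
have mf : measurable_fun setT (fun z : R * R => f z.1 z.2).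
  apply: measurable_funM.
    apply: measurable_funM; first exact: (measurableT_comp (jl_meas a a0 x) measurable_fst).
    exact: (measurableT_comp (ig_meas (GW_ig a a0 e e0)) measurable_fst).
  apply: measurable_funM; first exact: (measurableT_comp mu_ measurable_snd).
  apply: measurable_funM; last exact: (measurableT_comp (W_meas a) measurable_snd).
  exact: j_meas2.
have bf l y : `|f l y| <= (Gs e l * W a l) * (`|u y| * W a y).
  rewrite /f normrM ler_pM//.
    by rewrite normrM (ger0_norm (GW0 l)) ler_piMl// j_le1.
  by rewrite !normrM (ger0_norm (W_ge0 a y)) ler_wpM2l// ler_piMl ?W_ge0// j_le1.
have H := fubini_it _ _ _ mf (GW_ig a a0 e e0) (L1_abs u Lu) bf.
transitivity (it (fun l => it (f l))).
  apply: eq_it => l; rewrite /f (itZ _ _ (hat_ig u l Lu)) -/(hat u l).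
  by ring.
rewrite H; apply: eq_it => y; rewrite /f -(peE a a0 e e0 x y).
transitivity (it (fun l => u y * W a y * (j_alpha a (x * l) * j_alpha a (y * l) * (Gs e l * W a l)))).
  by apply: eq_it => l; rewrite (mulrC l y); ring.
by rewrite (itZ _ _ (jjG_ig a a0 e e0 x y)); ring.
Qed.

Definition en n : R := (n.+1%:R)^-1.

Lemma en_gt0 n : 0 < en n. Proof. by rewrite invr_gt0. Qed.

Lemma MM_en n : MM a (en n) 0 = MM a 1 0 * pw (a + 1) n.+1%:R.
Proof.
rewrite (MM_scale a a0 (en n) (en_gt0 n)) mulrAC -pwM// ?(ltW (en_gt0 n))//.
by rewrite /en mulVf// pw_pos// powR1 mul1r.
Qed.

Lemma heat_cvg phi (B : R) x : L1 phi -> (forall y, `|phi y| <= B) -> 0 < x ->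
  phi y @[y --> x] --> phi x ->
  it (fun y => phi y * (pe a (en n) x y * W a y)) @[n --> \oo] --> kpa a * phi x.
Proof.
move=> Lphi phiB x0 cphi; have [mphi iphi] := Lphi.
have k0 := kpa_gt0 a a0; have M0 := MM0_gt0 a a0 1 ltr01.
have B0 : 0 <= B by apply: le_trans (phiB 0).
pose Ph n y := pe a (en n) x y * W a y.
have Ph0 n y : 0 <= Ph n y by rewrite mulr_ge0 ?W_ge0 ?pe_ge0// en_gt0.
have Phi_ig n : ig (Ph n) := (pe_massE a a0 _ (en_gt0 n) x).1.
have PhE n : it (Ph n) = kpa a := (pe_massE a a0 _ (en_gt0 n) x).2.
have Phm n : measurable_fun setT (Ph n) := ig_meas (Phi_ig n).
have phPh n : ig (fun y => phi y * Ph n y).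
  apply: ig_dom (igZ _ B (Phi_ig n)) _; first exact: measurable_funM.
  by move=> y; rewrite normrM (ger0_norm (Ph0 n y)) ler_wpM2r.
(* The Gaussian exponent [(n+1)(y-x)^2/4] is halved: one half bounds the integrand by the fixed
   integrable [T], the other gives [expR (- d^2 (n+1)/8)] once [|x - y| >= d], which beats the
   polynomial growth of [MM a (en n) 0]. *)
pose T y := Gs 8^-1 (y - x) * W a y.
have Ti : ig T.
  have a1 := a_gt0.
  have := igZ _ (Gs 8^-1 x) (gauss_ig 8^-1 (2 * a + 1) (x / 4) ltac:(lra) ltac:(lra)).
  rewrite (_ : (fun y => _) = T)//; apply/funext => y; rewrite /T /W /Gs mulrA mulrA -!expRD.
  by congr (expR _ * _); field.
have T0 : 0 <= it T by apply: it_ge0 => y; rewrite mulr_ge0 ?Gs_ge0 ?W_ge0.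
apply/cvgrPdist_le => eps eps0.
pose eta := eps / 2 / kpa a.
have eta0 : 0 < eta by rewrite !divr_gt0.
have /cvgrPdist_le/(_ _ eta0) := cphi.
move=> [d /= d0 Hd].
have tail : (2 * B * it T * MM a 1 0) * (pw (a + 1) n.+1%:R * expR (- (d ^+ 2 / 8 * n.+1%:R))) @[n --> \oo] --> (0 : R).
  rewrite -[X in _ --> X](mulr0 (2 * B * it T * MM a 1 0)); apply: cvgM; first exact: cvg_cst.
  have a1 := a_gt0.
  by apply: pw_exp_cvg0; [lra|rewrite divr_gt0// exprn_gt0].
have /cvgr0_norm_le/(_ (eps / 2) ltac:(by rewrite divr_gt0)) := tail.
apply: filterS => n tn.
have -> : kpa a * phi x - it (fun y => phi y * Ph n y) = it (fun y => (phi x - phi y) * Ph n y).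
  rewrite -(PhE n) mulrC -itZ// -itB//; last exact: igZ.
  by apply: eq_it => y; rewrite mulrBl.
have ei : ig (fun y => (phi x - phi y) * Ph n y).
  rewrite (_ : (fun y => _) = fun y => phi x * Ph n y - phi y * Ph n y); last by apply/funext => y; rewrite mulrBl.
  by apply: igB => //; exact: igZ.
apply: (le_trans (it_norm _ ei)).
pose D := 2 * B * (MM a (en n) 0 * expR (- (d ^+ 2 / 8 * n.+1%:R))).
apply: (@le_trans _ _ (it (fun y => eta * Ph n y + D * T y))); last first.
  rewrite itD ?itZ//; try exact: igZ.
  rewrite PhE divfK ?gt_eqF// [leRHS](splitr eps) lerD2l (le_trans _ tn)// (le_trans _ (ler_norm _))//.
  by rewrite /D MM_en le_eqVlt; apply/orP; left; apply/eqP; ring.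
apply: it_le; [exact: ig_abs|by apply: igD; exact: igZ|move=> y].
have M1 := MM0_gt0 a a0 _ (en_gt0 n).
have D0 : 0 <= D by rewrite !mulr_ge0 ?expR_ge0 ?(ltW M1).
have T1 : 0 <= T y by rewrite mulr_ge0 ?Gs_ge0 ?W_ge0.
rewrite normrM (ger0_norm (Ph0 n y)).
have [y0|y0] := leP y 0; first by rewrite /Ph /T W_neg// !mulr0 addr0.
have [xy|xy] := ltP `|x - y| d.
  rewrite -[leLHS]addr0; apply: lerD; last exact: mulr_ge0.
  by apply: ler_wpM2r => //; apply: Hd.
rewrite -[leLHS]add0r; apply: lerD; first exact: mulr_ge0 (ltW eta0) (Ph0 n y).
apply: (@le_trans _ _ ((2 * B) * Ph n y)).
  rewrite ler_wpM2r// (le_trans (ler_normB _ _))//.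
  by have := phiB x; have := phiB y; lra.
rewrite /D -[leRHS]mulrA ler_wpM2l ?mulr_ge0// /Ph /T mulrA ler_wpM2r ?W_ge0//.
apply: (le_trans (pe_le a a0 _ (en_gt0 n) _ _ (ltW x0) (ltW y0))).
rewrite -mulrA ler_wpM2l ?(ltW M1)// /Gs -expRD ler_expR.
have -> : (4 * en n)^-1 = n.+1%:R / 4 :> R by rewrite /en invfM invrK mulrC.
have n1 : 1 <= n.+1%:R :> R by rewrite ler1n.
have : d ^+ 2 <= (y - x) ^+ 2.
  by rewrite -[(y - x) ^+ 2]real_normK ?num_real// distrC lerXn2r ?nnegrE ?(ltW d0).
move: ((y - x) ^+ 2) (sqr_ge0 (y - x)) (d ^+ 2) => z z0 w wz.
by nra.
Qed.

Lemma heat_bnd phi (B : R) x n : L1 phi -> (forall y, `|phi y| <= B) ->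
  `|it (fun y => phi y * (pe a (en n) x y * W a y))| <= B * kpa a.
Proof.
move=> [mphi iphi] phiB.
have [Phi_ig PhE] := pe_massE a a0 _ (en_gt0 n) x.
have Ph0 y : 0 <= pe a (en n) x y * W a y by rewrite mulr_ge0 ?W_ge0 ?pe_ge0// en_gt0.
have phPh : ig (fun y => phi y * (pe a (en n) x y * W a y)).
  apply: ig_dom (igZ _ B (Phi_ig)) _; first by apply: measurable_funM => //; exact: (ig_meas Phi_ig).
  by move=> y; rewrite normrM (ger0_norm (Ph0 y)) ler_wpM2r.
rewrite (le_trans (it_norm _ phPh))// -PhE -itZ//.
apply: it_le; [exact: ig_abs|exact: igZ|move=> y].
by rewrite normrM (ger0_norm (Ph0 y)) ler_wpM2r.
Qed.

(** Stated as a limit of Gaussian means, because [hat f * hat phi] need not be integrable. By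
    [parseval] and [hat_heat] such a mean pairs [f] with the heat regularisation of [phi]; only
    almost everywhere continuity of [phi] is asked, so that jumps are allowed. *)
Lemma inversion f phi (B : R) : L1 f -> L1 phi -> (forall y, `|phi y| <= B) ->
  {ae mu, forall x, 0 < x -> phi y @[y --> x] --> phi x} ->
  it (fun l => hat f l * (Gs (en n) l * hat phi l * W a l)) @[n --> \oo] -->
  kpa a * it (fun x => f x * (phi x * W a x)).
Proof.
move=> Lf Lphi phiB cphi; have [mf if_] := Lf; have [mphi iphi] := Lphi.
pose Ps n x := hat (fun l => Gs (en n) l * hat phi l) x.
have PsE n x : Ps n x = it (fun y => phi y * (pe a (en n) x y * W a y)).
  by apply: hat_heat => //; exact: en_gt0.
have Psm n : measurable_fun setT (Ps n).
  by apply: hat_meas; apply: GL1 => //; exact: en_gt0.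
have Psb n x : `|Ps n x| <= B * kpa a by rewrite PsE; exact: heat_bnd.
rewrite (_ : (fun n => _) = fun n => it (fun x => f x * (Ps n x * W a x))); last first.
  by apply/funext => n; apply: parseval => //; apply: GL1 => //; exact: en_gt0.
rewrite -itZ; last exact: (L1_bnd _ _ B).
have B0 : 0 <= B by apply: le_trans (phiB 0).
apply: (it_dct_ae (fun n x => f x * (Ps n x * W a x)) _ (fun x => (B * kpa a) * (`|f x| * W a x)) _ _ _ _ _).2.
- move=> n; apply: measurable_funM => //; apply: measurable_funM => //; exact: W_meas.
- apply: measurable_funM; first exact: measurable_cst.
  by apply: measurable_funM => //; apply: measurable_funM => //; exact: W_meas.
- by apply: igZ; exact: L1_abs.
- move=> n x; rewrite !normrM (ger0_norm (W_ge0 a x)) mulrCA.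
  by rewrite ler_wpM2r ?mulr_ge0 ?W_ge0.
- apply: negligibleS cphi => x /= Hx Hc; apply: Hx.
  have [x0|x0] := leP x 0.
    by apply: cvg_near_cst; apply: nearW => n; rewrite W_neg// !mulr0.
  have -> : kpa a * (f x * (phi x * W a x)) = f x * (kpa a * phi x * W a x) by ring.
  apply: cvgM; first exact: cvg_cst.
  apply: cvgM; last exact: cvg_cst.
  under eq_fun do rewrite PsE.
  by apply: (heat_cvg _ B) => //; exact: Hc.
Qed.

End Transform.

(* Keeps [done] and unification from unfolding integrals. *)
Opaque ig it pe Phi MM j_alpha Gs W rho gb KK.

(** * Plancherel inequality *)

Section Plancherel.
Context {R : realType}.
Local Notation mu := (@lebesgue_measure R).
Implicit Types (x y z s r t l m e q p : R) (n k : nat) (u v f h phi : R -> R).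
Variable a : R.
Hypothesis a0 : 2^-1 <= a.

Let a_gt0 : 0 < a.
Proof. by apply: lt_le_trans a0; rewrite invr_gt0. Qed.

Lemma Gs_en_cvg l : Gs (en n) l @[n --> \oo] --> (1 : R).
Proof.
rewrite -[X in _ --> X](_ : expR (- (0 * l ^+ 2)) = 1); last by rewrite mul0r oppr0 expR0.
apply: continuous_cvg; first exact: continuous_expR.
apply: cvgN; apply: cvgM; last exact: cvg_cst.
exact: cvg_harmonic.
Qed.

Lemma half_half : 2^-1 + 2^-1 = 1 :> R. Proof. lra. Qed.

Lemma mul_le1 (k w p : R) : k <= 1 -> 0 <= w -> 0 <= p -> k * w * p <= p * w.
Proof.
move=> k1 w0 p0; rewrite -subr_ge0 (_ : _ - _ = w * p * (1 - k)); last by ring.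
by rewrite !mulr_ge0// subr_ge0.
Qed.

(** [k1] and [k2] stand for the values of the indicator of the support at the two points. *)
Lemma amgm01 (X Y k1 k2 : R) : (k1 = 0 \/ k1 = 1) -> (k2 = 0 \/ k2 = 1) ->
  0 <= X ^+ 2 * k2 + Y ^+ 2 * k1 - 2 * X * k1 * Y * k2.
Proof.
have h1 := sqr_ge0 (X - Y); have h2 := sqr_ge0 X; have h3 := sqr_ge0 Y.
by case=> ->; case=> ->; nra.
Qed.

Section plancherel_ineq.
Variables (phi : R -> R) (B D : R).
Hypotheses (mphi : measurable_fun setT phi) (phiB : forall x, `|phi x| <= B).
Hypothesis phiD : forall x, ~~ (0 <= x <= D) -> phi x = 0.

Let K : R -> R := \1_`[0, D].

Let phiK x : phi x = phi x * K x.
Proof.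
rewrite /K indicE mem_setE in_itv/=; case: (boolP (0 <= x <= D)) => h; first by rewrite mulr1.
by rewrite phiD// mul0r.
Qed.

Let Kle1 x : K x <= 1.
Proof. by rewrite /K indicE; case: (_ \in _). Qed.

Let B0 : 0 <= B. Proof. exact: le_trans (phiB 0). Qed.

Lemma supp_L1 : L1 a phi.
Proof.
split=> //; apply: ig_dom (igZ _ B (W_ig_bnd a a0 0 D)) _.
  by apply: measurable_funM => //; exact: W_meas.
move=> x; rewrite {1}phiK -mulrA normrM ler_pM//.
by rewrite ger0_norm// mulr_ge0 ?W_ge0// /K indicE.
Qed.

Lemma supp_sqr : ig (fun x => phi x ^+ 2 * W a x).
Proof.
have := L1_bnd a phi phi B supp_L1 mphi phiB.
by rewrite (_ : (fun x => _) = fun x => phi x ^+ 2 * W a x)//; apply/funext => x; ring.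
Qed.

Let KW : ig (fun x => K x * W a x). Proof. exact: W_ig_bnd. Qed.

(** Schur's test: AM-GM on [phi x * phi y] for the symmetric kernel [pe], whose rows have mass
    [kpa a]. The indicator [K] of the support is kept on the variable that loses its factor [phi],
    to preserve a majorant of product form. *)
Let step1 n : it (fun l => hat a phi l * (Gs (en n) l * hat a phi l * W a l)) <=
  kpa a * it (fun x => phi x ^+ 2 * W a x).
Proof.
have e0 := @en_gt0 R n.
have L := supp_L1.
rewrite (parseval a a0 _ _ L (GL1 a a0 _ _ L e0)).
pose pp x y := pe a (en n) x y.
have ppm : measurable_fun setT (fun z : R * R => pp z.1 z.2) by exact: pe_meas.
have pp0 x y : 0 <= pp x y by exact: pe_ge0.
have M1 := MM0_gt0 a a0 _ e0; set C := MM a (en n) 0 in M1 *.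
have ppC x y : pp x y <= C by exact: pe_bnd.
pose f x y := phi x ^+ 2 * W a x * (K y * W a y * pp x y).
pose g x y := phi x * W a x * (phi y * W a y * pp x y).
have m1 h : measurable_fun setT h -> measurable_fun setT (fun z : R * R => h z.1).
  by move=> mh; exact: (measurableT_comp mh measurable_fst).
have m2 h : measurable_fun setT h -> measurable_fun setT (fun z : R * R => h z.2).
  by move=> mh; exact: (measurableT_comp mh measurable_snd).
have mf : measurable_fun setT (fun z : R * R => f z.1 z.2).
  apply: measurable_funM; first by apply: (m1 (fun x => phi x ^+ 2 * W a x)); exact: (ig_meas supp_sqr).
  by apply: measurable_funM => //; apply: (m2 (fun x => K x * W a x)); exact: (ig_meas KW).
have mg : measurable_fun setT (fun z : R * R => g z.1 z.2).
  apply: measurable_funM; first by apply: (m1 (fun x => phi x * W a x)); exact: (ig_meas L.2).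
  by apply: measurable_funM => //; apply: (m2 (fun x => phi x * W a x)); exact: (ig_meas L.2).
have s0 x : 0 <= phi x ^+ 2 * W a x by rewrite mulr_ge0 ?sqr_ge0 ?W_ge0.
have K0 x : 0 <= K x by rewrite /K indicE.
have K1 x : 0 <= K x * W a x by rewrite mulr_ge0 ?W_ge0.
have b3 (X Y p : R) : 0 <= X -> 0 <= Y -> p <= C -> X * (Y * p) <= C * X * Y.
  move=> X0 Y0 pC; rewrite -subr_ge0 (_ : _ - _ = X * Y * (C - p)); last by ring.
  by rewrite !mulr_ge0// subr_ge0.
have bf x y : `|f x y| <= (C * (phi x ^+ 2 * W a x)) * (K y * W a y).
  rewrite ger0_norm; first exact: b3.
  by apply: mulr_ge0 => //; exact: mulr_ge0.
have bg x y : `|g x y| <= (C * (`|phi x| * W a x)) * (`|phi y| * W a y).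
  rewrite /g 4!normrM (ger0_norm (pp0 x y)) !(ger0_norm (W_ge0 a _)).
  by apply: b3 => //; rewrite mulr_ge0 ?W_ge0.
have Li := L1_abs a phi L.
have ig2 : ig (fun x => C * (phi x ^+ 2 * W a x)) by apply: igZ; exact: supp_sqr.
have igC : ig (fun x => C * (`|phi x| * W a x)) by apply: igZ.
have fi1 := fubini_ig1 f _ _ mf ig2 KW bf.
have fi2 := fubini_ig2 f _ _ mf ig2 KW bf.
have FE := fubini_it f _ _ mf ig2 KW bf.
have fs1 := slice1_ig f _ _ mf KW bf.
have fs2 := slice2_ig f _ _ mf ig2 bf.
have gi1 := fubini_ig1 g _ _ mg igC Li bg.
have gs1 := slice1_ig g _ _ mg Li bg.
have LHSE : it (fun x => phi x * (hat a (fun l => Gs (en n) l * hat a phi l) x * W a x)) = it (fun x => it (g x)).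
  apply: eq_it => x; rewrite (hat_heat a a0 _ _ _ L e0).
  rewrite /g; transitivity (phi x * W a x * it (fun y => phi y * (pp x y * W a y))); first by ring.
  rewrite -itZ; last first.
    apply: (L1_bnd a phi (pp x) C L (meas_slice1 pp x ppm)) => y.
    by rewrite (ger0_norm (pp0 x y)).
  by apply: eq_it => y; ring.
rewrite LHSE.
apply: (@le_trans _ _ (it (fun x => it (fun y => 2^-1 * f x y + 2^-1 * f y x)))).
  apply: it_le; first exact: gi1.
    have := igD _ _ (igZ _ 2^-1 fi1) (igZ _ 2^-1 fi2).
    apply: eq_ig => x.
    by rewrite (itD _ _ (igZ _ _ (fs1 x)) (igZ _ _ (fs2 x))) (itZ _ _ (fs1 x)) (itZ _ _ (fs2 x)).
  move=> x; apply: it_le; [exact: gs1|by apply: igD; apply: igZ|move=> y].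
  have -> : f y x = phi y ^+ 2 * W a y * (K x * W a x * pp x y) by rewrite /f /pp pe_sym.
  have -> : g x y = phi x * K x * W a x * (phi y * K y * W a y * pp x y) by rewrite -!phiK.
  rewrite /f.
  have [k1 k2] : (K x = 0 \/ K x = 1) /\ (K y = 0 \/ K y = 1).
    by rewrite /K !indicE; split; case: (_ \in _); [right|left|right|left].
  have wx := W_ge0 a x; have wy := W_ge0 a y; have p0 := pp0 x y.
  rewrite -subr_ge0.
  have -> : 2^-1 * (phi x ^+ 2 * W a x * (K y * W a y * pp x y)) +
      2^-1 * (phi y ^+ 2 * W a y * (K x * W a x * pp x y)) -
      phi x * K x * W a x * (phi y * K y * W a y * pp x y) =
      2^-1 * (W a x * W a y * pp x y) * (phi x ^+ 2 * K y + phi y ^+ 2 * K x - 2 * phi x * K x * phi y * K y).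
    by field.
  apply: mulr_ge0.
    by apply: mulr_ge0; [rewrite invr_ge0|exact: mulr_ge0 (mulr_ge0 wx wy) p0].
  exact: amgm01.
have -> : it (fun x => it (fun y => 2^-1 * f x y + 2^-1 * f y x)) = it (fun x => it (f x)).
  transitivity (it (fun x => 2^-1 * it (f x) + 2^-1 * it (fun y => f y x))).
    apply: eq_it => x.
    by rewrite (itD _ _ (igZ _ _ (fs1 x)) (igZ _ _ (fs2 x))) (itZ _ _ (fs1 x)) (itZ _ _ (fs2 x)).
  rewrite (itD _ _ (igZ _ _ fi1) (igZ _ _ fi2)) (itZ _ _ fi1) (itZ _ _ fi2) -FE -mulrDl half_half mul1r.
  reflexivity.
rewrite -itZ; last exact: supp_sqr.
apply: it_le; [exact: fi1|by apply: igZ; exact: supp_sqr|].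
move=> x; have [pi1 pi2] := pe_massE a a0 _ e0 x.
have pk : ig (fun y => K y * W a y * pp x y).
  apply: ig_dom pi1 _.
    by apply: measurable_funM; [exact: (ig_meas KW)|exact: (meas_slice1 pp x ppm)].
  move=> y; rewrite (ger0_norm (mulr_ge0 (K1 y) (pp0 x y))).
  exact: mul_le1 (Kle1 y) (W_ge0 a y) (pp0 x y).
rewrite /f (itZ _ _ pk) mulrC; apply: ler_wpM2r; first exact: s0.
rewrite -pi2; apply: it_le; [exact: pk|exact: pi1|move=> y].
exact: mul_le1 (Kle1 y) (W_ge0 a y) (pp0 x y).
Qed.

(** The cut at [M] makes the removal of the Gaussian a dominated convergence, with a bound that does
    not depend on [M]. Only this inequality is needed later, not the equality. *)
Lemma plancherel_ineq (M : R) :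
  ig (fun l => \1_`[0, M] l * (hat a phi l ^+ 2 * W a l)) /\
  it (fun l => \1_`[0, M] l * (hat a phi l ^+ 2 * W a l)) <= kpa a * it (fun x => phi x ^+ 2 * W a x).
Proof.
have L := supp_L1.
have mh := hat_meas a a0 phi L.
have m0 : measurable_fun setT (\1_`[0, M] : R -> R) by exact: measurable_indic.
pose fn n l := \1_`[0, M] l * (hat a phi l * (Gs (en n) l * hat a phi l * W a l)).
have mfn n : measurable_fun setT (fn n).
  apply: measurable_funM => //; apply: measurable_funM => //.
  by apply: measurable_funM; [apply: measurable_funM => //; exact: Gs_meas|exact: W_meas].
have g1 n l : Gs (en n) l <= 1 by apply: Gs_le1; rewrite ltW// en_gt0.
have nn n l : 0 <= hat a phi l * (Gs (en n) l * hat a phi l * W a l).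
  rewrite (_ : _ * _ = Gs (en n) l * hat a phi l ^+ 2 * W a l); last by ring.
  exact: mulr_ge0 (mulr_ge0 (Gs_ge0 _ _) (sqr_ge0 _)) (W_ge0 _ _).
have hb l : hat a phi l ^+ 2 <= nrm a phi ^+ 2.
  by rewrite -real_normK ?num_real// lerXn2r ?nnegrE ?nrm_ge0// hat_bnd.
have bd n l : `|fn n l| <= nrm a phi ^+ 2 * (\1_`[0, M] l * W a l).
  have i0 : 0 <= \1_`[0, M] l :> R by rewrite indicE.
  rewrite (ger0_norm (mulr_ge0 i0 (nn n l))) -/(fn n l).
  rewrite (_ : fn n l = (Gs (en n) l * hat a phi l ^+ 2) * (\1_`[0, M] l * W a l)); last by rewrite /fn; ring.
  apply: ler_wpM2r; first exact: mulr_ge0 i0 (W_ge0 a l).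
  by apply: le_trans (hb l); rewrite ler_piMl// ?sqr_ge0.
have cfn l : fn n l @[n --> \oo] --> \1_`[0, M] l * (hat a phi l ^+ 2 * W a l).
  have -> : hat a phi l ^+ 2 * W a l = hat a phi l * (1 * hat a phi l * W a l) by ring.
  apply: cvgM; first exact: cvg_cst.
  apply: cvgM; first exact: cvg_cst.
  apply: cvgM; last exact: cvg_cst.
  apply: cvgM; last exact: cvg_cst.
  exact: Gs_en_cvg.
have [fi H] := it_dct _ _ _ mfn (igZ _ _ (W_ig_bnd a a0 0 M)) bd cfn; split=> //.
apply: cvg_le_cst H _ => n; apply: le_trans (step1 n).
have gl := GL1 a a0 _ _ L (@en_gt0 R n).
have ii : ig (fun l => hat a phi l * (Gs (en n) l * hat a phi l * W a l)).
  have := L1_bnd a _ (hat a phi) (nrm a phi) gl mh (fun x => hat_bnd a a0 phi x L).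
  by apply: eq_ig => l; ring.
apply: it_le; [|exact: ii|].
  by apply: ig_dom (igZ _ _ (W_ig_bnd a a0 0 M)) (bd n).
by move=> l; rewrite /fn ler_piMl// indicE; case: (_ \in _).
Qed.

End plancherel_ineq.
End Plancherel.

(** * Smoothness of the transform *)

Section Difference.
Context {R : realType}.
Local Notation mu := (@lebesgue_measure R).
Implicit Types (x y z s r t l m e q p : R) (n k : nat) (u v f h phi : R -> R).
Variable a : R.
Hypothesis a0 : 2^-1 <= a.

Let a_gt0 : 0 < a.
Proof. by apply: lt_le_trans a0; rewrite invr_gt0. Qed.

Let a1 : 2^-1 <= a + 1.
Proof. by have := a_gt0; lra. Qed.

Lemma cc_add1 k : cc a k.+1 * (4 * k.+1%:R * (a + 1)) = cc (a + 1) k.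
Proof.
have ag := a_gt0; have a10 : 0 < a + 1 by lra.
elim: k => [|k IH].
  by rewrite ccS// !cc0//; field; rewrite gt_eqF.
have k0 : 0 <= k%:R :> R by [].
rewrite ccS// (ccS (a + 1))// -IH -(natr1 k.+1) -(natr1 k).
have q1 : 0 < k%:R + 1 :> R by lra. have q2 : 0 < k%:R + 1 + 1 :> R by lra.
have q3 : 0 < a + (k%:R + 1 + 1) by lra. have q4 : 0 < a + 1 + (k%:R + 1) by lra.
by field; rewrite !gt_eqF.
Qed.

Lemma phis_derive x n t :
  is_derive t 1 (fun t => phis a n.+1 (- (t * x) ^+ 2))
    (- (t * x ^+ 2) / (2 * (a + 1)) * phis (a + 1) n (- (t * x) ^+ 2)).
Proof.
have ag := a_gt0; have a10 : a + 1 != 0 by rewrite gt_eqF//; lra.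
elim: n => [|n IH].
  rewrite (_ : (fun t => _) = cst 1).
    by apply: is_derive_eq; rewrite /phis big_geq// mulr0.
  by apply/funext => s; rewrite /phis big_nat1 expr0 mulr1 cc0.
rewrite (_ : (fun t => _) = fun t => phis a n.+1 (- (t * x) ^+ 2) + cc a n.+1 * (- (t * x) ^+ 2) ^+ n.+1); last first.
  by apply/funext => s; rewrite {1}/phis big_nat_recr.
have d1 : is_derive t 1 (fun t : R => - (t * x) ^+ 2) (- (2 * t * x ^+ 2)).
  by apply: is_derive_eq; rewrite /GRing.scale/=; ring.
have d2 : is_derive (- (t * x) ^+ 2) 1 (fun s : R => s ^+ n.+1) (n.+1%:R * (- (t * x) ^+ 2) ^+ n).
  apply: DeriveDef; first exact: exprn_derivable.
  by rewrite exp_derive /GRing.scale/= mulr1.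
have d3 := @is_derive1_comp _ (fun s : R => s ^+ n.+1) (fun t : R => - (t * x) ^+ 2) t _ _ d2 d1.
have d4 := @is_deriveD _ _ _ _ _ _ _ _ _ IH (@is_deriveZ _ _ _ _ (cc a n.+1) _ _ _ d3).
apply: (@is_derive_eq _ _ _ (fun t => phis a n.+1 (- (t * x) ^+ 2) + cc a n.+1 * (- (t * x) ^+ 2) ^+ n.+1) t 1 _ _ d4).
rewrite [in RHS]/phis big_nat_recr//= -/(phis (a + 1) n _) -(cc_add1 n) /GRing.scale/=.
move: (phis (a + 1) n _) ((- (t * x) ^+ 2) ^+ n) => P Q.
by field.
Qed.

Lemma phis_cont b n x : continuous (fun t => phis b n (- (t * x) ^+ 2)).
Proof.
elim: n => [|n IH] t.
  rewrite (_ : (fun t => _) = fun=> 0); first exact: cvg_cst.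
  by apply/funext => s; rewrite /phis big_geq.
rewrite (_ : (fun t => _) = fun t => phis b n (- (t * x) ^+ 2) + cc b n * (- (t * x) ^+ 2) ^+ n); last first.
  by apply/funext => s; rewrite {1}/phis big_nat_recr.
apply: cvgD; first exact: IH.
apply: cvgM; first exact: cvg_cst.
apply: (@continuous_comp _ _ _ (fun t : R => - (t * x) ^+ 2) (fun s : R => s ^+ n)); last exact: exprn_continuous.
apply: cvgN; apply: (@continuous_comp _ _ _ (fun t : R => t * x) (fun s : R => s ^+ 2)); last exact: exprn_continuous.
by apply: cvgM; [exact: cvg_id|exact: cvg_cst].
Qed.

(** The formula for the derivative of [j_alpha], in integrated form: it is proved for the partial
    sums and passes to the limit under the integral, so that no series is differentiated. *)
Lemma j_diff x t1 t2 : 0 <= t1 -> t1 < t2 ->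
  ig (fun t => \1_`[t1, t2] t * (t * x ^+ 2 * j_alpha (a + 1) (t * x))) /\
  j_alpha a (t2 * x) - j_alpha a (t1 * x) =
  - (2 * (a + 1))^-1 * it (fun t => \1_`[t1, t2] t * (t * x ^+ 2 * j_alpha (a + 1) (t * x))).
Proof.
move=> t10 t12; have ag := a_gt0.
pose fn n t := \1_`[t1, t2] t * (t * x ^+ 2 * phis (a + 1) n (- (t * x) ^+ 2)).
have cfn n : continuous (fun t => t * x ^+ 2 * phis (a + 1) n (- (t * x) ^+ 2)).
  move=> t; apply: cvgM; last exact: phis_cont.
  by apply: cvgM; [exact: cvg_id|exact: cvg_cst].
have fni n : ig (fn n) by apply: ig_cont; exact: cont_within.
have E n : it (fn n) = - (2 * (a + 1)) * (phis a n.+1 (- (t2 * x) ^+ 2) - phis a n.+1 (- (t1 * x) ^+ 2)).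
  have := @it_FTC R (fun t => phis a n.+1 (- (t * x) ^+ 2))
    (fun t => - (t * x ^+ 2) / (2 * (a + 1)) * phis (a + 1) n (- (t * x) ^+ 2)) t1 t2 t12.
  have c1 : continuous (fun t => - (t * x ^+ 2) / (2 * (a + 1)) * phis (a + 1) n (- (t * x) ^+ 2)).
    move=> t; apply: cvgM; last exact: phis_cont.
    apply: cvgM; last exact: cvg_cst.
    by apply: cvgN; apply: cvgM; [exact: cvg_id|exact: cvg_cst].
  move=> /(_ (cont_within _ _ c1) (cont_within _ _ (phis_cont _ _ _)) (fun t _ => phis_derive x n t)) <-.
  rewrite -itZ; last by apply: ig_cont; exact: cont_within.
  by apply: eq_it => t; rewrite /fn; field; rewrite gt_eqF//; lra.
pose C : R := t2 * x ^+ 2 * expR (t2 * `|x|).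
have bd n t : `|fn n t| <= C * \1_`[t1, t2] t.
  rewrite /fn indicE mem_setE in_itv/=; case: (boolP (t1 <= t <= t2)) => [/andP[h1 h2]|_]; last first.
    by rewrite mul0r normr0 mulr0.
  have t0 : 0 <= t by exact: le_trans h1.
  rewrite mul1r mulr1 2!normrM (ger0_norm t0) (ger0_norm (sqr_ge0 x)).
  apply: ler_pM => //; first by rewrite mulr_ge0 ?sqr_ge0.
    by rewrite ler_wpM2r ?sqr_ge0.
  apply: (le_trans (phis_bound _ a1 _ _)); rewrite ler_expR normrN.
  rewrite (ger0_norm (sqr_ge0 _)) sqrtr_sqr normrM (ger0_norm t0).
  by rewrite ler_wpM2r.
have cvfn t : fn n t @[n --> \oo] --> \1_`[t1, t2] t * (t * x ^+ 2 * j_alpha (a + 1) (t * x)).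
  apply: cvgM; first exact: cvg_cst.
  by apply: cvgM; [exact: cvg_cst|rewrite j_alphaE; exact: Phi_cvg].
have [Hi H] := it_dct _ _ _ (fun n => ig_meas (fni n)) (igZ _ C (ig_indic_bnd t1 t2)) bd cvfn.
split; first exact: Hi.
have S t : phis a n.+1 (- (t * x) ^+ 2) @[n --> \oo] --> j_alpha a (t * x).
  by rewrite (cvg_shiftS (fun n => phis a n (- (t * x) ^+ 2))) j_alphaE; exact: Phi_cvg.
have -> : it (fun t => \1_`[t1, t2] t * (t * x ^+ 2 * j_alpha (a + 1) (t * x))) =
    - (2 * (a + 1)) * (j_alpha a (t2 * x) - j_alpha a (t1 * x)).
  apply: cvg_uniqueN H _; under eq_fun do rewrite E.
  by apply: cvgM; [exact: cvg_cst|apply: cvgB; exact: S].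
by field; rewrite gt_eqF//; lra.
Qed.

Lemma W_add1 x : W (a + 1) x = x ^+ 2 * W a x.
Proof.
rewrite !W_pw (_ : 2 * (a + 1) + 1 = 2 * a + 1 + 2%:R); last by ring.
by rewrite pwXn mulrC.
Qed.

Section hatdiff.
Variable phi : R -> R.
Hypotheses (L : L1 a phi) (L' : L1 (a + 1) phi).

(** [j_diff] integrated against [phi]: by [W_add1], the factor [x ^+ 2] turns the weight of
    parameter [a] into that of [a + 1]. *)
Lemma hat_diff t1 t2 : 0 <= t1 -> t1 < t2 ->
  ig (fun t => \1_`[t1, t2] t * (t * hat (a + 1) phi t)) /\
  hat a phi t2 - hat a phi t1 =
  - (2 * (a + 1))^-1 * it (fun t => \1_`[t1, t2] t * (t * hat (a + 1) phi t)).
Proof.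
move=> t10 t12; have [mphi iphi] := L.
pose f x t := phi x * (j_alpha (a + 1) (t * x) * W (a + 1) x) * (\1_`[t1, t2] t * t).
have mi : measurable_fun setT (\1_`[t1, t2] : R -> R) by exact: measurable_indic.
have mf : measurable_fun setT (fun z : R * R => f z.1 z.2).
  apply: measurable_funM; last first.
    apply: measurable_funM; last exact: measurable_snd.
    exact: (measurableT_comp mi measurable_snd).
  apply: measurable_funM; first exact: (measurableT_comp mphi measurable_fst).
  apply: measurable_funM; last exact: (measurableT_comp (W_meas _) measurable_fst).
  apply: (measurableT_comp (j_meas _ a1)).
  by apply: measurable_funM; [exact: measurable_snd|exact: measurable_fst].
have bf x t : `|f x t| <= (`|phi x| * W (a + 1) x) * (t2 * \1_`[t1, t2] t).
  rewrite /f 3!normrM (ger0_norm (W_ge0 _ x)); apply: ler_pM => //.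
  - by apply: mulr_ge0 => //; apply: mulr_ge0 => //; exact: W_ge0.
  - apply: ler_wpM2l => //; rewrite ler_piMl ?W_ge0//.
    exact: j_le1.
  rewrite indicE mem_setE in_itv/=; case: (boolP (t1 <= t <= t2)) => [/andP[h1 h2]|_]; last first.
    by rewrite mul0r normr0 mulr0.
  by rewrite mul1r mulr1 ger0_norm// (le_trans t10).
have Li := L1_abs _ _ L'.
have ti : ig (fun t => t2 * \1_`[t1, t2] t) by apply: igZ; exact: ig_indic_bnd.
have H := fubini_it f _ _ mf Li ti bf.
have H2 := fubini_ig2 f _ _ mf Li ti bf.
have s2 := slice2_ig f _ _ mf Li bf.
have s1 := slice1_ig f _ _ mf ti bf.
have E t : it (fun x => f x t) = \1_`[t1, t2] t * (t * hat (a + 1) phi t).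
  by rewrite /f (itZr _ _ (hat_ig _ a1 _ t L')) -/(hat (a + 1) phi t); ring.
split; first by apply: eq_ig H2 => t; exact: E.
rewrite -(eq_it _ _ E) -H -itB; [|exact: hat_ig|exact: hat_ig].
rewrite -itZ; last exact: (fubini_ig1 f _ _ mf Li ti bf).
apply: eq_it => x.
transitivity (phi x * W a x * (j_alpha a (t2 * x) - j_alpha a (t1 * x))); first by ring.
have [ji ->] := j_diff x t1 t2 t10 t12.
have -> : it (f x) = phi x * W a x * it (fun t => \1_`[t1, t2] t * (t * x ^+ 2 * j_alpha (a + 1) (t * x))).
  by rewrite -(itZ _ _ ji); apply: eq_it => t; rewrite /f W_add1; ring.
by ring.
Qed.

Lemma hat_lip t1 t2 (T : R) : 0 <= t1 -> t1 < t2 -> t2 <= T ->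
  `|hat a phi t2 - hat a phi t1| <= (t2 - t1) * (T * nrm (a + 1) phi).
Proof.
move=> t10 t12 t2T; have [hi ->] := hat_diff t1 t2 t10 t12; have ag := a_gt0.
have n0 := nrm_ge0 (a + 1) phi.
have T0 : 0 <= T by apply: le_trans t2T; apply: le_trans (ltW t12).
have C0 : 0 <= T * nrm (a + 1) phi by exact: mulr_ge0.
have c1 : `|- (2 * (a + 1))^-1| <= 1.
  by rewrite normrN ger0_norm ?invr_ge0 ?invf_le1; lra.
rewrite normrM; apply: (@le_trans _ _ (1 * it (fun t => (T * nrm (a + 1) phi) * \1_`[t1, t2] t))).
  apply: ler_pM => //; apply: (le_trans (it_norm _ hi)).
  apply: it_le; [exact: ig_abs|by apply: igZ; exact: ig_indic_bnd|move=> t].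
  rewrite indicE mem_setE in_itv/=; case: (boolP (t1 <= t <= t2)) => [/andP[h1 h2]|_]; last first.
    by rewrite mul0r normr0 mulr0.
  rewrite mul1r mulr1 normrM; apply: ler_pM => //.
    by rewrite ger0_norm ?(le_trans t10)// (le_trans h2).
  exact: hat_bnd.
by rewrite mul1r (itZ _ _ (ig_indic_bnd _ _)) it_indic_itv// mulrC.
Qed.

Lemma hat_continuous x : 0 < x -> hat a phi y @[y --> x] --> hat a phi x.
Proof.
move=> x0; have n0 := nrm_ge0 (a + 1) phi.
pose C := 2 * x * nrm (a + 1) phi + 1.
have C0 : 0 < C by rewrite ltr_wpDl// !mulr_ge0// ltW.
apply/cvgrPdist_le => e e0.
near=> y.
have y0 : 0 < y by near: y; exact: lt_nbhsr.
have y2 : y < 2 * x by near: y; apply: lt_nbhsl; lra.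
have yx : `|x - y| <= e / C by near: y; apply: cvgr_dist_le => //; exact: divr_gt0.
have key t1 t2 : 0 <= t1 -> t1 < t2 -> t2 <= 2 * x -> t2 - t1 <= e / C -> `|hat a phi t2 - hat a phi t1| <= e.
  move=> h1 h2 h3 h4; apply: (le_trans (hat_lip _ _ _ h1 h2 h3)).
  apply: (@le_trans _ _ (e / C * C)); last by rewrite divfK// gt_eqF.
  apply: ler_pM => //; first by rewrite subr_ge0 ltW.
    by rewrite mulr_ge0// mulr_ge0// ltW.
  by rewrite /C lerDl.
have [xy|xy|->] := ltgtP x y.
- rewrite distrC; apply: key => //; [exact: ltW|exact: ltW|].
  by move: yx; rewrite distrC ger0_norm// subr_ge0 ltW.
- apply: key => //; [exact: ltW|lra|].
  by move: yx; rewrite ger0_norm// subr_ge0 ltW.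
- by rewrite subrr normr0 ltW.
Unshelve. all: by end_near. Qed.

End hatdiff.
End Difference.

(** * From local square integrability to the amalgam space *)

Section LocalToAmalgam.
Context {R : realType}.
Local Notation mu := (@lebesgue_measure R).
Implicit Types (x y z s r t l m e q p : R) (n k : nat) (u v h phi : R -> R).
Variable a : R.
Hypothesis a0 : 2^-1 <= a.

Let a_gt0 : 0 < a.
Proof. by apply: lt_le_trans a0; rewrite invr_gt0. Qed.

Let a1 : 2^-1 <= a + 1.
Proof. by have := a_gt0; lra. Qed.

Definition Ii n : R -> R := \1_(@In R n).

Definition JJ (F : R -> R) n : R := it (fun l => Ii n l * (F l * W a l)).

Lemma InE n l : Ii n l = (n%:R - 1 <= l < n%:R)%R%:R :> R.
Proof. by rewrite /Ii indicE mem_setE in_itv. Qed.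

Lemma In_uniq n k l : n%:R - 1 <= l < n%:R -> k%:R - 1 <= l < k%:R -> n = k.
Proof.
move=> /andP[h1 h2] /andP[l1 l2].
have nk : (n < k.+1)%N by rewrite -(ltr_nat R) -(natr1 k); lra.
have kn : (k < n.+1)%N by rewrite -(ltr_nat R) -(natr1 n); lra.
by apply/eqP; rewrite eqn_leq; apply/andP; split.
Qed.

Lemma In_meas n : measurable_fun setT (Ii n).
Proof. by apply: measurable_indic; exact: measurable_itv. Qed.

Lemma In_bnd_ig h (C : R) n : measurable_fun setT h -> (forall l, `|h l| <= C) ->
  ig (fun l => Ii n l * (h l * W a l)).
Proof.
move=> mh hC; apply: (ig_dom (fun l => C * (\1_`[(n%:R - 1), n%:R] l * W a l))).
- apply: measurable_funM; first exact: In_meas.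
  by apply: measurable_funM => //; exact: W_meas.
- by apply: igZ; exact: W_ig_bnd.
move=> l; rewrite InE indicE mem_setE in_itv/=; have [h1|h1] := leP (n%:R - 1) l; last by rewrite /= !mul0r normr0 mulr0.
have [h2|h2] := ltP l n%:R; last first.
  rewrite /= mul0r normr0 !mulr_ge0 ?W_ge0//.
  exact: le_trans (hC 0).
by rewrite /= (ltW h2) !mul1r normrM (ger0_norm (W_ge0 a l)) ler_wpM2r ?W_ge0.
Qed.

Variable f : R -> R.
Hypothesis Lf : L1 a f.
Let F := hat a f.
Hypothesis F0 : forall l, 0 <= l -> 0 <= F l.
Variable sg : R.
Hypotheses (sg0 : 0 < sg) (sg6 : sg <= 6^-1).
Hypothesis fl : ig (fun x => \1_`[0, 2 * sg] x * (f x ^+ 2 * W a x)).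

Let g := gb a sg.

Let g0 x : 0 <= g x. Proof. exact: gb_ge0. Qed.

Let gm : measurable_fun setT g. Proof. exact: (ig_meas (gb_ig a a0 sg)). Qed.

Let Ck := it (kap a).

Let g_le x : g x <= Ck * \1_`[0, 2 * sg] x. Proof. exact: gb_le. Qed.

Let g_le1 x : g x <= Ck.
Proof.
apply: (le_trans (g_le x)); apply: ler_piMr; last by rewrite indicE; case: (_ \in _).
by apply: it_ge0 => s; exact: kap_ge0.
Qed.

Let fgi : ig (fun x => f x ^+ 2 * (g x * W a x)).
Proof.
apply: ig_dom (igZ _ Ck fl) _.
  apply: measurable_funM; first by apply: measurable_funX; exact: Lf.1.
  by apply: measurable_funM => //; exact: W_meas.
move=> x; have s0 := sqr_ge0 (f x); have w0 := W_ge0 a x.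
rewrite (ger0_norm (mulr_ge0 s0 (mulr_ge0 (g0 x) w0))).
have -> : f x ^+ 2 * (g x * W a x) = g x * (f x ^+ 2 * W a x) by ring.
rewrite [leRHS]mulrA.
by apply: ler_wpM2r; [exact: mulr_ge0|exact: g_le].
Qed.

Let Z := it (fun x => f x ^+ 2 * (g x * W a x)).

(** * The quadratic form of the transform cut at [N] *)

Section fixedN.
Variable N : nat.

Let H l : R := \1_`[0, N%:R] l * F l.

Let Fm : measurable_fun setT F. Proof. exact: hat_meas. Qed.

Let Fb l : `|F l| <= nrm a f. Proof. exact: hat_bnd. Qed.

Let Hm : measurable_fun setT H.
Proof. by apply: measurable_funM => //; exact: measurable_indic. Qed.

Let Hb l : `|H l| <= nrm a f.
Proof.
rewrite /H normrM; apply: le_trans (Fb l); rewrite ler_piMl//.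
by rewrite indicE; case: (_ \in _); rewrite ?normr1 ?normr0.
Qed.

Let Hs l : ~~ (0 <= l <= N%:R) -> H l = 0.
Proof. by move=> h; rewrite /H indicE mem_setE in_itv/= (negbTE h) mul0r. Qed.

Let H0 l : 0 <= H l.
Proof.
rewrite /H indicE mem_setE in_itv/=; case: (boolP (0 <= l <= N%:R)) => [/andP[l0 _]|_]; last by rewrite mul0r.
by rewrite mul1r F0.
Qed.

Let HF l : 0 <= l -> H l <= F l.
Proof.
move=> l0; rewrite /H ler_piMl ?F0//; by rewrite indicE; case: (_ \in _).
Qed.

Let LH : L1 a H. Proof. exact: (supp_L1 a a0 H _ _ Hm Hb Hs). Qed.
Let LH' : L1 (a + 1) H. Proof. exact: (supp_L1 (a + 1) a1 H _ _ Hm Hb Hs). Qed.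

Let Hh := hat a H.
Let Hhm : measurable_fun setT Hh. Proof. exact: hat_meas. Qed.
Let Hhb x : `|Hh x| <= nrm a H. Proof. exact: hat_bnd. Qed.

Let phi x := g x * Hh x.

Let phim : measurable_fun setT phi. Proof. exact: measurable_funM. Qed.

Let phib x : `|phi x| <= Ck * nrm a H.
Proof. by rewrite /phi normrM (ger0_norm (g0 x)); apply: ler_pM. Qed.

Let phis' x : ~~ (0 <= x <= 2 * sg) -> phi x = 0.
Proof.
move=> h; rewrite /phi (_ : g x = 0) ?mul0r//; apply/eqP; rewrite eq_le g0 andbT.
by apply: (le_trans (g_le x)); rewrite indicE mem_setE in_itv/= (negbTE h) mulr0.
Qed.

Let Lphi : L1 a phi. Proof. exact: (supp_L1 a a0 phi _ _ phim phib phis'). Qed.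

Let phic x : 0 < x -> phi y @[y --> x] --> phi x.
Proof. by move=> x0; apply: cvgM; [exact: gb_continuous|exact: hat_continuous]. Qed.

Let Q := hat a phi.

Let gWi : ig (fun x => g x * (1 * W a x)).
Proof.
by apply: (gbW_ig a a0 sg (fun=> 1) 1) => // x; rewrite normr1.
Qed.

Let QE l : Q l = it (fun m => H m * W a m * KK a sg l m).
Proof.
pose p x m := g x * (j_alpha a (l * x) * W a x) * (H m * (j_alpha a (x * m) * W a m)).
have mp : measurable_fun setT (fun z : R * R => p z.1 z.2).
  apply: measurable_funM.
    apply: measurable_funM; first exact: (measurableT_comp gm measurable_fst).
    apply: measurable_funM; first exact: (measurableT_comp (jl_meas a a0 l) measurable_fst).
    exact: (measurableT_comp (W_meas a) measurable_fst).
  apply: measurable_funM; first exact: (measurableT_comp Hm measurable_snd).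
  apply: measurable_funM; first exact: j_meas2.
  exact: (measurableT_comp (W_meas a) measurable_snd).
have bp x m : `|p x m| <= (g x * (1 * W a x)) * (`|H m| * W a m).
  rewrite /p normrM; apply: ler_pM => //.
    rewrite 2!normrM (ger0_norm (g0 x)) (ger0_norm (W_ge0 a x)); apply: ler_wpM2l => //.
    by apply: ler_wpM2r; [exact: W_ge0|exact: j_le1].
  rewrite normrM [`|j_alpha _ _ * _|]normrM (ger0_norm (W_ge0 a m)); apply: ler_wpM2l => //.
  by rewrite ler_piMl ?W_ge0//; exact: j_le1.
have FE := fubini_it p _ _ mp gWi (L1_abs a H LH) bp.
transitivity (it (fun x => it (p x))).
  apply: eq_it => x; rewrite /p (itZ _ _ (hat_ig a a0 H x LH)) -/(hat a H x) -/Hh /phi.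
  by ring.
rewrite FE; apply: eq_it => m.
have ki : ig (fun x => g x * (j_alpha a (l * x) * j_alpha a (m * x) * W a x)).
  apply: (gbW_ig a a0 sg (fun x => j_alpha a (l * x) * j_alpha a (m * x)) 1).
    by apply: measurable_funM; exact: jl_meas.
  move=> x; rewrite normrM.
  by apply: mulr_ile1; [exact: normr_ge0|exact: normr_ge0|exact: j_le1|exact: j_le1].
transitivity (it (fun x => H m * W a m * (g x * (j_alpha a (l * x) * j_alpha a (m * x) * W a x)))).
  by apply: eq_it => x; rewrite /p (mulrC x m); ring.
exact: (itZ _ _ ki).
Qed.

Let Q0 l : 0 <= Q l.
Proof.
rewrite QE; apply: it_ge0 => m; apply: mulr_ge0; last exact: KK_ge0.
exact: mulr_ge0 (H0 m) (W_ge0 a m).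
Qed.

Let Qm : measurable_fun setT Q. Proof. exact: hat_meas. Qed.
Let Qb l : `|Q l| <= nrm a phi. Proof. exact: hat_bnd. Qed.

Let X := it (fun l => Q l * (H l * W a l)).

Let XE : X = it (fun x => phi x * (Hh x * W a x)).
Proof. exact: parseval. Qed.

Let Y := it (fun x => f x * (phi x * W a x)).

(** By inversion, [kpa a * Y] is the limit of the Gaussian means of [F * Q]. Since [Q >= 0] and
    [0 <= H <= F] on the half-line, each of them dominates the corresponding mean of [H * Q], which
    tends to [X]. *)
Let X_le_Y : X <= kpa a * Y.
Proof.
have phia : {ae mu, forall x, 0 < x -> phi y @[y --> x] --> phi x} by exact: aeW.
have inv := inversion a a0 f phi _ Lf Lphi phib phia.
have mG n : measurable_fun setT (Gs (@en R n)) by exact: Gs_meas.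
have hi : ig (fun l => Q l * (H l * W a l)).
  have := L1_bnd a H Q _ LH Qm Qb; apply: eq_ig => l; ring.
have g1 n l : Gs (@en R n) l <= 1 by apply: Gs_le1; rewrite ltW// en_gt0.
pose hn n l := Gs (en n) l * (Q l * (H l * W a l)).
have hn0 l : 0 <= Q l * (H l * W a l).
  exact: mulr_ge0 (Q0 l) (mulr_ge0 (H0 l) (W_ge0 a l)).
have mhn n : measurable_fun setT (hn n).
  by apply: measurable_funM => //; exact: (ig_meas hi).
have bhn n l : `|hn n l| <= Q l * (H l * W a l).
  rewrite (ger0_norm (mulr_ge0 (Gs_ge0 _ _) (hn0 l))) /hn ler_piMl//.
have chn l : hn n l @[n --> \oo] --> Q l * (H l * W a l).
  rewrite -[X in _ --> X]mul1r; apply: cvgM; last exact: cvg_cst.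
  exact: Gs_en_cvg.
have [_ hc] := it_dct _ _ _ mhn hi bhn chn.
rewrite -subr_ge0; apply: cvg_ge_cst (cvgB inv hc) _ => n; rewrite subr_ge0.
have gl := GL1 a a0 _ _ Lphi (@en_gt0 R n).
apply: it_le.
- exact: ig_dom hi (bhn n).
- have := L1_bnd a _ F _ gl Fm Fb; apply: eq_ig => l; rewrite /F /Q; ring.
move=> l; have [l0|l0] := ltP l 0; first by rewrite /hn W_neg ?(ltW l0)// !mulr0.
have -> : hn n l = H l * (Gs (en n) l * hat a phi l * W a l) by rewrite /hn /Q; ring.
apply: ler_wpM2r; last exact: HF.
exact: mulr_ge0 (mulr_ge0 (Gs_ge0 _ _) (Q0 l)) (W_ge0 a l).
Qed.

(** AM-GM bounds [kpa * f * Hh] by half of [(kpa * f)^2 + Hh^2]. Integrated against [g], the second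
    square is [X] itself by [XE], and its half is absorbed on the left. *)
Let X_le : X <= kpa a ^+ 2 * Z.
Proof.
have xi : ig (fun x => phi x * (Hh x * W a x)).
  exact: (L1_bnd a phi Hh _ Lphi Hhm Hhb).
have yi : ig (fun x => f x * (phi x * W a x)).
  exact: (L1_bnd a f phi _ Lf phim phib).
have : kpa a * Y <= 2^-1 * (kpa a ^+ 2 * Z) + 2^-1 * X.
  rewrite XE /Y /Z -(itZ _ _ yi) -(itZ _ _ fgi) -(itZ _ _ xi) -(itZ _ _ (igZ _ _ fgi)) -(itD _ _ (igZ _ _ (igZ _ _ fgi)) (igZ _ _ xi)).
  apply: it_le.
  - exact: igZ.
  - by apply: igD; apply: igZ => //; apply: igZ.
  move=> x; rewrite -subr_ge0 /phi.
  have -> : 2^-1 * (kpa a ^+ 2 * (f x ^+ 2 * (g x * W a x))) + 2^-1 * (g x * Hh x * (Hh x * W a x)) -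
      kpa a * (f x * (g x * Hh x * W a x)) = 2^-1 * (g x * W a x) * (kpa a * f x - Hh x) ^+ 2 by field.
  apply: mulr_ge0; last exact: sqr_ge0.
  by apply: mulr_ge0; [rewrite invr_ge0|exact: mulr_ge0 (g0 x) (W_ge0 a x)].
move=> h; have h' := le_trans X_le_Y h.
move: X (kpa a ^+ 2 * Z) h' => U V h'; lra.
Qed.

Let c0' := c0 a sg.

Let Ji n : ig (fun l => Ii n l * (F l * W a l)).
Proof. exact: (In_bnd_ig F _ n Fm Fb). Qed.

Let Q_ge n l : (0 < n <= N)%N -> n%:R - 1 <= l < n%:R -> c0' / pw (2 * a + 1) n%:R * JJ F n <= Q l.
Proof.
move=> /andP[n0 nN] /andP[l1 l2].
have np : 0 < n%:R :> R by rewrite ltr0n.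
have pn : 0 < pw (2 * a + 1) n%:R :> R by exact: pw_gt0.
rewrite QE /JJ -(itZ _ _ (Ji n)); apply: it_le.
- exact: igZ.
- have K1 m : KK a sg l m = it (fun x => g x * (j_alpha a (l * x) * j_alpha a (m * x) * W a x)) by [].
  pose w x := g x * j_alpha a (l * x).
  have Lw : L1 a w.
    split; first by apply: measurable_funM => //; exact: jl_meas.
    have := gbW_ig a a0 sg _ 1 (jl_meas a a0 l) (fun x => j_le1 a a0 (l * x)).
    by apply: eq_ig => x; rewrite /w /g; ring.
  have KE : KK a sg l = hat a w.
    by apply/funext => m; rewrite K1; apply: eq_it => x; rewrite /w; ring.
  have Km : measurable_fun setT (KK a sg l) by rewrite KE; exact: hat_meas.
  have Kb m : `|KK a sg l m| <= nrm a w by rewrite KE; exact: hat_bnd.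
  have := L1_bnd a H _ _ LH Km Kb; apply: eq_ig => m; ring.
move=> m; rewrite InE; case: (boolP (n%:R - 1 <= m < n%:R)) => [/andP[m1 m2]|_]; last first.
  rewrite mul0r mulr0; apply: mulr_ge0; last exact: KK_ge0.
  exact: mulr_ge0 (H0 m) (W_ge0 a m).
have m0 : 0 <= m by apply: le_trans m1; rewrite subr_ge0 ler1n.
have HE : H m = F m.
  rewrite /H indicE mem_setE in_itv/= m0/= (_ : m <= N%:R) ?mul1r//.
  by rewrite (le_trans (ltW m2))// ler_nat.
rewrite HE mul1r mulrC; apply: ler_wpM2l; first exact: mulr_ge0 (F0 m m0) (W_ge0 a m).
rewrite ler_pdivrMr//; apply: KK_lower => //; apply/andP; split=> //; exact: ltW.
Qed.

(** On [I_n] the function [Q] is at least a multiple of [JJ F n] by [Q_ge]. Integrating it against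
    [H] bounds [X] from below by the sum, at most one summand being nonzero at each point. The bound
    is uniform in [N]. *)
Lemma amalgam_partial : \sum_(1 <= n < N.+1) JJ F n ^+ 2 / pw (2 * a + 1) n%:R <= kpa a ^+ 2 * Z / c0'.
Proof.
have c0p : 0 < c0' by exact: c0_gt0.
rewrite ler_pdivlMr//; apply: le_trans X_le.
have -> : (\sum_(1 <= n < N.+1) JJ F n ^+ 2 / pw (2 * a + 1) n%:R) * c0' =
   it (fun l => \sum_(1 <= n < N.+1) (c0' / pw (2 * a + 1) n%:R * JJ F n) * (Ii n l * (F l * W a l))).
  rewrite it_sum; last by move=> n; apply: igZ; exact: Ji.
  rewrite mulr_suml; apply: eq_bigr => n _; rewrite (itZ _ _ (Ji n)) -/(JJ F n).
  by ring.
apply: it_le.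
- by apply: ig_sum => n; apply: igZ; exact: Ji.
- have := L1_bnd a H Q _ LH Qm Qb; apply: eq_ig => l; ring.
move=> l.
have HW0 : 0 <= H l * W a l by exact: mulr_ge0 (H0 l) (W_ge0 a l).
have [[n0 nN ln]|no] := pselect (exists2 n, (0 < n <= N)%N & n%:R - 1 <= l < n%:R); last first.
  rewrite big_nat big1; first exact: mulr_ge0 (Q0 l) HW0.
  move=> n nN; rewrite InE; case: (boolP (n%:R - 1 <= l < n%:R)) => h; last by rewrite mul0r mulr0.
  by exfalso; apply: no; exists n => //; rewrite -(ltnS n N).
rewrite (bigD1_seq n0) /= ?iota_uniq//; last by rewrite mem_index_iota ltnS.
rewrite big_nat_cond big1 ?addr0; last first.
  move=> n /andP[_ nn0]; rewrite InE; case: (boolP (n%:R - 1 <= l < n%:R)) => [/andP[h1 h2]|_]; last by rewrite mul0r mulr0.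
  by exfalso; move/eqP: nn0; apply; exact: In_uniq (introT andP (conj h1 h2)) ln.
rewrite InE ln mul1r.
have [l1 l2] := andP ln; have [n1 n2] := andP nN.
have l0 : 0 <= l by apply: le_trans l1; rewrite subr_ge0 ler1n.
have HE : H l = F l.
  rewrite /H indicE mem_setE in_itv/= l0/= (_ : l <= N%:R) ?mul1r//.
  by rewrite (le_trans (ltW l2))// ler_nat.
rewrite -HE; apply: ler_wpM2r => //; exact: Q_ge.
Qed.

End fixedN.
End LocalToAmalgam.

(** * Sobolev bounds on unit intervals *)

Section AmalgamToLocal.
Context {R : realType}.
Local Notation mu := (@lebesgue_measure R).
Implicit Types (x y z s r t l e q p : R) (n k m : nat) (u v h : R -> R).
Variable a : R.
Hypothesis a0 : 2^-1 <= a.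

Let a_gt0 : 0 < a.
Proof. by apply: lt_le_trans a0; rewrite invr_gt0. Qed.

Let a1 : 2^-1 <= a + 1.
Proof. by have := a_gt0; lra. Qed.

Definition pn n : R := pw (2 * a + 1) n%:R.

Lemma pn_gt0 n : (0 < n)%N -> 0 < pn n.
Proof. by move=> n0; apply: pw_gt0; rewrite ltr0n. Qed.

Lemma pn_sqr n : (0 < n)%N -> n%:R ^+ 2 <= pn n.
Proof.
move=> n0; rewrite /pn pw_pos ?ltr0n// -powR_mulrn//.
by apply: ler_powR; [rewrite ler1n|have := a0; lra].
Qed.

Lemma Ii_ge0 n l : 0 <= @Ii R n l. Proof. by rewrite InE. Qed.

Lemma Ii_ig n : ig (@Ii R n).
Proof.
apply: (ig_dom (\1_`[(n%:R - 1), n%:R])); [exact: In_meas|exact: ig_indic_bnd|move=> l].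
rewrite (ger0_norm (Ii_ge0 n l)) InE indicE mem_setE in_itv/= ler_nat.
by case: (leP (n%:R - 1) l) => //= _; case: (ltP l n%:R) => //= h; rewrite (ltW h).
Qed.

Lemma Ii_bnd_ig h (C : R) n : measurable_fun setT h ->
  (forall l, n%:R - 1 <= l < n%:R -> `|h l| <= C) -> ig (fun l => Ii n l * h l).
Proof.
move=> mh hC; apply: (ig_dom (fun l => C * Ii n l)).
- by apply: measurable_funM => //; exact: In_meas.
- by apply: igZ; exact: Ii_ig.
move=> l; rewrite normrM (ger0_norm (Ii_ge0 n l)) mulrC InE.
case: (boolP (n%:R - 1 <= l < n%:R)) => hl; last by rewrite !mulr0.
by rewrite !mulr1; exact: hC.
Qed.

Lemma Ii_it n : it (@Ii R n) = 1.
Proof.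
have E : (fun x : R => \1_`[(n%:R - 1), n%:R] x) = fun x => Ii n x + \1_`[n%:R, n%:R] x.
  apply/funext => x; rewrite InE !indicE !mem_setE !in_itv/=.
  case: (leP (n%:R - 1) x) => h1 /=; last first.
    by rewrite add0r; case: (leP n%:R x) => h2 //=; exfalso; lra.
  by case: (ltgtP x n%:R) => h2 /=; rewrite ?addr0 ?add0r.
have h : n%:R - 1 < n%:R :> R by lra.
have := it_indic_itv _ _ h; rewrite (_ : n%:R - (n%:R - 1) = 1 :> R); last by ring.
rewrite (_ : \1_`[(n%:R - 1), n%:R] = (fun x : R => \1_`[(n%:R - 1), n%:R] x))// E.
rewrite (itD _ _ (Ii_ig n) (ig_indic_bnd _ _)) => <-.
(* The half-open interval differs from the closed one by a point, whose integral is at most any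
   [e > 0]. *)
suff -> : it (\1_`[n%:R, n%:R] : R -> R) = 0 by rewrite addr0.
apply/eqP; rewrite eq_le; apply/andP; split; last by apply: it_ge0 => x; rewrite indicE.
apply/ler_addgt0Pr => e e0; rewrite add0r.
have he : n%:R - e < n%:R :> R by lra.
apply: (@le_trans _ _ (it (\1_`[n%:R - e, n%:R] : R -> R))); last by rewrite it_indic_itv//; lra.
apply: it_le; [exact: ig_indic_bnd|exact: ig_indic_bnd|move=> x].
rewrite !indicE !mem_setE !in_itv/= ler_nat; case: (boolP (n%:R <= x <= n%:R)) => //= /andP[h1 ->].
by rewrite (_ : n%:R - e <= x)//; lra.
Qed.

Lemma sum_Ii n l : \sum_(1 <= m < n.+1) Ii m l = (0 <= l < n%:R)%R%:R :> R.
Proof.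
elim: n => [|n IH].
  by rewrite big_geq//; case: (leP 0 l) => //= h; rewrite ltNge h.
rewrite big_nat_recr//= IH InE -(natr1 n) addrK.
have n0 : 0 <= n%:R :> R by [].
have [h1|h1] := ltP l n%:R.
  have h2 : l < n%:R + 1 by lra.
  by rewrite h2 /= addr0.
have h2 : 0 <= l by lra.
by rewrite h2 /= add0r.
Qed.

(* Minimising the right-hand side over [tau] gives back the Cauchy-Schwarz inequality. *)
Lemma amgm_weighted (tau p s2 s J : R) : 0 < tau -> 0 < p -> s ^+ 2 = s2 ->
  s * J <= 2^-1 * (tau * (J ^+ 2 / p) + tau^-1 * (p * s2)).
Proof.
move=> t0 p0 <-; rewrite -subr_ge0.
have -> : 2^-1 * (tau * (J ^+ 2 / p) + tau^-1 * (p * s ^+ 2)) - s * J =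
  (2 * tau * p)^-1 * (tau * J - p * s) ^+ 2.
  by field; rewrite !gt_eqF.
apply: mulr_ge0; last exact: sqr_ge0.
by rewrite invr_ge0; apply: mulr_ge0; [apply: mulr_ge0 => //|]; exact: ltW.
Qed.

(** * Test functions supported in one unit interval *)

Section sobolev.
Variables (phi : R -> R) (B : R) (n : nat).
Hypotheses (n0 : (0 < n)%N) (mphi : measurable_fun setT phi) (phiB : forall x, `|phi x| <= B).
Hypothesis phiI : forall x, ~~ (n%:R - 1 <= x <= n%:R) -> phi x = 0.

Let n1 : 1 <= n%:R :> R. Proof. by rewrite ler1n. Qed.

Let phiD x : ~~ (0 <= x <= n%:R) -> phi x = 0.
Proof.
move=> h; apply: phiI; apply: contra h => /andP[h1 ->]; rewrite andbT.
by apply: le_trans h1; rewrite subr_ge0.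
Qed.

Let L : L1 a phi. Proof. exact: (supp_L1 a a0 phi B n%:R mphi phiB phiD). Qed.
Let L' : L1 (a + 1) phi. Proof. exact: (supp_L1 (a + 1) a1 phi B n%:R mphi phiB phiD). Qed.

Let S := it (fun x => phi x ^+ 2 * W a x).
Let Si : ig (fun x => phi x ^+ 2 * W a x). Proof. exact: (supp_sqr a a0 phi B n%:R mphi phiB phiD). Qed.
Let S0 : 0 <= S. Proof. by apply: it_ge0 => x; exact: mulr_ge0 (sqr_ge0 _) (W_ge0 a x). Qed.

Let h := hat a phi.
Let h' := hat (a + 1) phi.

Let hm : measurable_fun setT h. Proof. exact: hat_meas. Qed.
Let hm' : measurable_fun setT h'. Proof. exact: hat_meas. Qed.
Let hb l : `|h l| <= nrm a phi. Proof. exact: hat_bnd. Qed.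
Let hb' l : `|h' l| <= nrm (a + 1) phi. Proof. exact: hat_bnd. Qed.

(** Cauchy-Schwarz on the support, whose measure is at most [pn n]; the multiplier [p / P] used in
    AM-GM is the optimal one once that measure is replaced by [P]. *)
Lemma nrm_sqr : nrm a phi ^+ 2 <= pn n * S.
Proof.
have pn0 := pn_gt0 n n0; set p := nrm a phi; set P := pn n in pn0 *.
pose E : R -> R := \1_`[(n%:R - 1), n%:R].
have EW : ig (fun x => E x * W a x) by exact: W_ig_bnd.
have EW1 : it (fun x => E x * W a x) <= P.
  apply: (@le_trans _ _ (it (fun x => P * E x))).
    apply: it_le; [exact: EW|by apply: igZ; exact: ig_indic_bnd|move=> x].
    rewrite /E indicE mem_setE in_itv/=; case: (boolP (n%:R - 1 <= x <= n%:R)) => [/andP[_ h2]|_]; last by rewrite mul0r mulr0.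
    by rewrite mul1r mulr1; apply: pw_le => //; have := a_gt0; lra.
  by rewrite (itZ _ _ (ig_indic_bnd _ _)) it_indic_itv; lra.
have Li := L1_abs a phi L.
have i1 : ig (fun x => phi x ^+ 2 * W a x + (p / P) ^+ 2 * (E x * W a x)) by apply: igD; [exact: Si|exact: igZ].
have K : 2 * (p / P) * p <= S + (p / P) ^+ 2 * it (fun x => E x * W a x).
  rewrite -[X in _ * X](erefl (nrm a phi)) -(itZ _ _ EW) -(itD _ _ Si (igZ _ _ EW)) -(itZ _ _ Li).
  apply: it_le; [exact: igZ|exact: i1|move=> x].
  have -> : phi x = phi x * E x.
    rewrite /E indicE mem_setE in_itv/=; case: (boolP (n%:R - 1 <= x <= n%:R)) => hx; first by rewrite mulr1.
    by rewrite phiI// mul0r.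
  have E01 : E x = 0 \/ E x = 1 by rewrite /E indicE; case: (_ \in _); [right|left].
  have w0 := W_ge0 a x.
  rewrite -subr_ge0 normrM.
  have -> : (phi x * E x) ^+ 2 * W a x + (p / P) ^+ 2 * (E x * W a x) - 2 * (p / P) * (`|phi x| * `|E x| * W a x) =
     W a x * ((phi x * E x) ^+ 2 + (p / P) ^+ 2 * E x - 2 * (p / P) * (`|phi x| * `|E x|)) by ring.
  apply: mulr_ge0 => //.
  case: E01 => ->; first by rewrite normr0 !mulr0 expr0n /= addr0 subr0.
  rewrite normr1 !mulr1 -(real_normK (num_real (phi x))).
  have := sqr_ge0 (`|phi x| - p / P); nra.
have p0 : 0 <= p by exact: nrm_ge0.
have K2 : (p / P) ^+ 2 * it (fun x => E x * W a x) <= (p / P) ^+ 2 * P by apply: ler_wpM2l => //; exact: sqr_ge0.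
have K3 : 2 * (p / P) * p <= S + (p / P) ^+ 2 * P by apply: le_trans K _; rewrite lerD2l.
rewrite -ler_pdivrMl//.
have e1 : 2 * (p / P) * p = 2 * (P^-1 * p ^+ 2) by ring.
have e2 : (p / P) ^+ 2 * P = P^-1 * p ^+ 2 by field; rewrite gt_eqF.
by move: K3; rewrite e1 e2; lra.
Qed.

Let th_meas : measurable_fun setT (fun t => t * h' t).
Proof. exact: measurable_funM. Qed.

Let th_bnd m t : m.+1%:R - 1 <= t < m.+1%:R -> `|t * h' t| <= m.+1%:R * nrm (a + 1) phi.
Proof.
move=> /andP[t1 t2]; rewrite normrM; apply: ler_pM => //.
by rewrite ger0_norm ?(ltW t2)//; apply: le_trans t1; rewrite subr_ge0 ler1n.
Qed.

(** Bounds the oscillation of [h] on the interval [I_(m+1)], by [hat_diff]. *)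
Let vv m := it (fun t => Ii m.+1 t * `|t * h' t|).

Let vv_ig m : ig (fun t => Ii m.+1 t * `|t * h' t|).
Proof.
apply: (Ii_bnd_ig _ (m.+1%:R * nrm (a + 1) phi)); first exact: measurableT_comp.
by move=> t ht; rewrite normr_id; exact: th_bnd.
Qed.

Let vv2_ig m : ig (fun t => Ii m.+1 t * (t * h' t) ^+ 2).
Proof.
apply: (Ii_bnd_ig _ ((m.+1%:R * nrm (a + 1) phi) ^+ 2)); first exact: measurable_funX.
move=> t ht; rewrite normrX lerXn2r ?nnegrE//; last exact: th_bnd.
by apply: mulr_ge0 => //; exact: nrm_ge0.
Qed.

Let h2_ig m : ig (fun t => Ii m t * h t ^+ 2).
Proof.
apply: (Ii_bnd_ig _ (nrm a phi ^+ 2)); first exact: measurable_funX.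
by move=> t _; rewrite normrX lerXn2r ?nnegrE//; exact: nrm_ge0.
Qed.

Let vv_diff_lt m l t : m.+1%:R - 1 <= t -> t < l -> l < m.+1%:R -> `|h l - h t| <= vv m.
Proof.
move=> t1 tl l2; have t0 : 0 <= t by apply: le_trans t1; rewrite subr_ge0 ler1n.
have [hi ->] := hat_diff a a0 phi L L' t l t0 tl.
have c1 : `|- (2 * (a + 1))^-1| <= 1 by rewrite normrN ger0_norm ?invr_ge0 ?invf_le1; have := a_gt0; lra.
rewrite normrM -[leRHS]mul1r; apply: ler_pM => //.
apply: (le_trans (it_norm _ hi)); apply: it_le; [exact: ig_abs|exact: vv_ig|move=> s].
rewrite normrM; apply: ler_wpM2r => //.
rewrite InE indicE mem_setE in_itv/=; case: (boolP (t <= s <= l)) => [/andP[s1 s2]|_]; last by rewrite normr0.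
by rewrite normr1 (le_trans t1 s1) (le_lt_trans s2 l2).
Qed.

Let vv_diff m l t : m.+1%:R - 1 <= t < m.+1%:R -> m.+1%:R - 1 <= l < m.+1%:R -> `|h l - h t| <= vv m.
Proof.
move=> /andP[t1 t2] /andP[l1 l2]; have [tl|lt|->] := ltgtP t l.
- exact: vv_diff_lt.
- by rewrite distrC; exact: vv_diff_lt.
- by rewrite subrr normr0; apply: it_ge0 => s; apply: mulr_ge0 => //; exact: Ii_ge0.
Qed.

Let vv_sqr m : vv m ^+ 2 <= it (fun t => Ii m.+1 t * (t * h' t) ^+ 2).
Proof.
have v1 := vv_ig m; have v2 := vv2_ig m; set v := vv m.
have : 0 <= it (fun t => Ii m.+1 t * (`|t * h' t| - v) ^+ 2).
  by apply: it_ge0 => t; apply: mulr_ge0; [exact: Ii_ge0|exact: sqr_ge0].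
rewrite (_ : (fun t => _) = fun t => (Ii m.+1 t * (t * h' t) ^+ 2 - (2 * v) * (Ii m.+1 t * `|t * h' t|)) + v ^+ 2 * Ii m.+1 t); last first.
  by apply/funext => t; rewrite -(real_normK (num_real (t * h' t))); ring.
rewrite (itD _ _ (igB _ _ v2 (igZ _ _ v1)) (igZ _ _ (Ii_ig _))) (itB _ _ v2 (igZ _ _ v1)).
rewrite (itZ _ _ v1) (itZ _ _ (Ii_ig _)) Ii_it -/(vv m) -/v.
move: (it _) v => Iv v'; nra.
Qed.

(** Sobolev bound for the square of [h] on [I_(m+1)]: average
    [h(l)^2 <= 2 h(t)^2 + 2 (h(l) - h(t))^2] over [t]. The interval has length 1, so averaging
    brings in no constant. *)
Definition sm2 m : R := 2 * it (fun t => Ii m.+1 t * h t ^+ 2) + 2 * it (fun t => Ii m.+1 t * (t * h' t) ^+ 2).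

Let sm2_sup m l : m.+1%:R - 1 <= l < m.+1%:R -> h l ^+ 2 <= sm2 m.
Proof.
move=> hl; apply: (@le_trans _ _ (2 * it (fun t => Ii m.+1 t * h t ^+ 2) + 2 * vv m ^+ 2)); last first.
  by rewrite /sm2 lerD2l; apply: ler_wpM2l => //; exact: vv_sqr.
have i1 := h2_ig m.+1; have i2 := Ii_ig m.+1.
have -> : h l ^+ 2 = it (fun t => h l ^+ 2 * Ii m.+1 t) by rewrite (itZ _ _ i2) Ii_it mulr1.
have -> : 2 * it (fun t => Ii m.+1 t * h t ^+ 2) + 2 * vv m ^+ 2 =
   it (fun t => 2 * (Ii m.+1 t * h t ^+ 2) + (2 * vv m ^+ 2) * Ii m.+1 t).
  by rewrite (itD _ _ (igZ _ _ i1) (igZ _ _ i2)) (itZ _ _ i1) (itZ _ _ i2) Ii_it mulr1.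
apply: it_le; [exact: igZ|by apply: igD; exact: igZ|move=> t].
rewrite InE; case: (boolP (m.+1%:R - 1 <= t < m.+1%:R)) => ht; last by rewrite !mulr0 mul0r mulr0 addr0.
rewrite !mulr1 mul1r.
have := vv_diff m l t ht hl; move: (h l) (h t) (vv m) => x y v; rewrite ler_norml => /andP[q1 q2].
(* This square is [2 y^2 + 2 (x - y)^2 - x^2]. *)
have : 0 <= (x - 2 * y) ^+ 2 by exact: sqr_ge0.
have : (x - y) ^+ 2 <= v ^+ 2 by nra.
nra.
Qed.

Let c2 : R := 2 * pw (2 * a + 1) 2.

Let GG t := h t ^+ 2 * W a t + h' t ^+ 2 * W (a + 1) t.

Let GG_ig m : ig (fun t => Ii m t * GG t).
Proof.
have i1 : ig (fun t => Ii m t * (h t ^+ 2 * W a t)).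
  apply: (In_bnd_ig a a0 (fun t => h t ^+ 2) (nrm a phi ^+ 2) m); first exact: measurable_funX.
  by move=> t; rewrite normrX lerXn2r ?nnegrE//; exact: nrm_ge0.
have i2 : ig (fun t => Ii m t * (h' t ^+ 2 * W (a + 1) t)).
  apply: (In_bnd_ig (a + 1) a1 (fun t => h' t ^+ 2) (nrm (a + 1) phi ^+ 2) m); first exact: measurable_funX.
  by move=> t; rewrite normrX lerXn2r ?nnegrE//; exact: nrm_ge0.
have := igD _ _ i1 i2; rewrite (_ : (fun t => _) = fun t => Ii m t * GG t)//.
by apply/funext => t; rewrite /GG mulrDr.
Qed.

(** For [0 < m], points of [I_(m+1)] satisfy [m + 1 <= 2t], so the weight there is comparable to
    [pn m.+1]. The factor [t^2] in front of [h'^2] is the one that [W (a + 1)] carries over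
    [W a]. *)
Let sm2_GG m : (0 < m)%N -> pn m.+1 * sm2 m <= c2 * it (fun t => Ii m.+1 t * GG t).
Proof.
move=> m0; have i1 := h2_ig m.+1; have i2 := vv2_ig m; have i3 := GG_ig m.+1.
have -> : pn m.+1 * sm2 m = it (fun t => (pn m.+1 * 2) * (Ii m.+1 t * h t ^+ 2) + (pn m.+1 * 2) * (Ii m.+1 t * (t * h' t) ^+ 2)).
  rewrite (itD _ _ (igZ _ _ i1) (igZ _ _ i2)) (itZ _ _ i1) (itZ _ _ i2) /sm2; ring.
rewrite -(itZ _ _ i3); apply: it_le; [by apply: igD; exact: igZ|exact: igZ|move=> t].
rewrite InE; case: (boolP (m.+1%:R - 1 <= t < m.+1%:R)) => [/andP[t1 t2]|_]; last by rewrite !mul0r !mulr0 addr0.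
rewrite !mul1r /GG W_add1.
have m1 : 1 <= m%:R :> R by rewrite ler1n.
have tm : m.+1%:R <= 2 * t by move: t1; rewrite -(natr1 m); lra.
have t0 : 0 <= t by move: t1; rewrite -(natr1 m); lra.
have pW : pn m.+1 <= pw (2 * a + 1) 2 * W a t.
  rewrite W_pw -pwM//; apply: pw_le => //; have := a_gt0; lra.
have -> : pn m.+1 * 2 * h t ^+ 2 + pn m.+1 * 2 * (t * h' t) ^+ 2 = pn m.+1 * (2 * (h t ^+ 2 + (t * h' t) ^+ 2)) by ring.
have -> : c2 * (h t ^+ 2 * W a t + h' t ^+ 2 * (t ^+ 2 * W a t)) = (pw (2 * a + 1) 2 * W a t) * (2 * (h t ^+ 2 + (t * h' t) ^+ 2)).
  by rewrite /c2; ring.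
apply: ler_wpM2r => //; apply: mulr_ge0 => //.
by apply: addr_ge0; exact: sqr_ge0.
Qed.

(** The 1 pays for the first interval, through [nrm_sqr]; the rest collects the two Plancherel
    constants, with the loss [c2] of [sm2_GG]. *)
Definition DD : R := 1 + c2 * (kpa a + kpa (a + 1)).

Lemma DD_gt0 : 0 < DD.
Proof.
apply: ltr_wpDr => //; apply: mulr_ge0; first by apply: mulr_ge0 => //; exact: pw_ge0.
by apply: addr_ge0; apply: ltW; [exact: kpa_gt0|exact: kpa_gt0].
Qed.

(** On the first interval the weight degenerates at 0 and the Sobolev bound is of no use, so the
    trivial bound of a transform by the norm replaces it. *)
Definition sup2 m : R := if m is 0%N then nrm a phi ^+ 2 else sm2 m.

Lemma sup2E m l : m.+1%:R - 1 <= l < m.+1%:R -> h l ^+ 2 <= sup2 m.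
Proof.
case: m => [_|m]; last exact: sm2_sup.
by rewrite -(real_normK (num_real (h l))) lerXn2r ?nnegrE//; exact: nrm_ge0.
Qed.

Let c2_ge0 : 0 <= c2. Proof. by apply: mulr_ge0 => //; exact: pw_ge0. Qed.

Let GG_ge0 t : 0 <= GG t.
Proof. by apply: addr_ge0; apply: mulr_ge0; [exact: sqr_ge0|exact: W_ge0|exact: sqr_ge0|exact: W_ge0]. Qed.

Let S' : it (fun x => phi x ^+ 2 * W (a + 1) x) <= n%:R ^+ 2 * S.
Proof.
rewrite -(itZ _ _ Si); apply: it_le.
- exact: (supp_sqr (a + 1) a1 phi B n%:R mphi phiB phiD).
- exact: igZ.
move=> x; have [hx|hx] := boolP (0 <= x <= n%:R); last by rewrite phiD// expr0n/= !mul0r mulr0.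
have /andP[x0 xn] := hx.
rewrite W_add1 mulrCA; apply: ler_wpM2r; first exact: mulr_ge0 (sqr_ge0 _) (W_ge0 _ _).
by rewrite lerXn2r ?nnegrE// ?(le_trans x0).
Qed.

(* Here [2 * a + 1 >= 2] absorbs the factor [n ^+ 2] lost on [H_(a+1)]. *)
Lemma sup2_sum M : \sum_(0 <= m < M) pn m.+1 * sup2 m <= DD * (pn n * S).
Proof.
have P0 : 0 <= pn n * S by apply: mulr_ge0 => //; exact: ltW (pn_gt0 n n0).
have k0 := ltW (kpa_gt0 a a0); have k1 := ltW (kpa_gt0 (a + 1) a1).
apply: (@le_trans _ _ (nrm a phi ^+ 2 + c2 * it (fun t => \sum_(1 <= m < M.+1) Ii m t * GG t))).
  rewrite it_sum; last exact: GG_ig.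
  case: M => [|M].
    rewrite !big_geq// mulr0 addr0; exact: sqr_ge0.
  rewrite big_nat_recl//= [in leRHS]big_nat_recl//=; apply: lerD.
    by rewrite /pn pw_pos// powR1 mul1r.
  rewrite mulrDr -[leLHS]add0r; apply: lerD.
    by apply: mulr_ge0 => //; apply: it_ge0 => t; apply: mulr_ge0 => //; exact: Ii_ge0.
  rewrite mulr_sumr big_add1/=; apply: ler_sum => m _; exact: sm2_GG.
have [q1 q2] := plancherel_ineq a a0 phi B n%:R mphi phiB phiD M%:R.
have [q3 q4] := plancherel_ineq (a + 1) a1 phi B n%:R mphi phiB phiD M%:R.
have K : it (fun t => \sum_(1 <= m < M.+1) Ii m t * GG t) <= (kpa a + kpa (a + 1)) * (pn n * S).
  apply: (@le_trans _ _ (it (fun l => \1_`[0, M%:R] l * (h l ^+ 2 * W a l) + \1_`[0, M%:R] l * (h' l ^+ 2 * W (a + 1) l)))).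
    apply: it_le; [by apply: ig_sum => m; exact: GG_ig|exact: igD|move=> l].
    rewrite -mulr_suml -mulrDr -/(GG l); apply: ler_wpM2r => //.
    rewrite sum_Ii indicE mem_setE in_itv/= ler_nat.
    by case: (leP 0 l) => //= _; case: (ltP l M%:R) => //= hl; rewrite (ltW hl).
  rewrite (itD _ _ q1 q3) mulrDl; apply: lerD.
    apply: (le_trans q2); apply: ler_wpM2l => //.
    rewrite -/S ler_peMl//; apply: le_trans (pn_sqr n n0).
    by rewrite exprn_ege1.
  apply: (le_trans q4); apply: ler_wpM2l => //; apply: (le_trans S').
  by apply: ler_wpM2r => //; exact: pn_sqr.
rewrite /DD mulrDl mul1r; apply: lerD; first exact: nrm_sqr.
by rewrite -mulrA; apply: ler_wpM2l.
Qed.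

(** * Pairing a function that satisfies (ii) with such a test function *)

Variable f : R -> R.
Hypothesis Lf : L1 a f.
Variable A : R.
Hypothesis FA : forall N, \sum_(1 <= m < N.+1) JJ a (fun l => `|hat a f l|) m ^+ 2 / pn m <= A.

Let F := hat a f.
Let Fm : measurable_fun setT F. Proof. exact: hat_meas. Qed.
Let Fb l : `|F l| <= nrm a f. Proof. exact: hat_bnd. Qed.

Let Gf k l := `|F l * (Gs (en k) l * h l * W a l)|.

Let Gf_ig k : ig (Gf k).
Proof.
apply: ig_abs; apply: eq_ig (L1_bnd a _ F (nrm a f) (GL1 a a0 phi (en k) L (en_gt0 k)) Fm Fb).
by move=> l; rewrite mulrCA.
Qed.

Let IGf_ig k m : ig (fun l => Ii m l * Gf k l).
Proof.
apply: (ig_dom (Gf k)); [by apply: measurable_funM; [exact: In_meas|exact: ig_meas (Gf_ig k)]|exact: Gf_ig|move=> l].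
rewrite normrM (ger0_norm (Ii_ge0 m l)) normr_id InE.
by case: (_ <= _ < _); [rewrite mul1r|rewrite mul0r; exact: normr_ge0].
Qed.

Let piece k m : it (fun l => Ii m.+1 l * Gf k l) <= Num.sqrt (sup2 m) * JJ a (fun l => `|F l|) m.+1.
Proof.
have i1 : ig (fun l => Ii m.+1 l * (`|F l| * W a l)).
  apply: (In_bnd_ig a a0 (fun l => `|F l|) (nrm a f)); first exact: measurableT_comp.
  by move=> l; rewrite normr_id.
rewrite -(itZ _ _ i1); apply: it_le; [exact: IGf_ig|exact: igZ|move=> l].
rewrite mulrCA InE; case: (boolP (m.+1%:R - 1 <= l < m.+1%:R)) => hl; last by rewrite !mul0r.
rewrite 2!mul1r /Gf normrM mulrCA; apply: ler_wpM2l => //.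
rewrite 2!normrM (ger0_norm (W_ge0 a l)); apply: ler_wpM2r; first exact: W_ge0.
rewrite -[leRHS]mul1r; apply: ler_pM => //.
  by rewrite (ger0_norm (Gs_ge0 _ _)); apply: Gs_le1; exact: ltW (en_gt0 k).
by rewrite -sqrtr_sqr; apply: ler_wsqrtr; exact: sup2E.
Qed.

Let sup2_ge0 m : 0 <= sup2 m.
Proof.
have hm_ : m.+1%:R - 1 <= (m%:R : R) < m.+1%:R by rewrite -(natr1 m) addrK lexx ltrDl ltr01.
exact: le_trans (sqr_ge0 _) (sup2E m m%:R hm_).
Qed.

Let it_Gf k tau : 0 < tau -> it (Gf k) <= 2^-1 * (tau * A + tau^-1 * (DD * (pn n * S))).
Proof.
move=> t0; pose fn M l := \sum_(1 <= m < M.+1) Ii m l * Gf k l.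
have [_ cv] : ig (Gf k) /\ it (fn M) @[M --> \oo] --> it (Gf k).
  apply: (it_dct fn (Gf k) (Gf k)).
  - by move=> M; apply: ig_meas; apply: ig_sum => m; exact: IGf_ig.
  - exact: Gf_ig.
  - move=> M l; rewrite /fn -mulr_suml sum_Ii normrM normr_id.
    by case: (_ <= _ < _); [rewrite normr1 mul1r|rewrite normr0 mul0r; exact: normr_ge0].
  move=> l; have [l0|l0] := ltP l 0.
    rewrite (_ : (fun M => fn M l) = cst (Gf k l)); first exact: cvg_cst.
    apply/funext => M; rewrite /fn -mulr_suml /Gf (W_neg a l (ltW l0)).
    by rewrite !mulr0 normr0 mulr0.
  apply: (@cvg_near_cst _ R^o).
  near=> M; rewrite /fn -mulr_suml sum_Ii l0 /=.
  suff -> : l < M%:R by rewrite mul1r.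
  by near: M; exact: nbhs_infty_gtr.
apply: (cvg_le_cst _ _ _ cv) => M; rewrite /fn it_sum; last by move=> m; exact: IGf_ig.
have := FA M; have := sup2_sum M.
rewrite !big_add1/=; set X := \sum_(0 <= i < M) pn i.+1 * sup2 i; set Y := \sum_(0 <= i < M) _ / _ => XD YA.
apply: (@le_trans _ _ (2^-1 * (tau * Y + tau^-1 * X))).
  rewrite /X /Y [tau * _]mulr_sumr [tau^-1 * _]mulr_sumr -big_split/= mulr_sumr; apply: ler_sum => m _.
  apply: (le_trans (piece k m)); apply: amgm_weighted => //; first exact: pn_gt0.
  exact: sqr_sqrtr.
apply: ler_wpM2l => //; apply: lerD; apply: ler_wpM2l => //; first exact: ltW.
by rewrite invr_ge0 ltW.
Unshelve. all: by end_near. Qed.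

(** On each [I_m] the transform of [phi] is bounded by its supremum and [amgm_weighted] separates
    the factors. The parameter [tau] is left free, to be chosen in [solve_energy]. No sign of the
    transform is assumed, so that the imaginary part is covered too. *)
Lemma pairing_bound tau : 0 < tau ->
  {ae mu, forall x, 0 < x -> phi y @[y --> x] --> phi x} ->
  kpa a * it (fun x => f x * (phi x * W a x)) <= 2^-1 * (tau * A + tau^-1 * (DD * (pn n * S))).
Proof.
move=> t0 phic; apply: (cvg_le_cst _ _ _ (inversion a a0 f phi B Lf L phiB phic)) => k.
have i1 : ig (fun l => F l * (Gs (en k) l * h l * W a l)).
  apply: eq_ig (L1_bnd a _ F (nrm a f) (GL1 a a0 phi (en k) L (en_gt0 k)) Fm Fb).
  by move=> l; rewrite mulrCA.
apply: le_trans (it_Gf k tau t0); apply: (le_trans (ler_norm _)); exact: it_norm i1.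
Qed.

End sobolev.
End AmalgamToLocal.

(** * From the amalgam space to local energy bounds *)

(** This [tau] makes the second term equal to [k * q / 2], half of the left-hand side. *)
Lemma solve_energy (R : realType) (k D P A q : R) : 0 < k -> 0 < D -> 0 < P ->
  let tau := D * P / k in
  k * q <= 2^-1 * (tau * A + tau^-1 * (D * (P * q))) -> q <= D * P * A / k ^+ 2.
Proof.
move=> k0 D0 P0 /=; have -> : (D * P / k)^-1 * (D * (P * q)) = k * q by field; rewrite !gt_eqF.
move=> h; rewrite ler_pdivlMr ?exprn_gt0// -(ler_pM2l k0).
have -> : k * (D * P * A) = k ^+ 2 * (D * P / k * A) by field; rewrite gt_eqF.
have -> : k * (q * k ^+ 2) = k ^+ 2 * (k * q) by ring.
rewrite ler_pM2l ?exprn_gt0//; lra.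
Qed.

Section LocalEnergy.
Context {R : realType}.
Local Notation mu := (@lebesgue_measure R).
Variable a : R.
Hypothesis a0 : 2^-1 <= a.

(** Values beyond [K] become 0, not [K] or [-K]: then [f] times its truncation is exactly the square
    of the truncation (see [fp]), and the pairing is an energy. *)
Definition trunc (K y : R) : R := if `|y| <= K then y else 0.

Lemma trunc_meas (h : R -> R) K : measurable_fun setT h -> measurable_fun setT (fun x => trunc K (h x)).
Proof.
move=> mh; apply: measurable_fun_ifT => //; apply: measurable_fun_ler => //.
exact: measurableT_comp.
Qed.

Lemma trunc_bnd (K y : R) : 0 <= K -> `|trunc K y| <= K.
Proof. by move=> K0; rewrite /trunc; case: ifP => // _; rewrite normr0. Qed.

Variables (f : R -> R) (A : R) (n : nat).
Hypotheses (Lf : L1 a f) (n0 : (0 < n)%N).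
Hypothesis FA : forall N, \sum_(1 <= m < N.+1) JJ a (fun l => `|hat a f l|) m ^+ 2 / pn a m <= A.

Let E : R -> R := \1_`[(n%:R - 1), n%:R].

Let EE x : E x = (n%:R - 1 <= x <= n%:R)%R%:R.
Proof. by rewrite /E indicE mem_setE in_itv. Qed.

Let E_ge0 x : 0 <= E x. Proof. by rewrite EE. Qed.

Let E_meas : measurable_fun setT E. Proof. exact: measurable_indic. Qed.

(** The product can jump only at the two ends of the interval, a null set. *)
Let E_ae_cont (g : R -> R) : continuous g ->
  {ae mu, forall x : R, 0 < x -> (E y * g y) @[y --> x] --> E x * g x}.
Proof.
move=> gc; have N : mu.-negligible ([set n%:R - 1 : R] `|` [set n%:R]).
  by apply: negligibleU; apply/negligibleP => //; exact: lebesgue_measure_set1.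
apply: negligibleS N => x /= /not_implyP[x0 H].
apply: contrapT => /not_orP[/eqP h1 /eqP h2]; apply: H.
apply: cvgM; last exact: gc.
rewrite /=; case: (ltgtP x (n%:R - 1)) h1 => // h1 _.
  apply: (@cvg_near_cst _ R^o); near=> y; rewrite !EE (lt_geF h1)/=.
  by rewrite (lt_geF (_ : y < n%:R - 1))//; near: y; exact: lt_nbhsl.
case: (ltgtP x n%:R) h2 => // h2 _.
  apply: (@cvg_near_cst _ R^o); near=> y; rewrite !EE (ltW h1) (ltW h2)/=.
  have -> : n%:R - 1 <= y by apply: ltW; near: y; exact: lt_nbhsr.
  by have -> : y <= n%:R by apply: ltW; near: y; exact: lt_nbhsl.
apply: (@cvg_near_cst _ R^o); near=> y; rewrite !EE (lt_geF h2) andbF.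
by rewrite (lt_geF (_ : n%:R < y)) ?andbF//; near: y; exact: lt_nbhsr.
Unshelve. all: by end_near. Qed.

Variable K : R.
Hypothesis K0 : 0 <= K.

Let p x := E x * trunc K (f x).
Let q := it (fun x => p x ^+ 2 * W a x).

Let fm : measurable_fun setT f. Proof. by case: Lf. Qed.
Let pm : measurable_fun setT p. Proof. by apply: measurable_funM => //; exact: trunc_meas. Qed.
Let E_le1 x : `|E x| <= 1. Proof. by rewrite EE; case: (_ <= _ <= _); rewrite ?normr1 ?normr0. Qed.
Let pb x : `|p x| <= K.
Proof. by rewrite normrM -[leRHS]mul1r; apply: ler_pM => //; exact: trunc_bnd. Qed.

Let fp x : f x * p x = p x ^+ 2.
Proof.
rewrite /p EE /trunc; case: (_ <= _ <= _); case: (_ <= _); rewrite ?mul1r ?mul0r ?mulr0 ?expr0n ?expr2//.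
Qed.

Let pE x : p x = E x * p x.
Proof. by rewrite /p EE; case: (_ <= _ <= _); rewrite ?mul1r ?mul0r. Qed.

Let EW x : E x * W a x <= pn a n * E x.
Proof.
rewrite EE; case: (boolP (n%:R - 1 <= x <= n%:R)) => [/andP[_ hx]|_]; last by rewrite mul0r mulr0.
by rewrite mul1r mulr1 W_pw; apply: pw_le => //; have := a0; lra.
Qed.

Let tail_meas N : measurable_fun setT (fun x => `|f x - trunc N%:R (f x)|).
Proof. by apply: measurableT_comp => //; apply: measurable_funB => //; exact: trunc_meas. Qed.

Let tail_le (N : nat) x : `|f x - trunc N%:R (f x)| <= `|f x|.
Proof. by rewrite /trunc; case: ifP => _; rewrite ?subrr ?normr0 ?subr0. Qed.

Let eta (N : nat) := it (fun x => `|f x - trunc N%:R (f x)| * W a x).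

Let tail_dom N x : `| `|f x - trunc N%:R (f x)| * W a x | <= `|f x| * W a x.
Proof.
rewrite normrM normr_id (ger0_norm (W_ge0 a x)); apply: ler_wpM2r; [exact: W_ge0|exact: tail_le].
Qed.

Let tail_mW N : measurable_fun setT (fun x => `|f x - trunc N%:R (f x)| * W a x).
Proof. by apply: measurable_funM; [exact: tail_meas|exact: W_meas]. Qed.

Let eta_ig N : ig (fun x => `|f x - trunc N%:R (f x)| * W a x).
Proof. exact: ig_dom (tail_mW N) (L1_abs a f Lf) (tail_dom N). Qed.

Let eta_cvg : eta N @[N --> \oo] --> 0.
Proof.
rewrite -[X in _ --> X](@it0 R).
apply: (it_dct (fun N x => `|f x - trunc N%:R (f x)| * W a x) _ (fun x => `|f x| * W a x) _ _ _ _).2.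
- exact: tail_mW.
- exact: L1_abs.
- exact: tail_dom.
move=> x; apply: (@cvg_near_cst _ R^o); near=> N.
suff -> : trunc N%:R (f x) = f x by rewrite subrr normr0 mul0r.
by rewrite /trunc ifT//; near: N; exact: nbhs_infty_ger.
Unshelve. all: by end_near. Qed.

Let dd (g : R -> R) := it (fun x => E x * `|p x - g x|).

(** The truncated function [p] is not continuous, so inversion is applied to [E * g] with [g] close
    to [p]. As [f] is unbounded, the error in the pairing is split at height [N]: the bounded part
    costs [N] times the distance [dd g], the tail costs [2 * K * eta N]. *)
Let approx_step (g : R -> R) (N : nat) tau : 0 < tau -> continuous g -> (forall x, `|g x| <= K) ->
  kpa a * q <= 2^-1 * (tau * A + tau^-1 * (DD a * (pn a n * (q + 2 * K * (pn a n * dd g)))))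
     + kpa a * (N%:R * (pn a n * dd g) + 2 * K * eta N).
Proof.
move=> t0 gc gK; set d := dd g.
have gm : measurable_fun setT g by exact: continuous_measurable_fun.
pose phi x := E x * g x.
have phm : measurable_fun setT phi by exact: measurable_funM.
have phb x : `|phi x| <= K by rewrite normrM -[leRHS]mul1r; apply: ler_pM.
have phI x : ~~ (n%:R - 1 <= x <= n%:R) -> phi x = 0 by move=> /negPf h; rewrite /phi EE h mul0r.
have pI x : ~~ (n%:R - 1 <= x <= n%:R) -> p x = 0 by move=> /negPf h; rewrite /p EE h mul0r.
have n1 : 1 <= n%:R :> R by rewrite ler1n.
have I0 (x : R) : ~~ (0 <= x <= n%:R) -> ~~ (n%:R - 1 <= x <= n%:R).
  by apply: contra => /andP[h1 ->]; rewrite andbT; apply: le_trans h1; rewrite subr_ge0.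
have iS : ig (fun x => phi x ^+ 2 * W a x) by apply: (supp_sqr a a0 phi K n%:R phm phb) => x /I0; exact: phI.
have iq : ig (fun x => p x ^+ 2 * W a x) by apply: (supp_sqr a a0 p K n%:R pm pb) => x /I0; exact: pI.
have dK x : `|p x - g x| <= 2 * K.
  by rewrite mulr_natl mulr2n; apply: (le_trans (ler_normB _ _)); apply: lerD.
have id_ : ig (fun x => E x * `|p x - g x|).
  apply: (ig_dom (fun x => (2 * K) * E x)); first by apply: measurable_funM => //; apply: measurableT_comp => //; exact: measurable_funB.
    by apply: igZ; exact: ig_indic_bnd.
  move=> x; rewrite normrM normr_id (ger0_norm (E_ge0 x)) mulrC; apply: ler_wpM2r => //.
have pn0 : 0 < pn a n by exact: pn_gt0.
have dW x : E x * `|p x - g x| * W a x <= pn a n * (E x * `|p x - g x|).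
  by rewrite mulrAC [leRHS]mulrA; apply: ler_wpM2r.
have S_le : it (fun x => phi x ^+ 2 * W a x) <= q + 2 * K * (pn a n * d).
  rewrite -(itZ _ _ id_) -(itZ _ _ (igZ _ _ id_)) -(itD _ _ iq (igZ _ _ (igZ _ _ id_))).
  apply: it_le; [exact: iS|by apply: igD; [exact: iq|exact: igZ (igZ _ _ id_)]|move=> x].
  apply: (@le_trans _ _ (p x ^+ 2 * W a x + 2 * K * (E x * `|p x - g x| * W a x))); last first.
    by rewrite lerD2l; apply: ler_wpM2l => //; exact: mulr_ge0.
  rewrite mulrA -mulrDl; apply: ler_wpM2r; first exact: W_ge0.
  have -> : E x * `|p x - g x| = `|phi x - p x|.
    by rewrite pE distrC -mulrBr normrM (ger0_norm (E_ge0 x)) -pE.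
  rewrite -lerBlDl subr_sqr; apply: le_trans (ler_norm _) _; rewrite normrM mulrC.
  apply: ler_wpM2r => //; apply: le_trans (ler_normD _ _) _; rewrite mulr_natl mulr2n; exact: lerD.
have if1 : ig (fun x => f x * (phi x * W a x)) by exact: L1_bnd a f phi K Lf phm phb.
have if2 : ig (fun x => f x * (p x * W a x)) by exact: L1_bnd a f p K Lf pm pb.
have qE : q = it (fun x => f x * (p x * W a x)) by apply: eq_it => x; rewrite mulrA fp.
have q_le : q <= it (fun x => f x * (phi x * W a x)) + (N%:R * (pn a n * d) + 2 * K * eta N).
  have i3 := igZ _ N%:R (igZ _ (pn a n) id_); have i4 := igZ _ (2 * K) (eta_ig N).
  rewrite qE -(itZ _ _ id_) -(itZ _ _ (igZ _ _ id_)) -(itZ _ _ (eta_ig N)) -(itD _ _ i3 i4) -(itD _ _ if1 (igD _ _ i3 i4)).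
  apply: it_le; [exact: if2|by apply: igD => //; exact: igD|move=> x].
  apply: (@le_trans _ _ (f x * (phi x * W a x) + (N%:R * (E x * `|p x - g x| * W a x) + 2 * K * (`|f x - trunc N%:R (f x)| * W a x)))); last first.
    by rewrite lerD2l lerD2r; apply: ler_wpM2l.
  have -> : f x * (phi x * W a x) + (N%:R * (E x * `|p x - g x| * W a x) + 2 * K * (`|f x - trunc N%:R (f x)| * W a x)) =
     (f x * phi x + (N%:R * (E x * `|p x - g x|) + 2 * K * `|f x - trunc N%:R (f x)|)) * W a x.
    by move: (p x) (phi x) (trunc _ _) => px phx tx; ring.
  rewrite [f x * (p x * _)]mulrA; apply: ler_wpM2r; first exact: W_ge0.
  rewrite -lerBlDl -mulrBr; apply: le_trans (ler_norm _) _; rewrite normrM.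
  have -> : `|p x - phi x| = E x * `|p x - g x|.
    by rewrite [in LHS]pE -mulrBr normrM (ger0_norm (E_ge0 x)).
  have fN : `|f x| <= N%:R + `|f x - trunc N%:R (f x)|.
    by rewrite /trunc; case: ifP => hN; rewrite ?subr0 ?lerDr// subrr normr0 addr0.
  have e1 : E x * `|p x - g x| <= 2 * K.
    by rewrite -[leRHS]mul1r; apply: ler_pM => //; rewrite -(ger0_norm (E_ge0 x)).
  apply: (@le_trans _ _ ((N%:R + `|f x - trunc N%:R (f x)|) * (E x * `|p x - g x|))).
    by apply: ler_wpM2r => //; exact: mulr_ge0.
  rewrite mulrDl lerD2l mulrC; exact: ler_wpM2r.
have k0 := kpa_gt0 a a0.
have PB := pairing_bound a a0 phi K n n0 phm phb phI f Lf A FA tau t0 (E_ae_cont g gc).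
apply: (@le_trans _ _ (kpa a * (it (fun x => f x * (phi x * W a x)) + (N%:R * (pn a n * d) + 2 * K * eta N)))).
  by apply: ler_wpM2l => //; exact: ltW.
rewrite mulrDr lerD2r; apply: (le_trans PB).
apply: ler_wpM2l => //; rewrite lerD2l; apply: ler_wpM2l; first by rewrite invr_ge0 ltW.
apply: ler_wpM2l; first exact: ltW (DD_gt0 a a0).
by apply: ler_wpM2l => //; exact: ltW.
Qed.

(** The order of limits matters: the approximation is refined at fixed [N], which kills [N * dd],
    and only then does [N] go to infinity. *)
Lemma trunc_energy : it (fun x => (E x * trunc K (f x)) ^+ 2 * W a x) <= DD a * pn a n * A / kpa a ^+ 2.
Proof.
have [g [gc gK gd]] := cont_approx (n%:R - 1) n%:R K p pm pb.
have k0 := kpa_gt0 a a0; have D0 := DD_gt0 a a0; have P0 := pn_gt0 a n n0.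
pose tau := DD a * pn a n / kpa a.
have t0 : 0 < tau by apply: divr_gt0 => //; exact: mulr_gt0.
have H1 N : kpa a * q <= 2^-1 * (tau * A + tau^-1 * (DD a * (pn a n * (q + 2 * K * (pn a n * 0)))))
     + kpa a * (N%:R * (pn a n * 0) + 2 * K * eta N).
  apply: (cvg_ge_cst (fun j => 2^-1 * (tau * A + tau^-1 * (DD a * (pn a n * (q + 2 * K * (pn a n * it (fun x => E x * `|p x - g j x|))))))
     + kpa a * (N%:R * (pn a n * it (fun x => E x * `|p x - g j x|)) + 2 * K * eta N))); last first.
    by move=> j; exact: approx_step.
  apply: cvgD; apply: cvgMl_tmp.
    apply: cvgD; first exact: cvg_cst.
    do 3 apply: cvgMl_tmp; apply: cvgD; first exact: cvg_cst.
    by do 2 apply: cvgMl_tmp.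
  by apply: cvgD; [do 2 apply: cvgMl_tmp|exact: cvg_cst].
have H2 : kpa a * q <= 2^-1 * (tau * A + tau^-1 * (DD a * (pn a n * (q + 2 * K * (pn a n * 0)))))
     + kpa a * (0 + 2 * K * 0).
  apply: (cvg_ge_cst (fun N => 2^-1 * (tau * A + tau^-1 * (DD a * (pn a n * (q + 2 * K * (pn a n * 0)))))
     + kpa a * (0 + 2 * K * eta N))).
    apply: cvgD; first exact: cvg_cst.
    by apply: cvgMl_tmp; apply: cvgD; [exact: cvg_cst|exact: cvgMl_tmp].
  by move=> N; have := H1 N; rewrite mulr0 mulr0 mulr0.
apply: solve_energy => //=; rewrite -/tau -/q; move: H2.
by rewrite !mulr0 !addr0 mulr0 addr0.
Qed.

End LocalEnergy.

(** * The equivalence *)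

Section Assembly.
Context {R : realType}.
Local Notation mu := (@lebesgue_measure R).
Variable a : R.
Hypothesis a0 : 2^-1 <= a.

Let a_gt0 : 0 < a.
Proof. by apply: lt_le_trans a0; rewrite invr_gt0. Qed.

Lemma local_energy (f : R -> R) A n : L1 a f -> (0 < n)%N ->
  (forall N, \sum_(1 <= m < N.+1) JJ a (fun l => `|hat a f l|) m ^+ 2 / pn a m <= A) ->
  ig (fun x => \1_`[(n%:R - 1), n%:R] x * (f x ^+ 2 * W a x)) /\
  it (fun x => \1_`[(n%:R - 1), n%:R] x * (f x ^+ 2 * W a x)) <= DD a * pn a n * A / kpa a ^+ 2.
Proof.
move=> Lf n0 FA; have [fm _] := Lf.
pose E : R -> R := \1_`[(n%:R - 1), n%:R].
have E01 x : E x = 0 \/ E x = 1 by rewrite /E indicE; case: (_ \in _); [right|left].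
have n1 : 1 <= n%:R :> R by rewrite ler1n.
have gm k : measurable_fun setT (fun x => E x * trunc k%:R (f x)).
  by apply: measurable_funM; [exact: measurable_indic|exact: trunc_meas].
have gb k x : `|E x * trunc k%:R (f x)| <= k%:R.
  by rewrite normrM; case: (E01 x) => ->; rewrite ?normr0 ?mul0r// normr1 mul1r trunc_bnd.
apply: (ig_monotone (fun k x => (E x * trunc k%:R (f x)) ^+ 2 * W a x)).
- move=> k; apply: (supp_sqr a a0 _ k%:R n%:R (gm k) (gb k)) => x hx.
  rewrite /E indicE mem_setE in_itv/=; case: (boolP (n%:R - 1 <= x <= n%:R)); last by rewrite mul0r.
  by move=> /andP[h1 h2]; move: hx; rewrite h2 andbT (le_trans _ h1)// subr_ge0.
- by move=> k x; exact: mulr_ge0 (sqr_ge0 _) (W_ge0 _ _).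
- move=> x k m km; apply: ler_wpM2r; first exact: W_ge0.
  rewrite !exprMn; apply: ler_wpM2l; first exact: sqr_ge0.
  rewrite /trunc; case: ifP => hk; last by rewrite expr0n /= sqr_ge0.
  by rewrite (le_trans hk)// ler_nat.
- move=> x; apply: (@cvg_near_cst _ R^o); near=> k.
  rewrite /trunc ifT; last by near: k; exact: nbhs_infty_ger.
  by rewrite exprMn -mulrA -/(E x); case: (E01 x) => ->; rewrite ?expr0n ?expr1n.
- by move=> k; exact: (trunc_energy a a0 f A n Lf n0 FA k%:R).
Unshelve. all: by end_near. Qed.

(** Extension by 0: the given functions are measurable and integrable on [[0, +oo[] and arbitrary
    elsewhere, while [ig] and [it] look at the whole line. *)
Definition half (h : R -> R) x : R := \1_`[0, +oo[ x * h x.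

Lemma half_pos h x : 0 <= x -> half h x = h x.
Proof. by move=> x0; rewrite /half indicE mem_setE in_itv/= x0 mul1r. Qed.

Lemma half_meas h : measurable_fun `[(0%R : R), +oo[ h -> measurable_fun setT (half h).
Proof.
have mD : measurable (`[0, +oo[%classic : set R) by exact: measurable_itv.
move=> /(measurable_restrictT _ mD).1; rewrite patch_indic.
by rewrite (_ : (h \* _) = half h)//; apply/funext => x; rewrite /half mulrC.
Qed.

Lemma W_wgt x : 0 <= x -> W a x = wgt a x.
Proof.
rewrite le_eqVlt => /predU1P[<-|x0]; last by rewrite W_pw pw_pos.
by rewrite W_neg// /wgt powR0// gt_eqF//; have := a_gt0; lra.
Qed.

Lemma half_wgt h x : \1_`[0, +oo[ x * (h x * wgt a x) = half h x * W a x.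
Proof.
have [x0|x0] := leP 0 x; last by rewrite /half indicE mem_setE in_itv/= leNgt x0 /= !mul0r.
by rewrite W_wgt// /half mulrA.
Qed.

Lemma int_half h : (\int[mu]_(x in `[(0%R : R), +oo[) (h x * wgt a x)%:E)%E = (\int[mu]_x (half h x * W a x)%:E)%E.
Proof.
rewrite it_indic; last exact: measurable_itv.
by apply: eq_integral => x _; rewrite half_wgt.
Qed.

(** Index 0 is excluded because [In 0] is [[-1, 0)], and on negative numbers [powR] takes the value
    1 while [W] is 0. *)
Lemma int_In h n : (0 < n)%N ->
  (\int[mu]_(x in @In R n) (h x * wgt a x)%:E)%E = (\int[mu]_x (Ii n x * (half h x * W a x))%:E)%E.
Proof.
move=> n0; rewrite it_indic; last exact: measurable_itv.
apply: eq_integral => x _; congr (_%:E); rewrite -half_wgt.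
have -> : \1_(@In R n) x = Ii n x by [].
rewrite InE; case: (boolP (n%:R - 1 <= x < n%:R)) => [/andP[h1 _]|_]; last by rewrite !mul0r.
have x0 : 0 <= x by apply: le_trans h1; rewrite subr_ge0 ler1n.
by rewrite indicE mem_setE in_itv/= x0 !mul1r.
Qed.

Lemma fhat_hat u l : L1 a (half u) -> fhat_re a u l = (hat a (half u) l)%:E.
Proof.
move=> Lu; rewrite /fhat_re (int_half (fun x => u x * j_alpha a (l * x))) /hat.
rewrite -(it_fin _ (hat_ig a a0 _ l Lu)); apply: eq_integral => x _; congr (_%:E).
by rewrite /half -!mulrA.
Qed.

Let om n := it (fun x => Ii n x * W a x).

Let om_ig n : ig (fun x => @Ii R n x * W a x).
Proof.
apply: eq_ig (In_bnd_ig a a0 (fun=> 1) 1 n _ _) => [x||x]; first by rewrite mul1r.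
- exact: measurable_cst.
- by rewrite normr1.
Qed.

Lemma omega_nE n : (0 < n)%N -> omega_n a n = om n.
Proof.
move=> n0; rewrite /omega_n.
have -> : (\int[mu]_(x in @In R n) (wgt a x)%:E)%E = (\int[mu]_(x in @In R n) (1 * wgt a x)%:E)%E.
  by apply: eq_integral => x _; rewrite mul1r.
rewrite (int_In (fun=> 1))// /om.
suff -> : (\int[mu]_x (Ii n x * (half (fun=> 1) x * W a x))%:E)%E = (om n)%:E by [].
rewrite -(it_fin _ (om_ig n)); apply: eq_integral => x _; congr (_%:E).
have [x0|x0] := leP 0 x; first by rewrite half_pos// mul1r.
by rewrite W_neg ?mulr0// ltW.
Qed.

Let om_le n : (0 < n)%N -> om n <= pn a n.
Proof.
move=> n0; rewrite -[leRHS]mulr1 -(Ii_it n) -(itZ _ _ (Ii_ig n)).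
apply: it_le; [exact: om_ig|by apply: igZ; exact: Ii_ig|move=> x].
rewrite InE; case: (boolP (n%:R - 1 <= x < n%:R)) => [/andP[_ hx]|_]; last by rewrite mul0r mulr0.
rewrite mul1r mulr1 W_pw; apply: pw_le; [by have := a_gt0; lra|exact: ltW].
Qed.

(** The part [[n - 1/2, n - 1/4]] of [I_n] has length 1/4 and lies above [n / 2]. *)
Definition omc : R := 4^-1 * pw (2 * a + 1) 2^-1.

Let omc_gt0 : 0 < omc.
Proof. by apply: mulr_gt0; rewrite ?invr_gt0//; apply: pw_gt0; rewrite invr_gt0. Qed.

Let om_ge n : (0 < n)%N -> omc * pn a n <= om n.
Proof.
move=> n0; have n1 : 1 <= n%:R :> R by rewrite ler1n.
have n12 : n%:R - 2^-1 < n%:R - 4^-1 :> R by lra.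
have nE : (n%:R - 4^-1) - (n%:R - 2^-1) = 4^-1 :> R by lra.
have -> : omc * pn a n = it (fun x => (pw (2 * a + 1) 2^-1 * pn a n) * \1_`[n%:R - 2^-1, n%:R - 4^-1] x).
  by rewrite (itZ _ _ (ig_indic_bnd _ _)) (it_indic_itv _ _ n12) nE /omc; ring.
apply: it_le; [by apply: igZ; exact: ig_indic_bnd|exact: om_ig|move=> x].
rewrite InE indicE mem_setE in_itv/=.
case: (boolP (n%:R - 2^-1 <= x <= n%:R - 4^-1)) => [/andP[h1 h2]|_]; last first.
  by rewrite mulr0; apply: mulr_ge0 => //; exact: W_ge0.
have -> : n%:R - 1 <= x by lra.
have -> : x < n%:R by lra.
rewrite mulr1 mul1r W_pw /pn -pwM; [|lra|lra].
by apply: pw_le; [have := a_gt0; lra|lra].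
Qed.

Let om_gt0 n : (0 < n)%N -> 0 < om n.
Proof. by move=> n0; apply: lt_le_trans (om_ge n n0); apply: mulr_gt0 => //; exact: pn_gt0. Qed.

Lemma JJ_ge0 (F : R -> R) n : (forall l, 0 <= l -> 0 <= F l) -> 0 <= JJ a F n.
Proof.
move=> F0; apply: it_ge0 => l; apply: mulr_ge0; first exact: Ii_ge0.
have [l0|l0] := leP 0 l; first exact: mulr_ge0 (F0 l l0) (W_ge0 _ _).
by rewrite W_neg ?mulr0// ltW.
Qed.

Lemma poweR_half_lty (x : \bar R) : (poweR x (1 / 2) < +oo)%E = (x < +oo)%E.
Proof.
apply/idP/idP; first by apply: lty_poweRy; rewrite mul1r invr_neq0.
exact: poweR_lty.
Qed.

(** For exponents 1 and 2 each term is [om * (JJ / om)^2], that is [JJ^2 / om]. *)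
Lemma amalgam_12E (g F : R -> R) : measurable_fun setT F -> (exists C, forall l, `|F l| <= C) ->
  (forall l, 0 <= l -> 0 <= F l) -> (forall l, 0 <= l -> g l = F l) ->
  amalgam_norm a 1 2 g = poweR (\sum_(1 <= n <oo) (JJ a F n ^+ 2 / om n)%:E)%E (1 / 2).
Proof.
move=> Fm [C FC] F0 gF; rewrite /amalgam_norm; congr poweR.
congr (limn _); apply/funext => N; apply: eq_big_nat => n /andP[n0 _].
have Ji : ig (fun l => Ii n l * (F l * W a l)) by exact: In_bnd_ig.
rewrite /local_mean (omega_nE n n0) (int_In (fun x => g x `^ 1))//.
have -> : (\int[mu]_x (Ii n x * (half (fun x => g x `^ 1) x * W a x))%:E)%E = (JJ a F n)%:E.
  rewrite -(it_fin _ Ji); apply: eq_integral => x _; congr (_%:E).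
  have [x0|x0] := leP 0 x; last by rewrite W_neg ?mulr0// ltW.
  by rewrite half_pos// gF// powRr1// F0.
rewrite -(EFinM (om n)^-1 (JJ a F n)) poweR_EFin divr1 powR_mulrn; last first.
  by apply: mulr_ge0; [rewrite invr_ge0 ltW// om_gt0|exact: JJ_ge0].
rewrite -EFinM; congr (_%:E); have /gt_eqF/negbT := om_gt0 n n0.
by move: (om n) (JJ a F n) => o J o0; field.
Qed.

Lemma nneseries_ltyP (t : nat -> R) : (forall n, (0 < n)%N -> 0 <= t n) ->
  ((\sum_(1 <= n <oo) (t n)%:E < +oo)%E <-> exists A, forall N, \sum_(1 <= n < N.+1) t n <= A).
Proof.
move=> t0; have t0' n : (1 <= n)%N -> true -> (0 <= (t n)%:E)%E by move=> n0 _; rewrite lee_fin t0.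
split.
  move=> h; have f : (\sum_(1 <= n <oo) (t n)%:E)%E \is a fin_num.
    by rewrite ge0_fin_numE//; exact: nneseries_ge0.
  exists (fine (\sum_(1 <= n <oo) (t n)%:E)%E) => N.
  by rewrite -lee_fin fineK// -sumEFin; exact: nneseries_lim_ge.
move=> [A hA]; apply: (@le_lt_trans _ _ A%:E); last exact: ltry.
apply: lime_le; first exact: is_cvg_nneseries.
near=> N; rewrite sumEFin lee_fin.
have N0 : (0 < N)%N by near: N; exists 1%N.
by rewrite -(prednK N0).
Unshelve. all: by end_near. Qed.

(** * The three statements for the given function [u + i v] *)

Variables (u v : R -> R).
Hypothesis uv1 : in_L1 a u v.
Hypothesis fh : forall l, 0 <= l -> (0 <= fhat_re a u l)%E /\ fhat_im a v l = 0%E.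

Let U := half u.
Let V := half v.

Let um : measurable_fun setT U. Proof. by apply: half_meas; case: uv1. Qed.
Let vm : measurable_fun setT V. Proof. by apply: half_meas; case: uv1 => _ []. Qed.

Let cmod_m : measurable_fun `[(0%R : R), +oo[ (cmod u v).
Proof.
have [mu_ [mv_ _]] := uv1.
have ms : measurable_fun `[(0%R : R), +oo[ (fun x => u x ^+ 2 + v x ^+ 2).
  by apply: measurable_funD; exact: measurable_funX.
exact: (measurableT_comp (continuous_measurable_fun (@sqrt_continuous R)) ms).
Qed.

Let CW_ig : ig (fun x => half (cmod u v) x * W a x).
Proof.
apply: ig_fin.
- by apply: measurable_funM; [exact: half_meas|exact: W_meas].
- move=> x; apply: mulr_ge0; last exact: W_ge0.
  by apply: mulr_ge0 => //; exact: sqrtr_ge0.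
- by rewrite -int_half; case: uv1 => _ [].
Qed.

Let cmod_sqr x : cmod u v x ^+ 2 = u x ^+ 2 + v x ^+ 2.
Proof. by rewrite sqr_sqrtr// addr_ge0// sqr_ge0. Qed.

Let Lu : L1 a U.
Proof.
split=> //; apply: ig_dom CW_ig _; first by apply: measurable_funM; [exact: um|exact: W_meas].
move=> x; rewrite normrM (ger0_norm (W_ge0 a x)); apply: ler_wpM2r; first exact: W_ge0.
rewrite normrM ger0_norm//; apply: ler_wpM2l => //; rewrite -sqrtr_sqr; apply: ler_wsqrtr.
by rewrite lerDl sqr_ge0.
Qed.

Let Lv : L1 a V.
Proof.
split=> //; apply: ig_dom CW_ig _; first by apply: measurable_funM; [exact: vm|exact: W_meas].
move=> x; rewrite normrM (ger0_norm (W_ge0 a x)); apply: ler_wpM2r; first exact: W_ge0.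
rewrite normrM ger0_norm//; apply: ler_wpM2l => //; rewrite -sqrtr_sqr; apply: ler_wsqrtr.
by rewrite lerDr sqr_ge0.
Qed.

Let F := hat a U.
Let G := hat a V.

Let F0 l : 0 <= l -> 0 <= F l.
Proof. by move=> l0; have [h _] := fh l l0; move: h; rewrite fhat_hat// lee_fin. Qed.

Let G0 l : 0 <= l -> G l = 0.
Proof. by move=> l0; have [_ h] := fh l l0; move: h; rewrite -[fhat_im _ _ _]/(fhat_re a v l) fhat_hat// => -[]. Qed.

Let fabsE l : fhat_abs a u v l = Num.sqrt (F l ^+ 2 + G l ^+ 2).
Proof. by rewrite /fhat_abs -[fhat_im _ _ _]/(fhat_re a v l) !fhat_hat. Qed.

Let fabs_m : measurable_fun `[(0%R : R), +oo[ (fhat_abs a u v).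
Proof.
apply: measurable_funTS; rewrite (_ : fhat_abs a u v = fun l => Num.sqrt (F l ^+ 2 + G l ^+ 2)); last exact/funext.
have ms : measurable_fun setT (fun l => F l ^+ 2 + G l ^+ 2).
  by apply: measurable_funD; apply: measurable_funX; exact: hat_meas.
exact: (measurableT_comp (continuous_measurable_fun (@sqrt_continuous R)) ms).
Qed.

Let fabs_pos l : 0 <= l -> fhat_abs a u v l = F l.
Proof. by move=> l0; rewrite fabsE G0// expr0n/= addr0 sqrtr_sqr ger0_norm ?F0. Qed.

Let amal_lty : (amalgam_norm a 1 2 (fhat_abs a u v) < +oo)%E <->
  exists A, forall N, \sum_(1 <= n < N.+1) JJ a F n ^+ 2 / om n <= A.
Proof.
rewrite (amalgam_12E (fhat_abs a u v) F) ?poweR_half_lty//; last 2 first.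
- exact: hat_meas.
- by exists (nrm a U) => l; exact: hat_bnd.
apply: (nneseries_ltyP (fun n => JJ a F n ^+ 2 / om n)) => n n0; apply: divr_ge0; [exact: sqr_ge0|exact: ltW (om_gt0 n n0)].
Qed.

Lemma local_to_amalgam (d : R) : 0 < d ->
  (\int[mu]_(x in `[(0%R : R), d]) ((cmod u v x) ^+ 2 * wgt a x)%:E < +oo)%E ->
  (amalgam_norm a 1 2 (fhat_abs a u v) < +oo)%E.
Proof.
move=> d0 hd; apply/amal_lty.
(* The bump lives on [[0, 2 * sg]], which must lie in [[0, d]]; the bound 1/6 is the one required by
   [KK_lower]. *)
pose sg := Num.min (d / 2) 6^-1.
have sg0 : 0 < sg by rewrite lt_min divr_gt0//= invr_gt0.
have sg6 : sg <= 6^-1 by rewrite ge_min lexx orbT.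
have sgd : 2 * sg <= d by rewrite mulrC -ler_pdivlMr// ge_min lexx.
have h2m : measurable_fun setT (fun x => \1_`[0, d] x * (half (cmod u v) x ^+ 2 * W a x)).
  apply: measurable_funM; first exact: measurable_indic.
  by apply: measurable_funM; [apply: measurable_funX; exact: half_meas|exact: W_meas].
have h2 : ig (fun x => \1_`[0, d] x * (half (cmod u v) x ^+ 2 * W a x)).
  apply: ig_fin => //.
    by move=> x; apply: mulr_ge0 => //; exact: mulr_ge0 (sqr_ge0 _) (W_ge0 a x).
  suff <- : (\int[mu]_(x in `[(0%R : R), d]) (cmod u v x ^+ 2 * wgt a x)%:E)%E = (\int[mu]_x (\1_`[0, d] x * (half (cmod u v) x ^+ 2 * W a x))%:E)%E by [].
  rewrite (it_indic `[0, d]); last exact: measurable_itv.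
  apply: eq_integral => x _; congr (_%:E).
  rewrite indicE mem_setE in_itv/=; case: (boolP (0 <= x <= d)) => [/andP[x0 _]|_]; last by rewrite !mul0r.
  by rewrite half_pos// W_wgt.
have h3 : ig (fun x => \1_`[0, 2 * sg] x * (U x ^+ 2 * W a x)).
  apply: ig_dom h2 _.
    apply: measurable_funM; first exact: measurable_indic.
    by apply: measurable_funM; [exact: measurable_funX|exact: W_meas].
  move=> x; rewrite normrM ger0_norm// (ger0_norm (mulr_ge0 (sqr_ge0 _) (W_ge0 a x))).
  rewrite !indicE !mem_setE !in_itv/=; case: (boolP (0 <= x <= 2 * sg)) => [/andP[x0 xs]|_]; last first.
    by rewrite mul0r; apply: mulr_ge0 => //; exact: mulr_ge0 (sqr_ge0 _) (W_ge0 a x).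
  rewrite x0 (le_trans xs sgd) !mul1r; apply: ler_wpM2r; first exact: W_ge0.
  by rewrite /U !half_pos// cmod_sqr lerDl sqr_ge0.
have H := amalgam_partial a a0 U Lu F0 sg sg0 sg6 h3.
eexists => N.
apply: (@le_trans _ _ (omc^-1 * \sum_(1 <= n < N.+1) JJ a F n ^+ 2 / pw (2 * a + 1) n%:R)).
  rewrite mulr_sumr; apply: ler_sum_nat => n /andP[n0 _].
  rewrite mulrCA; apply: ler_wpM2l; first exact: sqr_ge0.
  rewrite -invfM lef_pV2 ?posrE; [exact: om_ge|exact: om_gt0|].
  by apply: mulr_gt0 => //; exact: pn_gt0.
apply: ler_wpM2l; [by rewrite invr_ge0 ltW|exact: (H N)].
Qed.

Lemma amalgam_to_local : (amalgam_norm a 1 2 (fhat_abs a u v) < +oo)%E ->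
  (amalgam_norm_inf a 2 (cmod u v) < +oo)%E.
Proof.
move=> /amal_lty[A HA].
have HF N : \sum_(1 <= m < N.+1) JJ a (fun l => `|hat a U l|) m ^+ 2 / pn a m <= A.
  apply: le_trans (HA N); apply: ler_sum_nat => n /andP[n0 _].
  have -> : JJ a (fun l => `|hat a U l|) n = JJ a F n.
    apply: eq_it => l; have [l0|l0] := leP 0 l; first by rewrite (ger0_norm (F0 l l0)).
    by rewrite W_neg ?mulr0// ltW.
  apply: ler_wpM2l; first exact: sqr_ge0.
  by rewrite lef_pV2 ?posrE; [exact: om_le|exact: pn_gt0|exact: om_gt0].
(* The transform of [V] vanishes on the half-line, so [local_energy] applies to [V] with constant 0.
   No separate uniqueness theorem is invoked. *)
have HG N : \sum_(1 <= m < N.+1) JJ a (fun l => `|hat a V l|) m ^+ 2 / pn a m <= 0.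
  rewrite big1_seq// => n _.
  have -> : JJ a (fun l => `|hat a V l|) n = 0.
    rewrite -[RHS](@it0 R); apply: eq_it => l; have [l0|l0] := leP 0 l; first by rewrite -/(G l) (G0 l l0) normr0 mul0r mulr0.
    by rewrite W_neg ?mulr0// ltW.
  by rewrite expr0n mul0r.
(* The energy on [I_n] is at most [pn n] times the parenthesis, and [pn n / om n <= omc^-1]; hence a
   bound independent of [n]. *)
pose M := omc^-1 * (DD a * A / kpa a ^+ 2).
apply: (@le_lt_trans _ _ (poweR M%:E (1 / 2))); last by rewrite poweR_EFin ltry.
apply: ge_ereal_sup => _ [n /= n0 <-].
have [i1 b1] := local_energy U A n Lu n0 HF; have [i2 b2] := local_energy V 0 n Lv n0 HG.
set E : R -> R := \1_`[(n%:R - 1), n%:R] in i1 b1 i2 b2.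
have cmp x : Ii n x * (half (cmod u v) x ^+ 2 * W a x) <= E x * (U x ^+ 2 * W a x) + E x * (V x ^+ 2 * W a x).
  rewrite InE /E indicE mem_setE in_itv/=; case: (boolP (n%:R - 1 <= x < n%:R)) => [/andP[h1 h2]|_]; last first.
    by rewrite mul0r; apply: addr_ge0; apply: mulr_ge0 => //; exact: mulr_ge0 (sqr_ge0 _) (W_ge0 a x).
  have x0 : 0 <= x by apply: le_trans h1; rewrite subr_ge0 ler1n.
  by rewrite h1 (ltW h2) !mul1r /U /V !half_pos// cmod_sqr mulrDl.
have i3 : ig (fun x => Ii n x * (half (cmod u v) x ^+ 2 * W a x)).
  apply: ig_dom (igD _ _ i1 i2) _.
    apply: measurable_funM; first exact: In_meas.
    by apply: measurable_funM; [apply: measurable_funX; exact: half_meas|exact: W_meas].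
  move=> x; rewrite ger0_norm; first exact: cmp.
  exact: mulr_ge0 (Ii_ge0 n x) (mulr_ge0 (sqr_ge0 _) (W_ge0 a x)).
set q := it (fun x => Ii n x * (half (cmod u v) x ^+ 2 * W a x)).
have q_le : q <= pn a n * (DD a * A / kpa a ^+ 2).
  have -> : pn a n * (DD a * A / kpa a ^+ 2) = DD a * pn a n * A / kpa a ^+ 2 + DD a * pn a n * 0 / kpa a ^+ 2 by ring.
  apply: (le_trans _ (lerD b1 b2)); rewrite -(itD _ _ i1 i2).
  by apply: it_le; [exact: i3|exact: igD|exact: cmp].
have q0 : 0 <= q by apply: it_ge0 => x; exact: mulr_ge0 (Ii_ge0 n x) (mulr_ge0 (sqr_ge0 _) (W_ge0 a x)).
have D0 : 0 <= DD a * A / kpa a ^+ 2.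
  apply: divr_ge0; last exact: sqr_ge0.
  by apply: mulr_ge0; [exact: ltW (DD_gt0 a a0)|have := HA 0%N; rewrite big_geq].
have -> : local_mean a 2 (cmod u v) n = ((om n)^-1 * q)%:E.
  rewrite /local_mean (omega_nE n n0) (int_In (fun x => cmod u v x `^ 2))// EFinM; congr (_ * _)%E.
  rewrite -(it_fin _ i3); apply: eq_integral => x _; congr (_%:E).
  have [x0|x0] := leP 0 x; last by rewrite W_neg ?mulr0// ltW.
  by rewrite !half_pos// powR_mulrn// sqrtr_ge0.
have o0 := om_gt0 n n0; have p0 := pn_gt0 a n n0.
rewrite !poweR_EFin lee_fin; apply: ge0_ler_powR; rewrite ?nnegrE.
- by rewrite mul1r invr_ge0.
- by apply: mulr_ge0 => //; rewrite invr_ge0 ltW.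
- by apply: mulr_ge0 => //; rewrite invr_ge0 ltW.
rewrite ler_pdivrMl//; apply: (le_trans q_le); rewrite /M [leRHS]mulrA; apply: ler_wpM2r => //.
by rewrite ler_pdivlMr// mulrC; exact: om_ge.
Qed.

(** Only the first interval is used. It is [[0, 1)], half-open, so the closed neighbourhood is taken
    with end [1/2]. *)
Lemma amalgam_inf_to_local : (amalgam_norm_inf a 2 (cmod u v) < +oo)%E ->
  (\int[mu]_(x in `[(0%R : R), 2^-1%R]) ((cmod u v x) ^+ 2 * wgt a x)%:E < +oo)%E.
Proof.
move=> h; have : (poweR (local_mean a 2 (cmod u v) 1%N) (1 / 2)%R < +oo)%E.
  by apply: le_lt_trans h; apply: ereal_sup_ubound; exists 1%N.
rewrite poweR_half_lty /local_mean (omega_nE 1%N isT) => h1.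
have o0 : 0 < (om 1%N)^-1 by rewrite invr_gt0; exact: om_gt0.
set X := (\int[mu]_(x in @In R 1) (cmod u v x `^ 2 * wgt a x)%:E)%E in h1.
have : (X < +oo)%E.
  by rewrite ltNge leye_eq; apply/eqP => X1; move: h1; rewrite X1 gt0_muley ?lte_fin// ltxx.
apply: le_lt_trans.
have -> : X = (\int[mu]_(x in @In R 1) (cmod u v x ^+ 2 * wgt a x)%:E)%E.
  by apply: eq_integral => x _; rewrite powR_mulrn// sqrtr_ge0.
have I0 : @In R 1 `<=` `[(0%R : R), +oo[.
  by move=> x; rewrite /In /= !in_itv/= subrr andbT => /andP[].
apply: ge0_subset_integral; [exact: measurable_itv|exact: measurable_itv| | |].
- apply/measurable_EFinP; apply: measurable_funM; last exact: measurable_funTS (measurable_powR _).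
  by apply: measurable_funX; apply: measurable_funS cmod_m; [exact: measurable_itv|exact: I0].
- by move=> x _; rewrite lee_fin; apply: mulr_ge0; [exact: sqr_ge0|exact: powR_ge0].
move=> x; rewrite /In /= !in_itv/= subrr => /andP[-> h2] /=.
by apply: le_lt_trans h2 _; rewrite invf_lt1 ?ltr1n.
Qed.

Lemma equivalence :
  let f_i := exists d : R, 0 < d /\
      (\int[mu]_(x in `[(0%R : R), d]) ((cmod u v x) ^+ 2 * wgt a x)%:E < +oo)%E in
  let f_ii := measurable_fun `[(0%R : R), +oo[ (fhat_abs a u v) /\
      (amalgam_norm a 1 2 (fhat_abs a u v) < +oo)%E in
  let f_iii := measurable_fun `[(0%R : R), +oo[ (cmod u v) /\
      (amalgam_norm_inf a 2 (cmod u v) < +oo)%E in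
  (f_i <-> f_ii) /\ (f_ii <-> f_iii).
Proof.
move=> f_i f_ii f_iii.
have h12 : f_i -> f_ii by move=> [d [d0 hd]]; split; [exact: fabs_m|exact: local_to_amalgam hd].
have h23 : f_ii -> f_iii by move=> [_ h]; split; [exact: cmod_m|exact: amalgam_to_local].
have h31 : f_iii -> f_i.
  by move=> [_ h]; exists 2^-1; split; [rewrite invr_gt0|exact: amalgam_inf_to_local].
by tauto.
Qed.

End Assembly.

Theorem mainTheorem1 (R : realType) (a : R) (u v : R -> R) :
  2^-1 <= a ->
  in_L1 a u v ->
  (forall l : R, 0 <= l -> (0 <= fhat_re a u l)%E /\ fhat_im a v l = 0%E) ->
  let f_i := exists d : R, 0 < d /\
      (\int[@lebesgue_measure R]_(x in `[(0%R : R), d]) ((cmod u v x) ^+ 2 * wgt a x)%:E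
         < +oo)%E in
  let f_ii := measurable_fun `[(0%R : R), +oo[ (fhat_abs a u v) /\
      (amalgam_norm a 1 2 (fhat_abs a u v) < +oo)%E in
  let f_iii := measurable_fun `[(0%R : R), +oo[ (cmod u v) /\
      (amalgam_norm_inf a 2 (cmod u v) < +oo)%E in
  (f_i <-> f_ii) /\ (f_ii <-> f_iii).
Proof. by move=> a0 uv1 fh; exact: equivalence. Qed.
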